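(* Let $n\ge0$ and let $D\subset F_n$ be a (closed, not necessarily open) $\sigma$-invariant normal subgroup that is contained in the Frattini subgroup $\mathrm{Fr}(F_n)$ and invariant under $\mathrm{Aut}_\sigma(F_n)$. Let $G$ be a weak Schur $\sigma$-group with $d_G=n$. If $G_D$ is finite and $D\subset[F_n,F_n]$, then $U_{D,G}$ is an open and closed subset of $\mathrm{Sch}$ of measure $$\mu_\infty(U_{D,G})\ =\ \frac{C_\infty}{|\mathrm{Aut}_\sigma(G_D)|}.$$
   Context: Fix a prime $p>2$ and a group $\{1,\sigma\}$ of order $2$. All homomorphisms of pro-$p$-groups are continuous, all subgroups (including commutator subgroups) are closed, and ''generated'' means topologically generated. A $\sigma$-pro-$p$-group is a pro-$p$-group $G$ with a continuous action of $\{1,\sigma\}$, written $a\mapsto{}^\sigma a$; $\sigma$-homomorphisms and $\sigma$-isomorphisms are the $\sigma$-equivariant ones, and $\mathrm{Aut}_\sigma(G)$ is the group of $\sigma$-equivariant automorphisms. Put $G^-:=\{a\in G\mid {}^\sigma a=a^{-1}\}$. Let $d_G:=\dim_{\mathbb F_p}H^1(G,\mathbb F_p)$ be the minimal number of generators of $G$. Let $D_i(G)$ ($i\ge1$) be the Zassenhaus filtration (dimension subgroups mod $p$): $D_1(G)=G$, and $D_i(G)$ is generated by the $p$-th powers of elements of $D_{\lceil i/p\rceil}(G)$ and all $[D_j(G),D_k(G)]$ with $j+k=i$. $F_n$ is the free pro-$p$-group on $x_1,\dots,x_n$, made a $\sigma$-pro-$p$-group by ${}^\sigma x_i=x_i^{-1}$.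 For $r=(r_1,\dots,r_n)\in(F_n^-)^n$ let $N_r$ be the normal subgroup of $F_n$ generated by all conjugates of $r_1,\dots,r_n$, and $G_r:=F_n/N_r$. A weak Schur $\sigma$-group is a $\sigma$-pro-$p$-group $\sigma$-isomorphic to some $G_r$ with $n\ge0$, $r\in(F_n^-)^n$. $\mathrm{Sch}$ is the set of $\sigma$-isomorphism classes $[G]$ of weak Schur $\sigma$-groups, with the topology having as basis the sets $U_{i,G}:=\{[H]\in\mathrm{Sch}\mid H/D_i(H)\cong G/D_i(G)\ \sigma\text{-isomorphic}\}$ for all $i\ge2$ and all weak Schur $\sigma$-groups $G$. The Haar measure on $F_n^-$ is the unique Borel probability measure such that for every $\sigma$-invariant open normal subgroup $N\triangleleft F_n$ every fiber of the (surjective) map $F_n^-\to(F_n/N)^-$ has measure $1/|(F_n/N)^-|$. Let $\tilde\mu_n$ be the product measure on $(F_n^-)^n$, and $\mu_n$ its pushforward under the continuous map $(F_n^-)^n\to\mathrm{Sch}$, $r\mapsto[G_r]$. The probability measure $\mu_\infty$ on $\mathrm{Sch}$ is the limit $\mu_\infty(A)=\lim_{n\to\infty}\mu_n(A)$ for all Borel $A\subset\mathrm{Sch}$ (which exists). Put $C_\infty:=\prod_{i=1}^\infty(1-p^{-i})$. For $n$, $D$ as in the claim and a weak Schur $\sigma$-group $G$ with $d_G=n$, there is a surjective $\sigma$-homomorphism $\pi\colon F_n\twoheadrightarrow G$, unique up to composition with an element of $\mathrm{Aut}_\sigma(F_n)$. Put $G_D:=G/\pi(D)$, which does not depend on $\pi$.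 Define $U_{D,G}:=\{[H]\in\mathrm{Sch}\mid d_H=n \text{ and } H_D\cong G_D\ \sigma\text{-isomorphic}\}$. *)

(* Defs.v *)
From HB Require Import structures.
From mathcomp Require Import all_boot all_order all_algebra.
From mathcomp Require Import monoid generic_quotient finmap zify.
From mathcomp Require Import all_classical all_reals all_analysis.

Set Implicit Arguments.
Unset Strict Implicit.
Unset Printing Implicit Defensive.

Import Order.TTheory GRing.Theory Num.Theory.
Import numFieldNormedType.Exports.

Local Open Scope classical_set_scope.
Local Open Scope group_scope.

HB.mixin Record isTopGroup G & Topological G & Group G := {
  mulg_continuous : continuous (fun xy : G * G => xy.1 * xy.2 : G);
  invg_continuous : continuous (fun x : G => x^-1 : G)
}.

#[short(type="topGroupType")]
HB.structure Definition TopGroup :=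
  {G of isTopGroup G & Topological G & Group G}.

(* A continuous action of the group {1, sigma} of order 2 by automorphisms. *)
HB.mixin Record hasSigma G & TopGroup G := {
  sigma : G -> G;
  sigmaK : involutive sigma;
  sigmaM : {morph sigma : x y / x * y};
  sigma_continuous : continuous sigma
}.

#[short(type="sigmaGroupType")]
HB.structure Definition SigmaGroup := {G of hasSigma G & TopGroup G}.

Section Subgroups.
Context {G : topGroupType}.
Implicit Types (A B S : set G).

Definition is_subgroup A :=
  [/\ A 1, forall x y, A x -> A y -> A (x * y) & forall x, A x -> A x^-1].
Definition is_normal A := forall x g, A x -> A (x ^ g).
Definition closed_subgroup A := is_subgroup A /\ closed A.
Definition closed_normal_subgroup A := closed_subgroup A /\ is_normal A.

Definition gen S : set G := smallest closed_subgroup S.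
Definition normal_gen S : set G := smallest closed_normal_subgroup S.

Definition comm_subgroup A B : set G := gen [set [~ x, y] | x in A & y in B].

Definition cosets A : set (set G) := [set [set x * y | y in A] | x in setT].

(* A subgroup containing an open subgroup is itself open, so B need not be    *)
(* assumed open.                                                              *)
Definition maximal_open A :=
  [/\ is_subgroup A, open A, A <> setT &
      forall B, is_subgroup B -> A `<=` B -> B = A \/ B = setT].

Definition frattini : set G := \bigcap_(A in maximal_open) A.

End Subgroups.

Arguments frattini G : clear implicits.

(* Closedness is not part of the structure; it is stated where it is needed.  *)
Record sigmaNormal (G : sigmaGroupType) := SigmaNormal {
  ns_set :> set G;
  ns_subgroup : is_subgroup ns_set;
  ns_normal : is_normal ns_set;
  ns_sigma : forall x, ns_set x -> ns_set (sigma x)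
}.

Section Quotient.
Context {G : sigmaGroupType} (N : sigmaNormal G).

Definition coset_rel (x y : G) : bool := `[< ns_set N (x^-1 * y) >].

Lemma coset_rel_refl : reflexive coset_rel.
Proof. by move=> x; apply/asboolP; rewrite mulVg; case: (ns_subgroup N). Qed.

Lemma coset_rel_sym : symmetric coset_rel.
Proof.
have [_ _ NV] := ns_subgroup N.
by move=> x y; apply/asboolP/asboolP => /NV; rewrite invgM invgK.
Qed.

Lemma coset_rel_trans : transitive coset_rel.
Proof.
have [_ NM _] := ns_subgroup N.
move=> y x z /asboolP xy /asboolP yz; apply/asboolP.
by have := NM _ _ xy yz; rewrite -mulgA mulVKg.
Qed.

Canonical coset_equiv :=
  EquivRel coset_rel coset_rel_refl coset_rel_sym coset_rel_trans.

Definition quot : Type := quotient_topology {eq_quot coset_equiv}%qT.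
HB.instance Definition _ := Topological.copy quot
  (quotient_topology {eq_quot coset_equiv}%qT).
HB.instance Definition _ := Quotient.copy quot {eq_quot coset_equiv}%qT.

Definition qpi (x : G) : quot := (\pi_{eq_quot coset_equiv}%qT x)%qT.

Lemma qpiP x y : qpi x = qpi y <-> ns_set N (x^-1 * y).
Proof.
split=> [h|h]; first by apply/asboolP/(@eqmodP _ coset_equiv).
by apply/(@eqmodP _ coset_equiv)/asboolP.
Qed.

Definition qmul (a b : quot) : quot := qpi (repr a * repr b).
Definition qinv (a : quot) : quot := qpi (repr a)^-1.
Definition qsigma (a : quot) : quot := qpi (sigma (repr a)).

Lemma qreprK (a : quot) : qpi (repr a) = a.
Proof. exact: reprK. Qed.

Lemma repr_qpi x : exists2 z, ns_set N z & repr (qpi x) = x * z.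
Proof.
exists (x^-1 * repr (qpi x)); last by rewrite mulVKg.
by apply/qpiP; rewrite qreprK.
Qed.

Lemma quotP (P : quot -> Prop) : (forall x, P (qpi x)) -> forall a, P a.
Proof. by move=> h a; rewrite -[a]qreprK. Qed.

Lemma qmulE x y : qmul (qpi x) (qpi y) = qpi (x * y).
Proof.
have [_ NM NV] := ns_subgroup N.
have [z Nz ex] := repr_qpi x; have [t Nt ey] := repr_qpi y.
rewrite /qmul ex ey; apply/esym/qpiP.
rewrite (_ : _ * _ = z ^ y * t); first by apply: NM => //; exact: ns_normal.
by rewrite invgM /conjg !mulgA mulgVK.
Qed.

Lemma qinvE x : qinv (qpi x) = qpi x^-1.
Proof.
have [_ NM NV] := ns_subgroup N.
have [z Nz ex] := repr_qpi x; rewrite /qinv ex; apply/esym/qpiP.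
rewrite (_ : _ * _ = (z^-1) ^ (x^-1)); first by apply: ns_normal; exact: NV.
by rewrite /conjg invgM !invgK.
Qed.

Lemma qsigmaE x : qsigma (qpi x) = qpi (sigma x).
Proof.
have [z Nz ex] := repr_qpi x; rewrite /qsigma ex; apply/esym/qpiP.
by rewrite sigmaM mulKg; exact: ns_sigma.
Qed.

Fact qmulA : associative qmul.
Proof.
by elim/quotP=> x; elim/quotP=> y; elim/quotP=> z; rewrite !qmulE mulgA.
Qed.

Fact qmul1g : left_id (qpi 1) qmul.
Proof. by elim/quotP=> x; rewrite qmulE mul1g. Qed.

Fact qmulg1 : right_id (qpi 1) qmul.
Proof. by elim/quotP=> x; rewrite qmulE mulg1. Qed.

Fact qmulVg : left_inverse (qpi 1) qinv qmul.
Proof. by elim/quotP=> x; rewrite qinvE qmulE mulVg. Qed.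

Fact qmulgV : right_inverse (qpi 1) qinv qmul.
Proof. by elim/quotP=> x; rewrite qinvE qmulE mulgV. Qed.

HB.instance Definition _ :=
  isGroup.Build quot qmulA qmul1g qmulg1 qmulVg qmulgV.

Lemma quot_openE (U : set quot) : open U = open (qpi @^-1` U).
Proof. by []. Qed.

Lemma qpi_continuous : continuous qpi.
Proof. exact: pi_continuous. Qed.

Lemma qpi_open (U : set G) : open U -> open (qpi @` U).
Proof.
move=> oU; rewrite quot_openE.
have -> : qpi @^-1` (qpi @` U) = \bigcup_(z in N) ((fun x => x * z) @^-1` U).
  apply/seteqP; split=> x.
    case=> u Uu /esym/qpiP Nxu; exists (x^-1 * u) => //=.
    by rewrite mulVKg.
  case=> z Nz Uxz; exists (x * z) => //; apply/esym/qpiP.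
  by rewrite mulKg.
apply: bigcup_open => z _; apply: open_comp => // x _.
apply: (@continuous_comp _ _ _ (fun y => (y, z)) (fun p : G * G => p.1 * p.2)).
  by apply: cvg_pair => /=; [exact: cvg_id|exact: cvg_cst].
exact: mulg_continuous.
Qed.

Fact qmul_continuous : continuous (fun ab : quot * quot => ab.1 * ab.2 : quot).
Proof.
case; elim/quotP=> x; elim/quotP=> y U /=.
rewrite (_ : qpi x * qpi y = qpi (x * y)); last exact: qmulE.
move=> /qpi_continuous /(@mulg_continuous G (x, y)) [[A B] /= [nA nB] sAB].
rewrite nbhsE in nA; rewrite nbhsE in nB.
case: nA nB => [A' [oA' A'x] sA] [B' [oB' B'y] sB].
suff: filter_prod (nbhs (qpi x)) (nbhs (qpi y))
  ((fun ab : quot * quot => ab.1 * ab.2) @^-1` U) by exact.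
exists (qpi @` A', qpi @` B') => /=.
  split; apply: open_nbhs_nbhs; split; first exact: qpi_open.
  - by exists x.
  - exact: qpi_open.
  - by exists y.
case=> _ _ /= [[a Aa <-] [b Bb <-]].
rewrite /= (_ : qpi a * qpi b = qpi (a * b)); last exact: qmulE.
by apply: (sAB (a, b)); split; [exact: sA|exact: sB].
Qed.

Fact qinv_continuous : continuous (fun a : quot => a^-1 : quot).
Proof.
apply/quotient_continuous => x.
rewrite (_ : _ \o _ = qpi \o (fun z : G => z^-1)); last first.
  by apply/funext => z; exact: qinvE.
by apply: continuous_comp; [exact: invg_continuous|exact: qpi_continuous].
Qed.

Fact qsigma_continuous : continuous qsigma.
Proof.
apply/quotient_continuous => x.
rewrite (_ : _ \o _ = qpi \o sigma); last first.
  by apply/funext => z; exact: qsigmaE.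
by apply: continuous_comp; [exact: sigma_continuous|exact: qpi_continuous].
Qed.

HB.instance Definition _ := isTopGroup.Build quot qmul_continuous qinv_continuous.

Fact qsigmaK : involutive qsigma.
Proof. by elim/quotP=> x; rewrite !qsigmaE sigmaK. Qed.

Fact qsigmaM : {morph qsigma : a b / a * b}.
Proof.
elim/quotP=> x; elim/quotP=> y; rewrite [qpi x * _]qmulE !qsigmaE sigmaM.
by apply/esym; exact: qmulE.
Qed.

HB.instance Definition _ :=
  hasSigma.Build quot qsigmaK qsigmaM qsigma_continuous.

End Quotient.

Section Generation.
Context {G : topGroupType}.
Implicit Types (S : set G).

Lemma gen_closed_subgroup S : closed_subgroup (gen S).
Proof.
split; last by apply: closed_bigI => A [[]].
split.
- by move=> A [[[]]].
- move=> x y gx gy A SA; have [[[_ AM _] _] _] := SA.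
  by apply: AM; [exact: gx|exact: gy].
- by move=> x gx A SA; have [[[_ _ AV] _] _] := SA; apply: AV; exact: gx.
Qed.

Lemma normal_gen_closed_normal S : closed_normal_subgroup (normal_gen S).
Proof.
split; first split; last 1 first.
- by move=> x g gx A SA; have [[_ nA] _] := SA; apply: nA; exact: gx.
- split.
  + by move=> A [[[[]]]].
  + move=> x y gx gy A SA; have [[[[_ AM _] _] _] _] := SA.
    by apply: AM; [exact: gx|exact: gy].
  + by move=> x gx A SA; have [[[[_ _ AV] _] _] _] := SA; apply: AV; exact: gx.
- by apply: closed_bigI => A [[[]]].
Qed.

Lemma preimage_closed_subgroup (f : G -> G) (A : set G) :
  continuous f -> {morph f : x y / x * y} ->
  closed_subgroup A -> closed_subgroup (f @^-1` A).
Proof.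
move=> fC fM [[A1 AM AV] cA].
have f1 : f 1 = 1 by apply: (mulgI (f 1)); rewrite -fM !mulg1.
split; last exact: preimage_closed.
split=> /= [|x y Ax Ay|x Ax].
- by rewrite f1.
- by rewrite fM; exact: AM.
- suff -> : f x^-1 = (f x)^-1 by exact: AV.
  by apply/esym/mulg1_eq; rewrite -fM mulgV.
Qed.

Lemma sub_gen S : S `<=` gen S.
Proof. exact: sub_gen_smallest. Qed.

Lemma gen_endo (f : G -> G) S : continuous f -> {morph f : x y / x * y} ->
  (forall x, S x -> gen S (f x)) -> forall x, gen S x -> gen S (f x).
Proof.
move=> fC fM fS; apply: (@smallest_sub _ _ S (f @^-1` gen S)) => //.
by apply: preimage_closed_subgroup => //; exact: gen_closed_subgroup.
Qed.

Lemma conjg_continuous (g : G) : continuous (fun x : G => x ^ g).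
Proof.
move=> x; rewrite /conjg.
apply: (@continuous_comp _ _ _ (fun y => (g^-1, y * g)) (fun p : G * G => p.1 * p.2)).
  apply: cvg_pair => /=; first exact: cvg_cst.
  apply: (@continuous_comp _ _ _ (fun y => (y, g)) (fun p : G * G => p.1 * p.2)).
    by apply: cvg_pair => /=; [exact: cvg_id|exact: cvg_cst].
  exact: mulg_continuous.
exact: mulg_continuous.
Qed.

End Generation.

Section Zassenhaus.
Variables (p : nat) (G : topGroupType).
Local Open Scope nat_scope.

(* [divup i] is the ceiling of i / p. *)
Definition divup (i : nat) : nat := (i + p.-1) %/ p.

(* [zassenhaus_rec k i] unfolds the recursive definition of D_i(G) down to   *)
(* recursion depth k, and is D_i(G) as soon as i <= k (see zassenhausE).       *)
Fixpoint zassenhaus_rec (k i : nat) : set G :=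
  if k is k'.+1 then
    if i <= 1 then setT else
    gen ([set (x ^+ p)%g | x in zassenhaus_rec k' (divup i)] `|`
         \bigcup_(jk in [set jk : nat * nat |
                          [/\ 0 < jk.1, 0 < jk.2 & jk.1 + jk.2 = i]])
           comm_subgroup (zassenhaus_rec k' jk.1) (zassenhaus_rec k' jk.2))
  else setT.

Definition zassenhaus (i : nat) : set G :=
  zassenhaus_rec i i.

Lemma zassenhaus_rec_depth i k l : 1 < p ->
  i <= k -> i <= l -> zassenhaus_rec k i = zassenhaus_rec l i.
Proof.
move=> p1; elim: k l i => [|k IH] [|l] i //=; rewrite ?leqn0.
- by move=> /eqP ->.
- by move=> _ /eqP ->.
move=> ik il; case: ifPn => //; rewrite -ltnNge => i1.
have di : divup i < i.
  rewrite /divup ltn_divLR ?(ltnW p1)//.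
  case: i i1 {ik il} => [//|[//|i]] _; case: p p1 => [//|[//|q]] _ /=.
  by rewrite !mulSn !mulnS; lia.
congr gen; congr (_ `|` _).
  by rewrite (IH l)//; lia.
apply: eq_bigcupr => -[j m] /= [j0 m0 e].
by rewrite (IH l) ?(IH l m)//; lia.
Qed.

Lemma zassenhaus1 : zassenhaus 1 = setT.
Proof. by []. Qed.

Lemma zassenhausE i : 1 < p -> 1 < i -> zassenhaus i =
  gen ([set (x ^+ p)%g | x in zassenhaus (divup i)] `|`
       \bigcup_(jk in [set jk : nat * nat |
                        [/\ 0 < jk.1, 0 < jk.2 & jk.1 + jk.2 = i]])
         comm_subgroup (zassenhaus jk.1) (zassenhaus jk.2)).
Proof.
move=> p1 i1; rewrite {1}/zassenhaus.
case: i i1 => [//|i] i1 /=; rewrite leqNgt i1 /=.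
have di : divup i.+1 <= i.
  rewrite -ltnS /divup ltn_divLR ?(ltnW p1)//.
  case: i i1 => [//|i] _; case: p p1 => [//|[//|q]] _ /=.
  by rewrite !mulSn !mulnS; lia.
congr gen; congr (_ `|` _).
  by rewrite /zassenhaus -(@zassenhaus_rec_depth _ i).
apply: eq_bigcupr => -[j m] /= [j0 m0 e].
by rewrite /zassenhaus -(@zassenhaus_rec_depth j i) -?(@zassenhaus_rec_depth m i)//; lia.
Qed.

Local Open Scope group_scope.

Lemma zassenhaus_endo (f : G -> G) :
  continuous f -> {morph f : x y / x * y} ->
  forall k i x, zassenhaus_rec k i x -> zassenhaus_rec k i (f x).
Proof.
move=> fC fM; have fX n : {morph f : x / x ^+ n}.
  move=> x; elim: n => [|n IH]; last by rewrite !expgS fM IH.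
  by rewrite !expg0; apply: (mulgI (f 1)); rewrite -fM !mulg1.
have fV x : f x^-1 = (f x)^-1.
  by apply/esym/mulg1_eq; rewrite -fM mulgV (fX 0 1).
elim=> [//|k IH] i x /=; case: ifP => // _; apply: gen_endo => // {}x.
case=> [[y Dy <-]|[jk ijk Cx]]; apply: sub_gen.
  by left; rewrite fX; exists (f y) => //; exact: IH.
right; exists jk => //; apply: gen_endo Cx => // _ [a Da [b Db <-]].
apply: sub_gen; exists (f a); first exact: IH.
by exists (f b); [exact: IH|rewrite /commg /conjg !fM !fV].
Qed.

Lemma zassenhaus_subgroup i : is_subgroup (zassenhaus i).
Proof.
case: i => [|i] /=; first by split.
rewrite /zassenhaus /=; case: ifP => _; first by split.
exact: (gen_closed_subgroup _).1.
Qed.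

End Zassenhaus.

Arguments zassenhaus p G i : clear implicits.

Section ZassenhausNormal.
Variables (p : nat) (G : sigmaGroupType) (i : nat).

Fact zassenhaus_normal : is_normal (zassenhaus p G i).
Proof.
move=> x g; apply: (@zassenhaus_endo p G (fun y => y ^ g)).
  exact: conjg_continuous.
by move=> a b; rewrite conjMg.
Qed.

Fact zassenhaus_sigma x : zassenhaus p G i x -> zassenhaus p G i (sigma x).
Proof.
by apply: (@zassenhaus_endo p G sigma); [exact: sigma_continuous|exact: sigmaM].
Qed.

Definition zassenhausN : sigmaNormal G :=
  SigmaNormal (@zassenhaus_subgroup p G i) zassenhaus_normal zassenhaus_sigma.

End ZassenhausNormal.

Definition hom {G H : topGroupType} (f : G -> H) :=
  {morph f : x y / x * y} /\ continuous f.

Definition sigma_hom {G H : sigmaGroupType} (f : G -> H) :=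
  hom f /\ {morph f : x / sigma x}.

Definition sigma_iso {G H : sigmaGroupType} (f : G -> H) :=
  sigma_hom f /\ exists2 g : H -> G, cancel f g /\ cancel g f & continuous g.

Definition sigma_isomorphic (G H : sigmaGroupType) :=
  exists f : G -> H, sigma_iso f.

Definition Aut_sigma (G : sigmaGroupType) : set (G -> G) := [set f | sigma_iso f].

Arguments Aut_sigma G : clear implicits.

Record sigmaEpi (G H : sigmaGroupType) := SigmaEpi {
  epi_fun :> G -> H;
  epi_hom : sigma_hom epi_fun;
  epi_surj : set_surj setT setT epi_fun
}.

Section ImageNormal.
Context {G H : sigmaGroupType} (f : sigmaEpi G H) (N : sigmaNormal G).

Let f1 : f 1 = 1.
Proof. by have [[fM _] _] := epi_hom f; apply: (mulgI (f 1)); rewrite -fM !mulg1. Qed.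

Let fV x : f x^-1 = (f x)^-1.
Proof. by have [[fM _] _] := epi_hom f; apply/esym/mulg1_eq; rewrite -fM mulgV. Qed.

Fact image_subgroup : is_subgroup (f @` N).
Proof.
have [[fM _] _] := epi_hom f; have [N1 NM NV] := ns_subgroup N; split.
- by exists 1.
- by move=> _ _ [x Nx <-] [y Ny <-]; exists (x * y); rewrite ?fM//; exact: NM.
- by move=> _ [x Nx <-]; exists x^-1; rewrite ?fV//; exact: NV.
Qed.

Fact image_normal : is_normal (f @` N).
Proof.
have [[fM _] _] := epi_hom f.
move=> _ h [x Nx <-]; have [g _ <-] := epi_surj f (I : setT h).
exists (x ^ g); first exact: ns_normal.
by rewrite /conjg !fM fV.
Qed.

Fact image_sigma y : (f @` N) y -> (f @` N) (sigma y).
Proof.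
have [_ fs] := epi_hom f.
by move=> [x Nx <-]; exists (sigma x); rewrite ?fs//; exact: ns_sigma.
Qed.

Definition imageN : sigmaNormal H :=
  SigmaNormal image_subgroup image_normal image_sigma.

End ImageNormal.

Section Minus.
Variable G : sigmaGroupType.

Definition minus : set G := [set a | sigma a = a^-1].

Fact minus1 : 1 \in minus.
Proof.
apply/mem_set; rewrite /minus /= invg1.
by apply: (mulgI (sigma 1)); rewrite -sigmaM !mulg1.
Qed.

(* The set G^- with the subspace topology. *)
Definition minusT : Type := set_type minus.
HB.instance Definition _ := Topological.copy minusT (set_type minus).
HB.instance Definition _ := SubType.copy minusT (set_type minus).
HB.instance Definition _ := isPointed.Build minusT (exist _ (1 : G) minus1).

Definition borel_minus : Type := g_sigma_algebraType (@open minusT).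
HB.instance Definition _ := Pointed.copy borel_minus minusT.
HB.instance Definition _ :=
  Measurable.copy borel_minus (g_sigma_algebraType (@open minusT)).

End Minus.

Arguments minus G : clear implicits.

Section Relators.
Context {G : sigmaGroupType} {n : nat} (r : n.-tuple (minusT G)).

Definition relator_normal : set G :=
  normal_gen [set val (tnth r i) | i in [set: 'I_n]].

Fact relator_sigma x : relator_normal x -> relator_normal (sigma x).
Proof.
pose K := relator_normal.
apply: (@smallest_sub _ _ _ (sigma @^-1` K)) => /=.
  have [cK nK] := normal_gen_closed_normal
    [set val (tnth r i) | i in [set: 'I_n]].
  split; first exact: preimage_closed_subgroup (@sigma_continuous G) (@sigmaM G) cK.
  move=> {}x g /= Kx; rewrite /conjg !sigmaM.
  suff -> : sigma g^-1 = (sigma g)^-1 by exact: nK.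
  apply/esym/mulg1_eq; rewrite -sigmaM mulgV.
  by apply: (mulgI (sigma 1)); rewrite -sigmaM !mulg1.
move=> _ [i _ <-] /=; have /set_mem -> := valP (tnth r i).
have [[[_ _ KV] _] _] := normal_gen_closed_normal
  [set val (tnth r i) | i in [set: 'I_n]].
by apply: KV; apply: sub_gen_smallest; exists i.
Qed.

Definition relatorN : sigmaNormal G :=
  SigmaNormal (normal_gen_closed_normal _).1.1 (normal_gen_closed_normal _).2
    relator_sigma.

End Relators.

Section SigmaIso.

Lemma sigma_isomorphic_refl G : sigma_isomorphic G G.
Proof.
exists idfun; split; last by exists idfun => // x; exact: cvg_id.
by split=> //; split=> // x; exact: cvg_id.
Qed.

Lemma sigma_isomorphic_sym G H : sigma_isomorphic G H -> sigma_isomorphic H G.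
Proof.
case=> f [[[fM fC] fs] [g [fK gK] gC]]; exists g; split; last by exists f.
split; [split=> //|] => x; last by apply: (can_inj fK); rewrite fs !gK.
by move=> y; apply: (can_inj fK); rewrite fM !gK.
Qed.

Lemma sigma_isomorphic_trans H G K :
  sigma_isomorphic G H -> sigma_isomorphic H K -> sigma_isomorphic G K.
Proof.
case=> f [[[fM fC] fs] [f' [fK fK'] fC']].
case=> g [[[gM gC] gs] [g' [gK gK'] gC']].
exists (g \o f); split; last first.
  exists (f' \o g'); first by split; [exact: can_comp|exact: can_comp].
  by move=> x; apply: continuous_comp; [exact: gC'|exact: fC'].
split; first split.
- by move=> x y /=; rewrite fM gM.
- by move=> x; apply: continuous_comp; [exact: fC|exact: gC].
- by move=> x /=; rewrite fs gs.
Qed.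

End SigmaIso.

Section ProP.
Variable p : nat.

(* Compact Hausdorff, with a neighbourhood basis of 1 consisting of open      *)
(* normal subgroups of p-power index.                                         *)
Definition pro_p (G : topGroupType) :=
  [/\ compact [set: G], hausdorff_space G &
   forall U : set G, nbhs (1 : G) U -> exists N : set G,
     [/\ open N, is_subgroup N, is_normal N, N `<=` U &
         exists k, (cosets N #= `I_(expn p k))%card]].

(* H^1(G, F_p), for the trivial action, is the space of continuous            *)
(* homomorphisms from G to the discrete group F_p.                            *)
Definition H1 (G : topGroupType) : set (G -> 'F_p) :=
  [set f | {morph f : x y / x * y >-> (x + y)%R} /\
           forall a, open (f @^-1` [set a])].

(* The F_p-vector space H^1(G, F_p) has a basis with n elements. *)
Definition dim_H1 (G : topGroupType) (n : nat) :=
  exists2 e : 'I_n -> G -> 'F_p, (forall i, H1 (e i)) &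
  forall f : G -> 'F_p, H1 f ->
    exists! c : {ffun 'I_n -> 'F_p}, f = (fun x => \sum_i c i * e i x)%R.

Definition is_free_pro_p (G : topGroupType) (n : nat) (x : 'I_n -> G) :=
  pro_p G /\
  forall (P : topGroupType), pro_p P -> forall y : 'I_n -> P,
    exists! f : G -> P, hom f /\ forall i, f (x i) = y i.

(* The free pro-p-group on x_1, ..., x_n with sigma inverting each x_i; it is *)
(* determined by n up to unique isomorphism.                                  *)
Record freeSigma (n : nat) := FreeSigma {
  free_group :> sigmaGroupType;
  free_gen : 'I_n -> free_group;
  free_gen_free : is_free_pro_p free_gen;
  free_gen_sigma : forall i, sigma (free_gen i) = (free_gen i)^-1
}.

End ProP.

Section Power.
Context d (T : measurableType d) (R : realType) (P : probability T R).

Definition cons_tup n (xt : T * n.-tuple T) : n.+1.-tuple T :=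
  [tuple of xt.1 :: xt.2].

Fact measurable_cons_tup n : measurable_fun [set: T * n.-tuple T] (@cons_tup n).
Proof. by apply: measurable_cons; [exact: measurable_fst|exact: measurable_snd]. Qed.

HB.instance Definition _ n :=
  isMeasurableFun.Build _ _ _ _ (@cons_tup n) (@measurable_cons_tup n).

(* The n-fold product of P. *)
Fixpoint power_prob (n : nat) : probability (n.-tuple T) R :=
  if n is n'.+1 then
    distribution (P \x power_prob n')%E (@cons_tup n' : {mfun _ >-> _})
  else dirac ([tuple] : 0.-tuple T).

End Power.

Section SchurGroups.
Variables (p : nat) (F : forall n : nat, freeSigma p n).

Definition presentation : Type := {n : nat & n.-tuple (minusT (F n))}.

Definition Gr (u : presentation) : sigmaGroupType := quot (relatorN (tagged u)).

Definition weak_Schur (G : sigmaGroupType) :=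
  pro_p p G /\ exists u : presentation, sigma_isomorphic G (Gr u).

Definition pres_rel (u v : presentation) : bool :=
  `[< sigma_isomorphic (Gr u) (Gr v) >].

Fact pres_rel_refl : reflexive pres_rel.
Proof. by move=> u; apply/asboolP; exact: sigma_isomorphic_refl. Qed.

Fact pres_rel_sym : symmetric pres_rel.
Proof. by move=> u v; apply/asboolP/asboolP => /sigma_isomorphic_sym. Qed.

Fact pres_rel_trans : transitive pres_rel.
Proof.
move=> v u w /asboolP uv /asboolP vw; apply/asboolP.
exact: sigma_isomorphic_trans uv vw.
Qed.

Canonical pres_equiv :=
  EquivRel pres_rel pres_rel_refl pres_rel_sym pres_rel_trans.

(* Since every weak Schur sigma-group is isomorphic to some G_r, isomorphism  *)
(* classes of such groups are classes of relator tuples r.                    *)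
Definition Sch : Type := {eq_quot pres_equiv}%qT.
HB.instance Definition _ := Choice.copy Sch {eq_quot pres_equiv}%qT.

Definition class_of (u : presentation) : Sch := (\pi_({eq_quot pres_equiv}) u)%qT.
Definition group_of (c : Sch) : sigmaGroupType := Gr (repr c).

Definition U_basic (i : nat) (G : sigmaGroupType) : set Sch :=
  [set c | sigma_isomorphic (quot (zassenhausN p (group_of c) i))
                            (quot (zassenhausN p G i))].

(* For i <= j the set U_basic j G is contained in U_basic i G, and for fixed i *)
(* these sets partition Sch; so they form a basis, and the topology with this *)
(* basis is the one that they generate as a subbasis.                         *)
HB.instance Definition _ := isSubBaseTopological.Build Sch
  [set A : set Sch | exists i G, [/\ (2 <= i)%N, weak_Schur G & A = U_basic i G]]
  id.

(* H_D is H / rho(D) for any surjective rho : F_n -> H. If d_H = n such a rho  *)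
(* exists, and if moreover D is invariant under Aut_sigma(F_n), then rho(D)   *)
(* does not depend on it.                                                     *)
Definition U_D (n : nat) (D : sigmaNormal (F n)) (G : sigmaGroupType)
    (pi : sigmaEpi (F n) G) : set Sch :=
  [set c | dim_H1 p (group_of c) n /\
           exists rho : sigmaEpi (F n) (group_of c),
             sigma_isomorphic (quot (imageN rho D)) (quot (imageN pi D))].

Section Measures.
Variable R : realType.

Definition is_haar (n : nat) (m : probability (borel_minus (F n)) R) :=
  forall N : sigmaNormal (F n), open (N : set (F n)) ->
  forall b : quot N, minus (quot N) b ->
    m [set a | qpi N (val a) = b] =
    ((#|` fset_set (minus (quot N))|)%:R^-1)%:E.

Variable m : forall n : nat, probability (borel_minus (F n)) R.

Definition mu (n : nat) (A : set Sch) : \bar R :=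
  power_prob (m n) n
    [set r : n.-tuple (borel_minus (F n)) | A (class_of (existT _ n r))].

(* The limit exists for Borel A; limn is 0 on a divergent sequence.           *)
Definition mu_infty (A : set Sch) : \bar R := limn (fun n => mu n A).

Definition C_infty : R :=
  limn (fun n => \prod_(1 <= i < n.+1) (1 - (p%:R ^+ i)^-1) : R)%R.

End Measures.

End SchurGroups.

(* Main.v *)
(* Let Q = G_D and q = |Q^-|.  We count pairs (r, phi), where r is an m-tuple   *)
(* of relators and phi : F_m ->> Q is an epimorphism whose kernel is N_r s(D)   *)
(* for a lift s : F_n -> F_m of F_n ->> Q through phi; the image of s(D) in G_r *)
(* does not depend on s, because D is Aut_sigma(F_n)-invariant.                 *)
(* - For fixed phi let K = ker phi and let V be the dual of K / K^p[K,F_m]s(D). *)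
(*   By Nakayama, (r, phi) is counted iff r lies in K and maps to a basis.      *)
(*   Here sigma = -1 on V and dim V = m: comparing V for phi and for F_n ->> Q, *)
(*   dim V - m does not depend on phi and is <= 0 thanks to the presentation of *)
(*   G; it is >= 0 since Q is finite and D lies in [F_n, F_n].  So the relators *)
(*   are equidistributed in F_p^m x Q^-, and phi contributes the probability    *)
(*   |GL_m(F_p)| / (p^(m^2) q^m).                                               *)
(* - sigma-homomorphisms F_m -> Q correspond to m-tuples in Q^-, and the        *)
(*   proportion of epimorphisms among these q^m homomorphisms tends to 1.       *)
(* - Each r with (G_r)_D = Q occurs with exactly |Aut_sigma(Q)| maps phi.       *)
(* Hence mu_m(U_D) tends to prod_i (1 - p^-i) / |Aut_sigma(Q)|.  Finally, U_D   *)
(* is open and closed because H_D = Q only depends on H / D_i(H) for large i.   *)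

(* The question whether (G_r)_D is isomorphic to Q = G_D is replaced by a count of the epimorphisms
   phi : F_m ->> Q that induce such an isomorphism ([presents]). For a given r there are either none
   of them or a torsor under Aut_sigma(Q) ([card_presentations]), so the measure is the expected
   number of phi divided by |Aut_sigma(Q)| ([probability_count]). Everything rests on rho(D) being
   independent of rho : F_n ->> H: since Q already has n independent homomorphisms to F_p, two such
   rho differ by an automorphism of F_n, and D is invariant ([image_D_unique]).

   For fixed phi with kernel K the problem is linear algebra over F_p. By Nakayama
   ([pro_p_chief_hom]), r and s(D) generate K normally iff no nonzero functional in [kernel_dual]
   vanishes on r ([presentsP]). Two facts make the probability explicit: this space has dimension
   exactly m, and sigma acts on it by -1. Both follow from a comparison with kappa : F_n ->> Q.
   Restriction along s leads to the functionals for kappa; the functionals lost are restrictions of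
   the homomorphisms F_m -> F_p that kill s(F_n), a space of dimension m - n on which sigma is -1
   ([kernel_dual_extension], [H1_section_ker_dim]). For kappa itself, the given presentation of G
   yields the sign and the bound dim <= n ([kernel_dual_kappa_sigma], [kernel_dual_kappa_dim]). The
   lower bound m holds because fewer relators would leave too many homomorphisms from F_m to Z/p^k
   ([kernel_dual_dim_geq]).

   Because of the sign, a Haar-random element of F_m^- lies in K with prescribed values of the m
   functionals with probability 1/(q p^m), where q = |Q^-| ([haar_value_fibre]). So phi contributes
   |GL_m(F_p)|/(q^m p^(m^2)) ([presents_prob]). Summing over the E_m epimorphisms, with E_m/q^m
   tending to 1 ([gen_tuple_surj], [ffun_surjective_bound]), gives the limit.

   For the topology, D_j(Q) = 1 for some j, and whether H_D is Q is then decided by H / D_i(H) with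
   i = p j ([has_quotient_local]). Thus U_D and its complement are both unions of basic open
   sets. *)
From HB Require Import structures.
Require Import Defs.
From mathcomp Require Import all_boot all_order all_algebra.
From mathcomp Require Import all_fingroup all_solvable.

Set Implicit Arguments.
Unset Strict Implicit.
Unset Printing Implicit Defensive.

Import Order.TTheory GRing.Theory Num.Theory.

Local Open Scope group_scope.

(** * Finite p-groups *)

Section FiniteGroups.
Variables (p : nat) (gT : finGroupType).
Hypothesis p_pr : prime p.
Implicit Types (G H K L M : {group gT}).

(** The discrete logarithm to a generator of [K / L]; values outside [K] carry no meaning. *)
Lemma index_prime_hom K L : L <| K -> #|K : L|%g = p ->
  exists f : gT -> 'F_p, {in K &, {morph f : x y / x * y >-> (x + y)%R}} /\
    {in K, forall x, (f x == 0%R) = (x \in L)}.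
Proof.
move=> /andP[sLK nLK] iLK; have p1 := prime_gt1 p_pr.
have cQ : prime #|K / L| by rewrite card_quotient// iLK.
have /cyclicP[a Qa] : cyclic (K / L) by exact: prime_cyclic.
have oa : #[a] = p by rewrite /order -Qa card_quotient.
have aP x : x \in K -> exists i, coset L x == a ^+ i.
  move=> Kx; have /cycleP[i ->] : coset L x \in <[a]> by rewrite -Qa mem_quotient.
  by exists i.
pose g x := if [pick i : 'I_p | coset L x == a ^+ i] is Some i then val i else 0%N.
have gP x : x \in K -> coset L x = a ^+ g x.
  move=> Kx; rewrite /g; case: pickP => [i /eqP//|h].
  have [i /eqP e] := aP x Kx.
  have := h (Ordinal (ltn_pmod i (prime_gt0 p_pr))).
  by rewrite /= -[X in (_ %% X)%N]oa expg_mod_order e eqxx.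
exists (fun x => (g x)%:R%R); split => [x y Kx Ky|x Kx].
  apply: val_inj; rewrite -natrD /= !val_Fp_nat//; apply/eqP.
  have := eq_expg_mod_order a (g (x * y)) (g x + g y); rewrite oa => <-.
  apply/eqP; rewrite expgD -(gP x Kx) -(gP y Ky) -gP ?groupM//.
  by rewrite morphM//; apply: (subsetP nLK).
rewrite -(dvdn_pcharf (pchar_Fp p_pr)) -[X in dvdn X _]oa order_dvdn.
by rewrite -gP//; apply/eqP/idP => [/coset_idr|/coset_id->//]; apply; exact: (subsetP nLK).
Qed.

Hypothesis pG : p.-group [set: gT].

Lemma pgroup_proper_hom H : H \proper [set: gT] ->
  exists f : gT -> 'F_p, [/\ {morph f : x y / x * y >-> (x + y)%R},
    {in H, forall x, f x = 0%R} & exists x, f x != 0%R].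
Proof.
move=> pH; have [L maxL sHL] : exists2 L : {group gT}, maximal L [set: gT] & H \subset L.
  have [|E|[L mL sL]] := @maximal_exists gT H [set: gT]; first exact: proper_sub.
    by move: pH; rewrite properE E subxx andbF.
  by exists L.
have nL := p_maximal_normal pG maxL.
have [f [fM f0]] := index_prime_hom nL (p_maximal_index pG maxL).
exists f; split=> [x y|x Hx|]; first by apply: fM; rewrite inE.
  by apply/eqP; rewrite f0 ?inE// (subsetP sHL).
have /properP[_ [x _ Lx]] := maxgroupp maxL.
by exists x; rewrite f0 ?inE.
Qed.

(** Nakayama in dual form. By nilpotency the commutator of [K / M] with the whole group is proper in
    [K / M]. A maximal subgroup of [K] above its preimage has index p, and the functional it defines
    is conjugation invariant because it kills all [x, g]. *)
Lemma pgroup_chief_hom M K : M <| [set: gT] -> K <| [set: gT] -> M \proper K ->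
  exists f : gT -> 'F_p, [/\ {in K &, {morph f : x y / x * y >-> (x + y)%R}},
    {in K, forall x g, f (x ^ g) = f x},
    {in M, forall x, f x = 0%R} & exists2 x, x \in K & f x != 0%R].
Proof.
move=> nM nK pMK; have sMK := proper_sub pMK.
have pK : p.-group K by exact: pgroupS (subsetT _) pG.
have nMT g : g \in 'N(M) by case/andP: nM => _ /subsetP; apply; rewrite inE.
have nMs (A : {set gT}) : A \subset 'N(M) by apply/subsetP => g _.
have nKT : [set: gT] \subset 'N(K) by case/andP: nK.
have pC : [~: K / M, [set: gT] / M] \proper K / M.
  apply: (@nil_comm_properl _ ([set: gT] / M)%G).
  - exact/pgroup_nil/quotient_pgroup/pG.
  - by rewrite quotientS// subsetT.
  - by rewrite -subG1 quotient_sub1//; case/andP: pMK.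
  - by rewrite subsetI subxx quotient_norms.
pose C := (K :&: coset M @*^-1 [~: K / M, [set: gT] / M])%G.
have CK : C \proper K.
  rewrite properE subsetIl/= subsetI subxx/=; apply: contraTN pC => sK.
  by rewrite properE negb_and negbK; apply/orP; right; rewrite sub_quotient_pre// -/C.
have [L maxL sCL] : exists2 L : {group gT}, maximal L K & C \subset L.
  have [|E|[L mL sL]] := @maximal_exists gT C K; first exact: proper_sub.
    by move: CK; rewrite properE E subxx andbF.
  by exists L.
have nL := p_maximal_normal pK maxL.
have [f [fM f0]] := index_prime_hom nL (p_maximal_index pK maxL).
have sML : M \subset L.
  apply: subset_trans sCL; rewrite subsetI sMK/=.
  by rewrite -sub_quotient_pre// trivg_quotient sub1G.
have KJ x g : x \in K -> x ^ g \in K.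
  by move=> Kx; rewrite memJ_norm// (subsetP nKT)// inE.
exists f; split=> [||x Mx|].
- exact: fM.
- move=> x Kx g; apply/eqP; rewrite -subr_eq0.
  have KR : [~ x, g] \in K by rewrite commgEl groupM ?groupV ?KJ.
  rewrite -[x ^ g](mulKVg x) -commgEl fM// addrAC subrr add0r f0//.
  apply: (subsetP sCL); rewrite inE KR/= inE (subsetP (nMs setT)) ?inE//=.
  by rewrite morphR// mem_commg// mem_quotient// inE.
- by apply/eqP; rewrite f0 ?(subsetP sMK)// (subsetP sML).
have /properP[_ [x Kx Lx]] := maxgroupp maxL.
by exists x; rewrite ?f0.
Qed.

End FiniteGroups.

From mathcomp Require Import monoid generic_quotient finmap zify.
From mathcomp Require Import all_classical all_reals all_analysis measurable_realfun.
Require Import Defs.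

Import numFieldNormedType.Exports.

Local Open Scope classical_set_scope.
Local Open Scope group_scope.

(** * Pro-p groups *)

Section FiniteGroupType.
Variables (X : groupType) (T : finType) (h : X -> T) (h' : T -> X).
Hypotheses (hK : cancel h h') (h'K : cancel h' h).

(** The two proofs are phantom parameters, on which the group structure carried over from [X] can
    depend. *)
Definition transported of cancel h h' & cancel h' h : Type := T.
Local Notation fT := (transported hK h'K).
HB.instance Definition _ := Finite.on fT.

Let mul (a b : fT) : fT := h (h' a * h' b).
Let inv (a : fT) : fT := h (h' a)^-1.

Fact transported_mulA : associative mul.
Proof. by move=> a b c; rewrite /mul !hK mulgA. Qed.

Fact transported_mul1 : left_id (h 1 : fT) mul.
Proof. by move=> a; rewrite /mul hK mul1g h'K. Qed.

Fact transported_mulV : left_inverse (h 1 : fT) inv mul.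
Proof. by move=> a; rewrite /mul /inv hK mulVg. Qed.

HB.instance Definition _ :=
  Finite_isGroup.Build fT transported_mulA transported_mul1 transported_mulV.

Lemma transportM : {morph (h : X -> fT) : x y / x * y}.
Proof. by move=> x y; rewrite [RHS]/(mul (h x) (h y)) /mul !hK. Qed.

End FiniteGroupType.

Lemma finite_group_model (X : groupType) n : ([set: X] #= `I_n)%card ->
  exists (gT : finGroupType) (u : X -> gT) (v : gT -> X),
    [/\ cancel u v, cancel v u, {morph u : x y / x * y} & #|gT| = n].
Proof.
move=> /card_set_bijP[f [fS fI fJ]].
have fn x : (f x < n)%N by apply: (fS x).
have /choice[v vP] : forall i : 'I_n, exists x, f x = i.
  by move=> i; have [x _ fx] := fJ i (ltn_ord i); exists x.
pose u x : 'I_n := Ordinal (fn x).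
have uK : cancel u v by move=> x; apply: fI; rewrite ?inE// vP.
have vK : cancel v u by move=> i; apply: val_inj; rewrite /= vP.
exists (transported uK vK), u, v; split=> //; first exact: transportM.
exact: card_ord.
Qed.

Section Morphisms.
Variables (G H : groupType) (f : G -> H).
Hypothesis fM : {morph f : x y / x * y}.

Lemma gmorph1 : f 1 = 1.
Proof. by apply: (mulgI (f 1)); rewrite -fM !mulg1. Qed.

Lemma gmorphV : {morph f : x / x^-1}.
Proof. by move=> x; apply/esym/mulg1_eq; rewrite -fM mulgV gmorph1. Qed.

Lemma gmorphJ : {morph f : x y / x ^ y}.
Proof. by move=> x y; rewrite /conjg !fM gmorphV. Qed.

Lemma gmorphR : {morph f : x y / [~ x, y]}.
Proof. by move=> x y; rewrite /commg fM gmorphV gmorphJ. Qed.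

Lemma gmorphX n : {morph f : x / x ^+ n}.
Proof. by move=> x; elim: n => [|n IH]; rewrite ?expg0 ?gmorph1// !expgS fM IH. Qed.

End Morphisms.

Section ContinuousTranslations.
Variable G : topGroupType.
Implicit Types x y : G.

Lemma mulgl_continuous x : continuous (fun y => x * y).
Proof.
move=> y; apply: (@continuous_comp _ _ _ (fun y => (x, y)) (fun p : G * G => p.1 * p.2)).
  by apply: cvg_pair => /=; [exact: cvg_cst|exact: cvg_id].
exact: mulg_continuous.
Qed.

Lemma locally_constant_open (T : Type) (f : G -> T) (U : set G) :
  nbhs (1 : G) U -> (forall x z, U z -> f (x * z) = f x) ->
  forall A, open (f @^-1` A).
Proof.
move=> U1 fU A; rewrite openE => x /= Ax; rewrite /interior.
have : nbhs x ((fun y => x^-1 * y) @^-1` U).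
  by apply: mulgl_continuous; rewrite mulVg.
by apply: filterS => y /= Uxy; rewrite -[y](mulVKg x) fU.
Qed.

End ContinuousTranslations.

(* The group G with the trivial action, so that the quotients of              *)
(* sigma-groups apply to arbitrary topological groups.                        *)
Definition triv (G : topGroupType) : Type := G.
HB.instance Definition _ (G : topGroupType) := TopGroup.on (triv G).

Fact triv_sigmaK (G : topGroupType) : involutive (idfun : triv G -> triv G).
Proof. by []. Qed.
Fact triv_sigmaM (G : topGroupType) :
  {morph (idfun : triv G -> triv G) : x y / x * y}.
Proof. by []. Qed.
Fact triv_sigma_continuous (G : topGroupType) :
  continuous (idfun : triv G -> triv G).
Proof. by move=> x; exact: cvg_id. Qed.
HB.instance Definition _ (G : topGroupType) := hasSigma.Build (triv G)
  (@triv_sigmaK G) (@triv_sigmaM G) (@triv_sigma_continuous G).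

Section ProPGroups.
Variables (p : nat) (p_pr : prime p) (G : topGroupType) (G_pro : pro_p p G).

(** Replaces open normal subgroups by homomorphisms onto finite p-groups, to which finite group
    theory applies. *)
Lemma pro_p_finite_quotient (U : set G) : nbhs (1 : G) U ->
  exists (gT : finGroupType) (u : G -> gT),
    [/\ {morph u : x y / x * y}, forall a, exists x, u x = a,
        p.-group [set: gT]%SET, forall x, u x = 1 -> U x &
        forall A, open (u @^-1` A)].
Proof.
move=> U1; have [_ _ /(_ U U1)[N [oN sN nN NU [k ck]]]] := G_pro.
pose N' : sigmaNormal (triv G) := @SigmaNormal (triv G) N sN nN (fun x Nx => Nx).
have cQ : ([set: quot N'] #= `I_(p ^ k))%card.
  move/card_set_bijP : ck => [f [fS fI fJ]].
  apply/card_set_bijP; exists (fun a : quot N' => f [set repr a * y | y in N]).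
  have cosetP a : cosets N [set repr (a : quot N') * y | y in N] by exists (repr a).
  split=> [a _|a b _ _ e|i /fJ[_ [x _ <-] <-]]; first exact: fS.
    have /seteqP[+ _] : [set repr a * y | y in N] = [set repr b * y | y in N].
      by apply: fI => //; rewrite inE; exact: cosetP.
    have [N1 _ _] := sN.
    case/(_ (repr a)); first by exists 1; rewrite ?mulg1.
    move=> y Ny e'; rewrite -[a]qreprK -[b]qreprK; apply/esym/qpiP.
    by rewrite -e' mulKg.
  exists (qpi N' x) => //; congr f.
  have [z Nz ->] := repr_qpi N' x; have [_ NM NV] := sN.
  apply/seteqP; split=> _ [y Ny <-].
    by exists (z * y); [exact: NM|rewrite mulgA].
  by exists (z^-1 * y); [apply: NM => //; exact: NV|rewrite -mulgA mulVKg].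
have [gT [u [v [uK vK uM cT]]]] := finite_group_model cQ.
exists gT, (u \o qpi N'); split=> [x y|a||x|A].
- rewrite /= -uM; congr u; exact/esym/qmulE.
- by exists (repr (v a)); rewrite /= qreprK vK.
- by rewrite /pgroup cardsT cT pnatX pnat_id.
- move=> /= ux; apply: NU; have : qpi N' 1 = qpi N' x.
    apply: (can_inj uK); rewrite ux; apply: (mulgI (u (qpi N' 1))).
    by rewrite mulg1 -uM; congr u; rewrite [LHS]qmulE mulg1.
  by move=> /qpiP; rewrite invg1 mul1g.
- have [N1 _ _] := sN.
  apply: (@locally_constant_open _ _ _ N); first exact: open_nbhs_nbhs.
  move=> x z Nz /=; congr u; apply/esym/qpiP; by rewrite mulKg.
Qed.

Lemma closed_separation (A : set G) x : closed A -> ~ A x ->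
  exists (gT : finGroupType) (u : G -> gT),
    [/\ {morph u : x y / x * y}, forall a, exists x, u x = a,
        p.-group [set: gT]%SET, forall y, A y -> u y <> u x &
        forall A, open (u @^-1` A)].
Proof.
move=> cA Ax.
have : nbhs (1 : G) ((fun y => x * y) @^-1` (~` A)).
  apply: mulgl_continuous; rewrite mulg1; apply: open_nbhs_nbhs; split=> //.
  exact: closed_openC.
move=> /pro_p_finite_quotient[gT [u [uM uS pT uA uO]]].
exists gT, u; split=> // y Ay uyx.
have : u (x^-1 * y) = 1 by rewrite uM uyx -uM mulVg (gmorph1 uM).
by move=> /uA; rewrite /= mulVKg.
Qed.

Lemma image_group (gT : finGroupType) (u : G -> gT) (A : set G) :
  {morph u : x y / x * y} -> is_subgroup A ->
  exists L : {group gT}, forall t, t \in L <-> exists2 x, A x & u x = t.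
Proof.
move=> uM [A1 AM AV].
pose L := finset (fun t => `[< exists2 x, A x & u x = t >]).
have LP t : t \in L <-> exists2 x, A x & u x = t.
  by rewrite finset.inE; split=> /asboolP.
have gL : group_set L.
  apply/group_setP; split; first by apply/LP; exists 1; rewrite ?(gmorph1 uM).
  move=> _ _ /LP[x Ax <-] /LP[y Ay <-]; apply/LP; exists (x * y) => //.
  exact: AM.
by exists (group gL).
Qed.

(** A proper closed subgroup stays proper in some finite p-quotient, where a maximal subgroup above
    its image has index p. *)
Lemma pro_p_hom_separation (A : set G) : closed_subgroup A -> A <> setT ->
  exists f : G -> 'F_p, [/\ H1 f, forall x, A x -> f x = 0%R & exists x, f x <> 0%R].
Proof.
move=> cA AT; have [x Ax] : exists x, ~ A x.
  apply: contrapT => h; apply: AT; apply/seteqP; split=> // x _.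
  by apply: contrapT => Ax; apply: h; exists x.
have [gT [u [uM uS pT uA uO]]] := closed_separation cA.2 Ax.
have [L LP] := image_group uM cA.1.
have [|f [fM fL [t ft]]] := @pgroup_proper_hom p gT p_pr pT L.
  apply/properP; split; first exact: finset.subsetT.
  exists (u x); first by rewrite finset.inE.
  by apply/negP => /LP[y /uA].
exists (f \o u); split=> [|y Ay|]; last first.
- by have [y uy] := uS t; exists y => /=; rewrite uy; apply/eqP.
- by apply: fL; apply/LP; exists y.
- by split=> [y z|a] /=; [rewrite uM fM|rewrite comp_preimage; exact: uO].
Qed.

(** Nakayama for pro-p groups: if [M] does not fill [K], a nonzero conjugation-invariant functional
    on [K] detects this. Only the restriction of [f] to [K] is a homomorphism. *)
Lemma pro_p_chief_hom (M K : set G) :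
  closed_normal_subgroup M -> closed_normal_subgroup K -> M `<=` K -> M <> K ->
  exists f : G -> 'F_p,
    [/\ forall x y, K x -> K y -> f (x * y) = (f x + f y)%R,
        forall x g, K x -> f (x ^ g) = f x,
        forall A, open (f @^-1` A),
        forall x, M x -> f x = 0%R & exists2 x, K x & f x <> 0%R].
Proof.
move=> [cM nM] [cK nK] MK neMK; have [x Kx Mx] : exists2 x, K x & ~ M x.
  apply: contrapT => h; apply: neMK; apply/seteqP; split=> // x Kx.
  by apply: contrapT => Mx; apply: h; exists x.
have [gT [u [uM uS pT uA uO]]] := closed_separation cM.2 Mx.
have [M' MP] := image_group uM cM.1; have [K' KP] := image_group uM cK.1.
have nrm (L : {group gT}) (A : set G) : is_normal A ->
    (forall t, t \in L <-> exists2 x, A x & u x = t) -> fingroup.normal L [set: gT]%SET.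
  move=> nA LP; rewrite /fingroup.normal finset.subsetT; apply/fintype.subsetP => t _.
  rewrite finset.inE; apply/fintype.subsetP => _ /imsetP[_ /LP[y Ay <-] ->].
  by have [z <-] := uS t; apply/LP; exists (y ^ z); [exact: nA|rewrite gmorphJ].
have [|||f [fM fJ fL [t /KP[y Ky <-] ft]]] := @pgroup_chief_hom p gT p_pr pT M' K'.
- exact: nrm MP.
- exact: nrm KP.
- apply/properP; split; first by apply/fintype.subsetP => _ /MP[y /MK Ky <-]; apply/KP; exists y.
  by exists (u x); [apply/KP; exists x|apply/negP => /MP[y /uA]].
exists (f \o u); split=> [y' z Ky' Kz|y' z Ky'|A|y' My|].
- by rewrite /= uM fM//; apply/KP; [exists y'|exists z].
- by rewrite /= (gmorphJ uM) fJ//; apply/KP; exists y'.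
- by rewrite comp_preimage; exact: uO.
- by apply: fL; apply/MP; exists y'.
- by exists y => //=; apply/eqP.
Qed.

End ProPGroups.

(** * Square roots for odd p and lifting of inverted elements *)

Section SquareRoots.
Variables (p : nat) (p_pr : prime p) (p_gt2 : (2 < p)%N).

(** The order is odd, so raising to the power (|gT| + 1)/2 extracts square roots, with one exponent
    for all elements. *)
Lemma pgroup_sqrt (gT : finGroupType) : p.-group [set: gT]%SET ->
  exists k, forall x : gT, (x * x) ^+ k = x.
Proof.
move=> pT; have oT : odd #|gT|.
  have [k ck] := p_natP pT; rewrite -cardsT ck oddX; apply/orP; right.
  by case: (even_prime p_pr) p_gt2 => [->|->].
exists (#|gT|.+1./2) => x; rewrite -expg2 -expgM.
have -> : (2 * (#|gT|.+1)./2 = #|gT|.+1)%N by lia.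
by rewrite expgS -cardsT expg_cardG ?mulg1 ?finset.inE.
Qed.

Variables (G : topGroupType) (G_pro : pro_p p G).

Lemma pro_p_closed1 : closed [set 1 : G].
Proof.
have [_ /hausdorff_accessible hG _] := G_pro; exact: accessible_closed_set1.
Qed.

Lemma pro_p_sqr_inj : injective (fun x : G => x * x).
Proof.
move=> x y exy; apply: contrapT => nxy.
have [|gT [u [uM _ pT uA _]]] := closed_separation p_pr G_pro (x := x^-1 * y) pro_p_closed1.
  by move=> /= /(congr1 (mulg x)); rewrite mulVKg mulg1 => /esym.
apply: (uA 1) => //; have [k uk] := pgroup_sqrt pT.
have e : u x = u y by rewrite -(uk (u x)) -uM exy uM uk.
by rewrite uM (gmorphV uM) e mulVg (gmorph1 uM).
Qed.

Lemma pro_p_sqrt_ex (z : G) : exists x, x * x = z.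
Proof.
have [cG hG _] := G_pro.
have sC : continuous (fun x : G => x * x).
  move=> x; apply: (@continuous_comp _ _ _ (fun x => (x, x)) (fun p : G * G => p.1 * p.2)).
    by apply: cvg_pair => /=; exact: cvg_id.
  exact: mulg_continuous.
have cR : closed (range (fun x : G => x * x)).
  apply: compact_closed => //; apply: continuous_compact => //.
  exact: continuous_subspaceT.
suff [x _ <-] : range (fun x : G => x * x) z by exists x.
apply: contrapT => nz; have [gT [u [uM _ pT uA _]]] := closed_separation p_pr G_pro cR nz.
have [k uk] := pgroup_sqrt pT; apply: (uA (z ^+ k * z ^+ k)); first by exists (z ^+ k).
by rewrite uM !(gmorphX uM) -expgMn ?uk.
Qed.

End SquareRoots.

(** For any lift x of a, the square root w of sigma(x)^-1 x works: sigma(w) = w^-1 and f(w) = a hold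
    after squaring, and squaring is injective. *)
Lemma minus_lift (p : nat) (P H : sigmaGroupType) (f : P -> H) (a : H) :
  prime p -> (2 < p)%N -> pro_p p P -> pro_p p H ->
  {morph f : x y / x * y} -> {morph f : x / sigma x} -> (forall b, exists x, f x = b) ->
  minus H a -> exists2 x, minus P x & f x = a.
Proof.
move=> p_pr p2 P_pro H_pro fM fs fS; rewrite /minus /= => sa; have [x fx] := fS a.
have sV (K : sigmaGroupType) : {morph (@sigma K) : x / x^-1} := gmorphV (@sigmaM K).
have [w ww] := pro_p_sqrt_ex p_pr p2 P_pro ((sigma x)^-1 * x).
exists w; last first.
  by apply: (pro_p_sqr_inj p_pr p2 H_pro); rewrite -fM ww fM (gmorphV fM) fs fx sa invgK.
apply: (pro_p_sqr_inj p_pr p2 P_pro); rewrite -sigmaM ww sigmaM sV sigmaK -invgM ww.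
by rewrite invgM invgK.
Qed.

Lemma pro_pP (p : nat) (G : topGroupType) : compact [set: G] -> hausdorff_space G ->
  (forall U : set G, nbhs (1 : G) U -> exists (gT : finGroupType) (u : G -> gT),
    [/\ {morph u : x y / x * y}, forall a, exists x, u x = a,
        p.-group [set: gT]%SET, forall x, u x = 1 -> U x &
        forall A, open (u @^-1` A)]) ->
  pro_p p G.
Proof.
move=> cG hG hU; split=> // U /hU[gT [u [uM uS pT uU uO]]].
have u1 := gmorph1 uM; have uV := gmorphV uM.
exists [set x | u x = 1]; split=> //.
- exact: (uO [set 1]).
- by split=> [|x y ux uy|x ux] //=; rewrite ?uM ?uV ?ux ?uy ?mulg1 ?invg1.
- by move=> x g /= ux; rewrite (gmorphJ uM) ux conj1g.
have [k ck] := p_natP pT; exists k.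
rewrite -ck cardsT; apply/card_esym/card_set_bijP.
have cosE x : [set x * y | y in [set x | u x = 1]] = [set y | u y = u x].
  apply/seteqP; split=> [_ [y /= uy <-]|y /= uy]; first by rewrite /= uM uy mulg1.
  by exists (x^-1 * y); rewrite ?mulVKg//= uM uV uy mulVg.
exists (fun i => [set x | val (enum_rank (u x)) = i]); split.
- move=> i /= ltic; have [x ux] := uS (enum_val (Ordinal ltic)).
  exists x => //; rewrite cosE; apply/seteqP; split=> y /=.
    by move=> ->; rewrite ux enum_valK.
  move=> ei; apply: enum_rank_inj; apply: val_inj.
  by rewrite /= ux enum_valK.
- move=> i j; rewrite !inE /= => ltic _; have [x ux] := uS (enum_val (Ordinal ltic)).
  move=> /seteqP[+ _] => /(_ x)/=; rewrite ux enum_valK /=; exact.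
- move=> _ [x _ <-]; exists (val (enum_rank (u x))); first by rewrite /=.
  rewrite cosE; apply/seteqP; split=> y /=; first by move=> /val_inj/enum_rank_inj.
  by move=> ->.
Qed.

Lemma qpiM (G : sigmaGroupType) (N : sigmaNormal G) : {morph qpi N : x y / x * y}.
Proof. by move=> x y; apply/esym; exact: qmulE. Qed.

Lemma qpi_sigma (G : sigmaGroupType) (N : sigmaNormal G) :
  {morph qpi N : x / sigma x}.
Proof. by move=> x; apply/esym; exact: qsigmaE. Qed.

(** Pushes a finite quotient of [G] down to [quot N] by dividing out the image of [N]. *)
Lemma quot_finite_quotient (p : nat) (G : sigmaGroupType) (N : sigmaNormal G)
    (gT : finGroupType) (u : G -> gT) :
  {morph u : x y / x * y} -> (forall a, exists x, u x = a) ->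
  p.-group [set: gT]%SET -> (forall A, open (u @^-1` A)) ->
  exists (rT : finGroupType) (v : quot N -> rT),
    [/\ {morph v : x y / x * y}, forall a, exists x, v x = a,
      p.-group [set: rT]%SET,
      forall x, v (qpi N x) = 1 -> exists2 z, ns_set N z & u x = u z &
      forall A, open (v @^-1` A)].
Proof.
move=> uM uS pT uO; have sN := ns_subgroup N; have [L LP] := image_group uM sN.
have nL : [set: gT]%SET \subset 'N(L).
  apply/fintype.subsetP => t _.
  rewrite finset.inE; apply/fintype.subsetP => _ /imsetP[_ /LP[y Ny <-] ->].
  have [z <-] := uS t; apply/LP; exists (y ^ z); last by rewrite gmorphJ.
  exact: ns_normal.
have nLx x : u x \in 'N(L) by apply: (fintype.subsetP nL); rewrite finset.inE.
pose v (a : quot N) := coset L (u (repr a)).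
have vE x : v (qpi N x) = coset L (u x).
  have [z Nz e] := repr_qpi N x; rewrite /v e uM morphM ?nLx//=.
  by rewrite [coset L (u z)]coset_id ?mulg1//; apply/LP; exists z.
exists (coset_of L), v; split.
- move=> a b; move: a b; apply: quotP => x; apply: quotP => y.
  by rewrite -qpiM !vE uM morphM ?nLx.
- move=> a; case: (cosetP a) => t nt ->; have [x <-] := uS t.
  by exists (qpi N x).
- have := quotient_pgroup L pT; apply: pgroupS; apply/fintype.subsetP => a _.
  by case: (cosetP a) => t nt ->; rewrite mem_quotient// finset.inE.
- by move=> x; rewrite vE => /coset_idr-/(_ (nLx x))/LP[z Nz e]; exists z.
- move=> A; rewrite quot_openE.
  have -> : qpi N @^-1` (v @^-1` A) = u @^-1` (coset L @^-1` A).
    by apply/seteqP; split=> x /=; rewrite vE.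
  exact: uO.
Qed.

Lemma quot_pro_p (p : nat) (G : sigmaGroupType) (N : sigmaNormal G) :
  prime p -> pro_p p G -> closed (N : set G) -> pro_p p (quot N).
Proof.
move=> p_pr G_pro cN; have [cG hG _] := G_pro.
have [N1 NM NV] := ns_subgroup N.
apply: pro_pP.
- have -> : [set: quot N] = qpi N @` setT.
    by apply/seteqP; split=> // a _; exists (repr a); rewrite ?qreprK.
  apply: continuous_compact => //; apply: continuous_subspaceT.
  exact: qpi_continuous.
- rewrite open_hausdorff => a b; move: a b; apply: quotP => x; apply: quotP => y nxy.
  have nN : ~ ns_set N (x^-1 * y) by move=> /qpiP e; rewrite e eqxx in nxy.
  have [gT [u [uM uS pT uN uO]]] := closed_separation p_pr G_pro cN nN.
  have [rT [v [vM vS pv vN vO]]] := quot_finite_quotient N uM uS pT uO.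
  exists (v @^-1` [set v (qpi N x)], v @^-1` [set v (qpi N y)]) => /=.
    by rewrite !inE.
  split; [exact: vO|exact: vO|].
  apply/eqP/seteqP; split=> // a [/= -> e].
  have /vN[z Nz uz] : v (qpi N (x^-1 * y)) = 1.
    by rewrite qpiM vM -e -vM -qpiM mulVg (gmorph1 (@qpiM _ N)) (gmorph1 vM).
  by case: (uN z Nz).
- move=> U U1; have /(pro_p_finite_quotient p_pr G_pro) : nbhs (1 : G) (qpi N @^-1` U).
    exact: qpi_continuous.
  case=> gT [u [uM uS pT uU uO]].
  have [rT [v [vM vS pv vN vO]]] := quot_finite_quotient N uM uS pT uO.
  exists rT, v; split=> //; apply: quotP => x /vN[z Nz uz].
  have -> : qpi N x = qpi N (x * z^-1) by apply/qpiP; rewrite mulKg; exact: NV.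
  by apply: uU; rewrite uM (gmorphV uM) uz mulgV.
Qed.

(** * Free pro-p groups with involution *)

Section DiscreteGroup.
Variable A : finZmodType.

(** A finite additive group written multiplicatively, so that the universal property of F_m reaches
    the targets F_p and Z/p^k. *)
Definition discrete_group : Type := A.
HB.instance Definition _ := DiscreteTopology.copy discrete_group (discrete_topology A).
HB.instance Definition _ := Finite.copy discrete_group A.

Let mul (a b : discrete_group) : discrete_group := ((a : A) + (b : A))%R.
Let inv (a : discrete_group) : discrete_group := (- (a : A))%R.

Fact discrete_mulA : associative mul. Proof. exact: addrA. Qed.
Fact discrete_mul1g : left_id (0%R : discrete_group) mul. Proof. exact: add0r. Qed.
Fact discrete_mulg1 : right_id (0%R : discrete_group) mul. Proof. exact: addr0. Qed.
Fact discrete_mulVg : left_inverse (0%R : discrete_group) inv mul.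
Proof. exact: addNr. Qed.
Fact discrete_mulgV : right_inverse (0%R : discrete_group) inv mul.
Proof. exact: addrN. Qed.

HB.instance Definition _ := isGroup.Build discrete_group
  discrete_mulA discrete_mul1g discrete_mulg1 discrete_mulVg discrete_mulgV.

Fact discrete_mul_continuous :
  continuous (fun ab : discrete_group * discrete_group => ab.1 * ab.2 : discrete_group).
Proof.
case=> a b U; rewrite nbhs_principalE => /principal_filterP Uab.
exists ([set a], [set b]); first by split; exact: discrete_set1.
by case=> _ _ [/= -> ->].
Qed.

Fact discrete_inv_continuous : continuous (fun a : discrete_group => a^-1 : discrete_group).
Proof.
move=> a U /nbhs_singleton Ua.
have : nbhs a ((fun a : discrete_group => a^-1) @^-1` U).
  by rewrite nbhs_principalE; exact/principal_filterP.
exact.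
Qed.

HB.instance Definition _ :=
  isTopGroup.Build discrete_group discrete_mul_continuous discrete_inv_continuous.

Lemma discrete_group_hom (G : topGroupType) (f : G -> A) :
  {morph f : x y / x * y >-> (x + y)%R} -> (forall B, open (f @^-1` B)) ->
  hom (f : G -> discrete_group).
Proof.
move=> fM fO; split=> // x U; rewrite nbhs_principalE => /principal_filterP Ux.
have : nbhs x (f @^-1` U) by apply: open_nbhs_nbhs; split.
exact.
Qed.

Lemma discrete_group_pro_p (p : nat) k : prime p -> #|A| = (p ^ k)%N ->
  pro_p p discrete_group.
Proof.
move=> p_pr cA.
have cD : ([set: discrete_group] #= `I_(p ^ k))%card.
  apply/card_set_bijP; exists (fun a => val (enum_rank (a : A))); split.
  - by move=> a _; rewrite /= -cA.
  - by move=> a b _ _ /val_inj/enum_rank_inj.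
  - move=> i; rewrite /= -cA => lti; exists (enum_val (Ordinal lti) : A) => //=.
    by rewrite enum_valK.
apply: pro_pP; [exact/finite_compact/finite_finset|exact: discrete_hausdorff|].
move=> U U1; have [gT [u [v [uK vK uM cT]]]] := finite_group_model cD.
exists gT, u; split=> [|a|||B]; first exact: uM.
- by exists (v a).
- by rewrite /pgroup cardsT cT pnatX pnat_id.
- move=> x ux; have -> : x = 1 by apply: (can_inj uK); rewrite ux (gmorph1 uM).
  exact: nbhs_singleton.
- exact: discrete_open.
Qed.

End DiscreteGroup.

Section H1Basics.
Variable p : nat.

Lemma H1_0 (G : topGroupType) : H1 (fun _ : G => 0%R : 'F_p).
Proof.
split=> [u v|a]; first by rewrite addr0.
have [->|na] := eqVneq a 0%R.
  by rewrite (_ : _ @^-1` _ = setT); [exact: openT|apply/seteqP; split].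
rewrite (_ : _ @^-1` _ = set0); first exact: open0.
by apply/seteqP; split=> // u /= e; rewrite e eqxx in na.
Qed.

Lemma H1_open (G : topGroupType) (f : G -> 'F_p) : H1 f -> forall B, open (f @^-1` B).
Proof.
move=> [_ fO] B; rewrite (_ : _ @^-1` _ = \bigcup_(a in B) (f @^-1` [set a])).
  by apply: bigcup_open => a _.
by apply/seteqP; split=> [y By|y [a Ba /= ->]//]; exists (f y).
Qed.

End H1Basics.

Section FreeGroup.
Variables (p : nat) (p_pr : prime p) (p_gt2 : (2 < p)%N) (m : nat) (F : freeSigma p m).
Notation x := (@free_gen _ _ F).

Let F_pro : pro_p p F := (free_gen_free F).1.

Lemma free_hom_ex (A : finZmodType) k (c : 'I_m -> A) : #|A| = (p ^ k)%N ->
  exists f : F -> A, [/\ {morph f : x y / x * y >-> (x + y)%R},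
    forall B, open (f @^-1` B) & forall i, f (x i) = c i].
Proof.
move=> cA; have [f [[[fM fC] fx] _]] :=
  (free_gen_free F).2 _ (discrete_group_pro_p p_pr cA) c.
exists f; split=> // B; apply: (@open_comp _ _ f) => [y _|]; first exact: fC.
exact: (@discrete_open (discrete_group A)).
Qed.

Lemma free_hom_eq (A : finZmodType) k (f g : F -> A) : #|A| = (p ^ k)%N ->
  {morph f : x y / x * y >-> (x + y)%R} -> (forall B, open (f @^-1` B)) ->
  {morph g : x y / x * y >-> (x + y)%R} -> (forall B, open (g @^-1` B)) ->
  (forall i, f (x i) = g (x i)) -> f = g.
Proof.
move=> cA fM fO gM gO fg; have [h [_ hU]] :=
  (free_gen_free F).2 _ (discrete_group_pro_p p_pr cA) (fun i => f (x i)).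
rewrite -(hU f); last by split; [exact: discrete_group_hom|].
by apply: hU; split; [exact: discrete_group_hom|move=> i; rewrite fg].
Qed.

Lemma free_hom_unique (P : topGroupType) (f g : F -> P) : pro_p p P ->
  hom f -> hom g -> (forall i, f (x i) = g (x i)) -> f = g.
Proof.
move=> P_pro fh gh fg; have [h [_ hU]] := (free_gen_free F).2 _ P_pro (fun i => f (x i)).
by rewrite -(hU f)// (hU g)//; split=> // i; rewrite fg.
Qed.

Lemma card_Fp_pfactor : #|'F_p| = (p ^ 1)%N.
Proof. by rewrite card_Fp. Qed.

Lemma H1_free_eq (f g : F -> 'F_p) : H1 f -> H1 g -> (forall i, f (x i) = g (x i)) ->
  f = g.
Proof.
move=> f1 g1; apply: (free_hom_eq card_Fp_pfactor f1.1 _ g1.1); exact: H1_open.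
Qed.

Lemma free_gen_dense (S : set F) : closed_subgroup S -> (forall i, S (x i)) -> S = setT.
Proof.
move=> cS Sx; apply: contrapT => /(pro_p_hom_separation p_pr F_pro cS)[f [f1 fS [y]]].
apply; rewrite (_ : f = fun=> 0%R)//; apply: H1_free_eq => //; first exact: H1_0.
by move=> i; rewrite fS.
Qed.

(** Both sides are homomorphisms in y, and sigma inverts the free generators. *)
Lemma H1_sigma (f : F -> 'F_p) : H1 f -> forall y, f (sigma y) = (- f y)%R.
Proof.
move=> f1 y; have [fM _] := f1; have f0 : f 1 = 0%R.
  by apply: (addrI (f 1)); rewrite -fM mulg1 addr0.
suff : f \o sigma = (fun y => - f y)%R by move=> /(congr1 (@^~ y)).
apply: H1_free_eq.
- split=> [u v|a] /=; first by rewrite sigmaM fM.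
  rewrite comp_preimage; apply: open_comp => [u _|]; first exact: sigma_continuous.
  exact: H1_open.
- split=> [u v|a]; first by rewrite fM opprD.
  rewrite (_ : _ @^-1` _ = f @^-1` [set - a]%R); first exact: H1_open.
  by apply/seteqP; split=> u /= => [<-|->]; rewrite opprK.
- move=> i /=; rewrite free_gen_sigma; apply: (addrI (f (x i))).
  by rewrite -fM mulgV f0 subrr.
Qed.

(** Equivariance comes from uniqueness: sigma s sigma and s agree on the generators, since sigma
    inverts both x_i and z_i. *)
Lemma free_sigma_hom_ex (P : sigmaGroupType) (z : 'I_m -> P) : pro_p p P ->
  (forall i, minus P (z i)) -> exists s : F -> P, sigma_hom s /\ forall i, s (x i) = z i.
Proof.
move=> P_pro zm; have [s [[[sM sC] sx] _]] := (free_gen_free F).2 _ P_pro z.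
exists s; split=> //; split=> //.
have ss : sigma \o s \o sigma = s.
  apply: free_hom_unique => //; first split.
  - by move=> u v /=; rewrite sigmaM sM sigmaM.
  - move=> u; apply: continuous_comp; first exact: sigma_continuous.
    by apply: continuous_comp; [exact: sC|exact: sigma_continuous].
  - move=> i /=; rewrite free_gen_sigma (gmorphV sM) (gmorphV (@sigmaM P)) sx.
    by have := zm i; rewrite /minus /= => ->; rewrite invgK.
by move=> y; rewrite -[in RHS]ss /= sigmaK.
Qed.

(** Projectivity of F_m among sigma-pro-p-groups: the images of the generators lie in H^- and lift
    to P^- by [minus_lift]. *)
Lemma free_sigma_lift (P H : sigmaGroupType) (f : P -> H) (g : F -> H) :
  pro_p p P -> pro_p p H -> sigma_hom f -> (forall b, exists y, f y = b) ->
  sigma_hom g -> exists2 s : F -> P, sigma_hom s & forall y, f (s y) = g y.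
Proof.
move=> P_pro H_pro [[fM fC] fs] fS [[gM gC] gs].
have /choice[z zP] : forall i, exists z, minus P z /\ f z = g (x i).
  move=> i; have gx : minus H (g (x i)).
    by rewrite /minus /= -gs free_gen_sigma (gmorphV gM).
  by have [z z1 z2] := minus_lift p_pr p_gt2 P_pro H_pro fM fs fS gx; exists z.
have [s [sh sx]] := free_sigma_hom_ex P_pro (fun i => (zP i).1).
exists s => //; have [[sM sC] _] := sh.
suff fsg : f \o s = g by move=> y; rewrite -fsg.
apply: free_hom_unique => //; last by move=> i /=; rewrite sx; exact: (zP i).2.
split=> [u v|u] /=; first by rewrite sM fM.
by apply: continuous_comp; [exact: sC|exact: fC].
Qed.

End FreeGroup.

(** * Dual systems *)

Section DualSystems.
Variables (k : fieldType) (X : Type).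
Implicit Types (V : set (X -> k)) (f g : X -> k).
Local Open Scope ring_scope.

Definition is_subspace V :=
  V (fun=> 0) /\ forall a f g, V f -> V g -> V (fun x => a * f x + g x).

(** Records dim V = v by a basis [e] together with points whose evaluations form the dual basis. *)
Definition dual_system V v (e : 'I_v -> X -> k) (y : 'I_v -> X) :=
  [/\ forall i, V (e i), forall i j, e i (y j) = (i == j)%:R &
      forall f, V f -> (forall j, f (y j) = 0) -> f = fun=> 0].

Lemma subspace_sum V v (c : 'I_v -> k) (e : 'I_v -> X -> k) : is_subspace V ->
  (forall i, V (e i)) -> V (fun x => \sum_i c i * e i x).
Proof.
move=> [V0 VL]; elim: v c e => [|v IH] c e Ve.
  by under eq_fun do rewrite big_ord0.
under eq_fun do rewrite big_ord_recl; apply: VL => //.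
exact: (IH (fun i => c (lift ord0 i)) (fun i => e (lift ord0 i))).
Qed.

Lemma subspaceB V f g : is_subspace V -> V f -> V g -> V (fun x => f x - g x).
Proof.
move=> VS Vf Vg; have := VS.2 (-1) g f Vg Vf; congr V.
by apply/funext => x; rewrite mulN1r addrC.
Qed.

Lemma sum_delta v (c : 'I_v -> k) j : \sum_i c i * (i == j)%:R = c j.
Proof.
rewrite (bigD1 j)//= eqxx mulr1 big1 ?addr0// => i /negPf ->.
by rewrite mulr0.
Qed.

Lemma dual_system_expand V v (e : 'I_v -> X -> k) y f : is_subspace V ->
  dual_system V e y -> V f -> f = fun x => \sum_i f (y i) * e i x.
Proof.
move=> VS [Ve ey yS] Vf; have : (fun x => f x - \sum_i f (y i) * e i x) = fun=> 0.
  apply: yS => [|j]; first by apply: subspaceB => //; exact: subspace_sum.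
  by under eq_bigr do rewrite ey; rewrite sum_delta subrr.
by move=> fE; apply/funext => x; apply/eqP; rewrite -subr_eq0 -[_ - _]/((fun x => _) x) fE.
Qed.

Lemma dual_system_ex V N (x : 'I_N -> X) : is_subspace V ->
  (forall f, V f -> (forall i, f (x i) = 0) -> f = fun=> 0) ->
  exists v (e : 'I_v -> X -> k) y, dual_system V e y.
Proof.
elim: N V x => [|N IH] V x VS xS.
  exists 0%N, (fun=> fun=> 0), x; split=> [[]//|[]//|f Vf _].
  by apply: xS => // -[].
pose V' := [set f | V f /\ f (x ord_max) = 0].
have V'S : is_subspace V'.
  split; first by split; [exact: VS.1|].
  move=> a f g [Vf f0] [Vg g0]; split; first exact: VS.2.
  by rewrite f0 g0 mulr0 addr0.
have [|v [e [y [Ve ey yS]]]] := IH V' (fun i => x (lift ord_max i)) V'S.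
  move=> f [Vf f0] fx; apply: xS => // i.
  by case: (unliftP ord_max i) => [j ->|->].
have [[h [Vh hx]]|nh] := pselect (exists h, V h /\ h (x ord_max) <> 0); last first.
  exists v, e, y; split=> [i||f Vf fy]; [exact: (Ve i).1|exact: ey|].
  by apply: yS => //; split=> //; apply: contrapT => fx; apply: nh; exists f.
(* The function [h] corrected to vanish at the old points [y] and scaled to the value 1 at the new
   point. *)
pose g := fun z => (h (x ord_max))^-1 * (h z - \sum_i h (y i) * e i z).
have gV : V g.
  have -> : g = (fun z => (h (x ord_max))^-1 * (h z - \sum_i h (y i) * e i z) + 0).
    by apply/funext => z; rewrite addr0.
  apply: VS.2 VS.1; apply: subspaceB => //.
  by apply: subspace_sum => // i; exact: (Ve i).1.
have gy j : g (y j) = 0.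
  by rewrite /g; under eq_bigr do rewrite ey; rewrite sum_delta subrr mulr0.
have gx : g (x ord_max) = 1.
  rewrite /g big1 ?subr0 ?mulVf//; first exact/eqP.
  by move=> i _; rewrite (Ve i).2 mulr0.
exists v.+1, (fun i => if unlift ord_max i is Some j then e j else g),
  (fun i => if unlift ord_max i is Some j then y j else x ord_max); split.
- by move=> i; case: unliftP => [j _|_//]; exact: (Ve j).1.
- move=> i j; case: (unliftP ord_max i) => [i' ->|->]; case: (unliftP ord_max j) => [j' ->|->].
  + by rewrite ey (inj_eq lift_inj).
  + by rewrite (Ve i').2 eq_sym (negPf (neq_lift _ _)).
  + by rewrite gy (negPf (neq_lift _ _)).
  + by rewrite gx eqxx.
move=> f Vf fy; apply: yS => [|j]; last by have := fy (lift ord_max j); rewrite liftK.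
by split=> //; have := fy ord_max; rewrite unlift_none.
Qed.

Lemma separated_independent_leq v N (e : 'I_v -> X -> k) (x : 'I_N -> X) :
  (forall c : 'I_v -> k,
    (forall j, \sum_i c i * e i (x j) = 0) -> forall i, c i = 0) ->
  (v <= N)%N.
Proof.
move=> ind; pose A := \matrix_(i < v, j < N) e i (x j).
have /eqP <- : row_free A.
  apply: inj_row_free => c cA; apply/rowP => i; rewrite mxE.
  apply: (ind (c 0)) => j; have := congr1 (fun M : 'rV_N => M 0 j) cA => /=.
  move=> cAj; transitivity ((c *m A) 0 j); last by rewrite cAj mxE.
  by rewrite [RHS]mxE; apply: eq_bigr => l _; rewrite [A l j]mxE.
exact: rank_leq_col.
Qed.

Lemma separated_independent_leq_addl v w N (e : 'I_v -> X -> k) (e' : 'I_w -> X -> k)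
    (x : 'I_N -> X) :
  (forall a b, (forall j, \sum_i a i * e i (x j) + \sum_i b i * e' i (x j) = 0) ->
    (forall i, a i = 0) /\ (forall i, b i = 0)) ->
  (v + w <= N)%N.
Proof.
move=> ind; apply: (@separated_independent_leq _ _
  (fun i => match fintype.split i with inl j => e j | inr j => e' j end) x) => c cx.
have [|a0 b0 i] := ind (fun i => c (lshift w i)) (fun i => c (rshift v i)).
  move=> j; rewrite -[RHS](cx j) big_split_ord /=; congr (_ + _); apply: eq_bigr => i _.
    by rewrite (unsplitK (inl i)).
  by rewrite (unsplitK (inr i)).
by rewrite -(splitK i); case: (fintype.split i).
Qed.

Definition join_points a b (x : 'I_a -> X) (x' : 'I_b -> X) (i : 'I_(a + b)) : X :=
  match fintype.split i with inl j => x j | inr j => x' j end.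

Lemma join_points_vanish a b (x : 'I_a -> X) (x' : 'I_b -> X) f :
  (forall i, f (join_points x x' i) = 0) ->
  (forall i, f (x i) = 0) /\ (forall i, f (x' i) = 0).
Proof.
rewrite /join_points => fx; split=> i.
  by have := fx (lshift b i); rewrite (unsplitK (inl i)).
by have := fx (rshift a i); rewrite (unsplitK (inr i)).
Qed.

Lemma dual_system_leq V v N (e : 'I_v -> X -> k) y (x : 'I_N -> X) : is_subspace V ->
  dual_system V e y ->
  (forall f, V f -> (forall i, f (x i) = 0) -> f = fun=> 0) -> (v <= N)%N.
Proof.
move=> VS [Ve ey _] xS; apply: (@separated_independent_leq _ _ e x) => c cx i.
have := xS _ (subspace_sum c VS Ve) cx => /(congr1 (@^~ (y i))) <-.
by under eq_bigr do rewrite ey; rewrite sum_delta.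
Qed.

End DualSystems.

(** * Epimorphisms and H^1 *)

Definition sigma_epi (G H : sigmaGroupType) (f : G -> H) :=
  sigma_hom f /\ forall b, exists a, f a = b.

Lemma sigma_hom_comp (G H K : sigmaGroupType) (f : G -> H) (g : H -> K) :
  sigma_hom f -> sigma_hom g -> sigma_hom (g \o f).
Proof.
move=> [[fM fC] fs] [[gM gC] gs]; split; last by move=> x /=; rewrite fs gs.
split=> [x y|x]; first by rewrite /= fM gM.
by apply: continuous_comp; [exact: fC|exact: gC].
Qed.

Lemma sigma_hom_id (G : sigmaGroupType) : sigma_hom (@id G).
Proof. by split=> //; split=> // x; exact: cvg_id. Qed.

Lemma sigma_epi_comp (G H K : sigmaGroupType) (f : G -> H) (g : H -> K) :
  sigma_epi f -> sigma_epi g -> sigma_epi (g \o f).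
Proof.
move=> [fh fS] [gh gS]; split; first exact: sigma_hom_comp.
by move=> c; have [b <-] := gS c; have [a <-] := fS b; exists a.
Qed.

Lemma continuous_open_preimage (S T : topologicalType) (f : S -> T) A :
  continuous f -> open A -> open (f @^-1` A).
Proof. by move=> fC oA; apply: open_comp => // x _; exact: fC. Qed.

Section H1.
Variable p : nat.

Lemma open_preimage2 (G : topologicalType) (A B C : Type) (f : G -> A) (g : G -> B)
    (h : A -> B -> C) :
  (forall S, open (f @^-1` S)) -> (forall S, open (g @^-1` S)) ->
  forall S, open ((fun x => h (f x) (g x)) @^-1` S).
Proof.
move=> fO gO S.
rewrite (_ : _ @^-1` _ = \bigcup_(ab in [set ab : A * B | S (h ab.1 ab.2)])
  (f @^-1` [set ab.1] `&` g @^-1` [set ab.2])).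
  by apply: bigcup_open => ab _; apply: openI.
apply/seteqP; split=> x /=; first by exists (f x, g x).
by move=> [[a b] /= Sab [/= -> ->]].
Qed.

Lemma H1_comp (G H : topGroupType) (f : H -> 'F_p) (g : G -> H) :
  H1 f -> hom g -> H1 (f \o g).
Proof.
move=> f1 [gM gC]; split=> [x y|a]; first by rewrite /= gM f1.1.
by rewrite comp_preimage; apply: continuous_open_preimage => //; exact: H1_open.
Qed.

Lemma H1_subspace (G : topGroupType) : is_subspace (@H1 p G).
Proof.
split; first exact: H1_0.
move=> a f g f1 g1; split=> [x y|b].
  by rewrite f1.1 g1.1 mulrDr addrACA.
by apply: (@open_preimage2 _ _ _ _ f g (fun u v => a * u + v)%R); exact: H1_open.
Qed.

End H1.

Lemma cst_open_preimage (G : topologicalType) (A : Type) (a : A) B :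
  open ((fun _ : G => a) @^-1` B).
Proof.
have [Ba|nBa] := pselect (B a).
  by rewrite (_ : _ @^-1` _ = setT); [exact: openT|apply/seteqP; split].
by rewrite (_ : _ @^-1` _ = set0); [exact: open0|apply/seteqP; split].
Qed.

Section LocallyConstantHomomorphisms.
Variables (A : zmodType) (G : topGroupType).
Implicit Types f g : G -> A.

(** The analogue of [H1] for any abelian target; Z/p^k is needed for the lower bound on the number
    of relators. *)
Definition lc_hom f :=
  {morph f : x y / x * y >-> (x + y)%R} /\ forall B, open (f @^-1` B).

Lemma lc_hom1 f : lc_hom f -> f 1 = 0%R.
Proof. by move=> [fM _]; apply: (addrI (f 1)); rewrite -fM mulg1 addr0. Qed.

Lemma lc_homV f x : lc_hom f -> f x^-1 = (- f x)%R.
Proof.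
by move=> fl; apply: (addrI (f x)); rewrite -fl.1 mulgV lc_hom1// subrr.
Qed.

Lemma lc_homX f x k : lc_hom f -> f (x ^+ k) = (f x *+ k)%R.
Proof.
move=> fl; elim: k => [|k IH]; first by rewrite expg0 lc_hom1.
by rewrite expgS fl.1 IH mulrS.
Qed.

Lemma lc_hom0 : lc_hom (fun=> 0%R).
Proof. by split=> [x y|B]; [rewrite addr0|exact: cst_open_preimage]. Qed.

Lemma lc_hom_eq_closed_normal f g : lc_hom f -> lc_hom g ->
  closed_normal_subgroup [set x | f x = g x].
Proof.
move=> fl gl; split; first split.
- split=> [|x y /= fx fy|x /= fx]; first by rewrite /= !lc_hom1.
  + by rewrite fl.1 gl.1 fx fy.
  + by rewrite !lc_homV// fx.
- rewrite -openC.
  exact: (@open_preimage2 _ _ _ _ f g (fun u v => u <> v) fl.2 gl.2 (fun P : Prop => P)).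
- move=> x y /= e; rewrite /conjg !fl.1 !gl.1 !lc_homV// e.
  by rewrite [(_ + f y)%R]addrC addKr [(_ + g y)%R]addrC addKr.
Qed.

Lemma lc_hom_comm f x : lc_hom f -> comm_subgroup [set: G] [set: G] x -> f x = 0%R.
Proof.
move=> fl; have [cK _] := lc_hom_eq_closed_normal fl lc_hom0.
move: x; apply: smallest_sub => // _ [a _ [b _ <-]].
by rewrite /= /commg /conjg !fl.1 !lc_homV// [(f a + f b)%R]addrC addKr addNr.
Qed.

End LocallyConstantHomomorphisms.

Lemma H1_lc_hom p (G : topGroupType) (f : G -> 'F_p) : H1 f <-> lc_hom f.
Proof.
split=> -[fM fO]; split=> //; exact: H1_open.
Qed.

Section FreeGroupMaps.
Variables (p : nat) (p_pr : prime p) (p_gt2 : (2 < p)%N) (n : nat) (F : freeSigma p n).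
Notation x := (@free_gen _ _ F).

Definition H1_independent (P : topGroupType) (e : 'I_n -> P -> 'F_p) :=
  forall c : 'I_n -> 'F_p, (forall b, \sum_i c i * e i b = 0)%R -> forall i, c i = 0%R.

(** The pullbacks are n independent elements of the n-dimensional H^1(F_n): their matrix of values
    at the generators is invertible. *)
Lemma H1_pullback (P : topGroupType) (e : 'I_n -> P -> 'F_p) (psi : F -> P) :
  (forall i, H1 (e i)) -> H1_independent e -> hom psi -> (forall b, exists a, psi a = b) ->
  forall f : F -> 'F_p, H1 f ->
  exists c : 'I_n -> 'F_p, f = fun a => (\sum_i c i * e i (psi a))%R.
Proof.
move=> e1 ei psih psiS f f1.
have ce1 (c : 'I_n -> 'F_p) : H1 (fun a => \sum_i c i * e i (psi a))%R.
  apply: (subspace_sum c (e := fun i a => e i (psi a))); first exact: H1_subspace.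
  by move=> i; exact: (H1_comp (e1 i) psih).
pose A := (\matrix_(i < n, j < n) e i (psi (x j)))%R.
have AE (c : 'rV_n) j : ((c *m A) 0 j = \sum_i c 0 i * e i (psi (x j)))%R.
  by rewrite mxE; apply: eq_bigr => i _; rewrite mxE.
have uA : A \in unitmx.
  rewrite -row_free_unit; apply: inj_row_free => c cA; apply/rowP => i; rewrite mxE.
  apply: (ei (fun i => c 0%R i)) => b; have [a <-] := psiS b.
  have : (fun a => \sum_i c 0 i * e i (psi a))%R = fun=> 0%R.
    apply: (H1_free_eq p_pr); [exact: ce1|exact: H1_0|].
    by move=> j; rewrite -AE cA mxE.
  by move=> /(congr1 (@^~ a)).
pose c : 'rV_n := ((\row_j f (x j)) *m invmx A)%R.
exists (c 0%R); apply: (H1_free_eq p_pr) => //.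
by move=> j; rewrite -AE mulmxKV// mxE.
Qed.

Lemma pro_p_surj_criterion (H : topGroupType) (s : F -> H) : pro_p p H -> hom s ->
  (forall f : H -> 'F_p, H1 f -> (forall a, f (s a) = 0%R) -> f = fun=> 0%R) ->
  forall h, exists a, s a = h.
Proof.
move=> H_pro [sM sC] fS; have [cF _ _] := (free_gen_free F).1.
have [_ hH _] := H_pro.
have cR : closed_subgroup (range s).
  split; last first.
    apply: compact_closed => //; apply: continuous_compact => //.
    exact: continuous_subspaceT.
  split; first by exists 1; rewrite ?(gmorph1 sM).
  - by move=> _ _ [a _ <-] [b _ <-]; exists (a * b).
  - by move=> _ [a _ <-]; exists a^-1; rewrite ?(gmorphV sM).
suff sT : range s = setT.
  move=> h; have [a _ <-] : range s h by rewrite sT.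
  by exists a.
apply: contrapT => /(pro_p_hom_separation p_pr H_pro cR)[f [f1 fs [h]]]; apply.
by rewrite (fS f)// => a; apply: fs; exists a.
Qed.

(** A map to a pro-p-group is onto as soon as no nonzero functional kills its image. Here all
    functionals on [H] come from [Q], onto which [s] already maps surjectively. *)
Lemma free_epi_criterion (H Q : topGroupType) (e : 'I_n -> Q -> 'F_p)
    (phi : H -> Q) (s : F -> H) :
  pro_p p H -> hom s ->
  (forall f : H -> 'F_p, H1 f ->
    exists c : 'I_n -> 'F_p, f = fun a => (\sum_i c i * e i (phi a))%R) ->
  (forall b, exists a, phi (s a) = b) -> H1_independent e ->
  forall h, exists a, s a = h.
Proof.
move=> H_pro sh eH sS ei; apply: pro_p_surj_criterion => // f f1 fs.
have [c fE] := eH f f1; rewrite fE; apply/funext => h.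
rewrite big1// => i _; rewrite (ei c) ?mul0r// => b.
by have [a <-] := sS b; have := fs a; rewrite fE.
Qed.

End FreeGroupMaps.

(** * Probabilities and counting *)

Section FiniteProbability.
Context d (T : measurableType d) (R : realType) (P : probability T R).
Local Open Scope ereal_scope.

Lemma probability_finite_bigcup (I : finType) (F : I -> set T) :
  (forall i, measurable (F i)) -> trivIset setT F ->
  P (\bigcup_i F i) = \sum_i P (F i).
Proof.
move=> mF tF; rewrite measure_fin_bigcup//; last exact: finite_finset.
rewrite (_ : [set: I] = [set` index_enum I]); last first.
  by apply/seteqP; split=> i //= _; rewrite mem_index_enum.
by rewrite -fsbig_seq// index_enum_uniq.
Qed.

(** Double counting: integrate the number of i with x in [S i], which is c on [A] and 0 off [A]. *)
Lemma probability_count (I : finType) (S : I -> set T) (A : set T) (c : nat) :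
  (forall i, measurable (S i)) -> measurable A ->
  (forall x, A x -> #|[pred i | `[< S i x >]]| = c) ->
  (forall x i, S i x -> A x) ->
  \sum_i P (S i) = c%:R%:E * P A.
Proof.
move=> mS mA cA SA.
transitivity (\int[P]_x (\sum_i (\1_(S i) x)%:E)).
  rewrite ge0_integral_sum//; first by apply: eq_bigr => i _; rewrite integral_indic ?setIT.
  move=> i; apply/measurable_EFinP; exact: measurable_indic.
transitivity (\int[P]_x (c%:R%:E * (\1_A x)%:E)); last first.
  rewrite ge0_integralZl_EFin//; first by rewrite integral_indic ?setIT.
  by apply/measurable_EFinP; exact: measurable_indic.
apply: eq_integral => x _; rewrite -EFinM sumEFin; congr EFin.
rewrite [in RHS]indicE; have [/set_mem Ax|nAx] := boolP (x \in A).
  rewrite mulr1 -(cA x Ax) -sum1_card natr_sum [in RHS]big_mkcond /=; apply: eq_bigr => i _.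
  by rewrite indicE inE /=; case: asboolP => [/mem_set ->//|nS]; rewrite memNset.
rewrite mulr0 big1// => i _; rewrite indicE memNset// => /SA/mem_set.
by apply/negP.
Qed.

End FiniteProbability.

Section PowerProbability.
Context d (T : measurableType d) (R : realType) (P : probability T R).
Local Open Scope ereal_scope.

Lemma measurable_box n (A : 'I_n -> set T) : (forall i, measurable (A i)) ->
  measurable [set t : n.-tuple T | forall i, A i (tnth t i)].
Proof.
move=> mA; rewrite (_ : [set _ | _] = \bigcap_(i in setT) ((fun t => tnth t i) @^-1` A i)).
  apply: fin_bigcap_measurable => [|i _]; first exact: finite_finset.
  by rewrite -[X in measurable X]setTI; exact: measurable_tnth.
by apply/seteqP; split=> [t tA i _|t tA i]; [exact: tA|exact: tA].
Qed.

Lemma power_prob_box n (A : 'I_n -> set T) : (forall i, measurable (A i)) ->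
  power_prob P n [set t | forall i, A i (tnth t i)] = \prod_i P (A i).
Proof.
elim: n A => [|n IH] A mA.
  rewrite big_ord0 /= diracE mem_set//=; by case.
rewrite big_ord_recl -(IH (fun i => A (lift ord0 i)))//.
have mB := measurable_box (fun i => mA (lift ord0 i)).
rewrite -(product_measure1E P (power_prob P n) (mA ord0) mB).
rewrite /= /pushforward; congr (product_measure1 _ _ _).
apply/seteqP; split=> [[a t] /= h|[a t] /= [h0 h] i].
  split; first by have := h ord0; rewrite tnth0.
  by move=> i; have := h (lift ord0 i); rewrite tnthS.
by case: (unliftP ord0 i) => [j ->|->]; rewrite ?tnthS// tnth0.
Qed.

End PowerProbability.

Section GeneralLinearRatio.
Variables (p : nat) (p_pr : prime p) (R : realType).
Local Open Scope ring_scope.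

Lemma card_unitmx m : (0 < m)%N ->
  #|[pred M : 'M['F_p]_m | M \in unitmx]| =
  (p ^ 'C(m, 2) * \prod_(1 <= i < m.+1) (p ^ i - 1))%N.
Proof.
case: m => // m _; transitivity #|'GL_m.+1['F_p]|; last by rewrite card_GL// card_Fp.
by rewrite cardsT /= card_sub; apply: eq_card.
Qed.

Lemma unitmx_ratio m : (0 < m)%N ->
  (#|[pred M : 'M['F_p]_m | M \in unitmx]|%:R / (p ^ (m * m))%:R : R) =
  \prod_(1 <= i < m.+1) (1 - (p%:R ^+ i)^-1).
Proof.
move=> m0; rewrite card_unitmx// {m0}.
have p0 : p%:R != 0 :> R by rewrite pnatr_eq0 -lt0n prime_gt0.
elim: m => [|m IH]; first by rewrite !big_geq// !expn0 divr1.
rewrite big_nat_recr//= [X in _ = X]big_nat_recr//= -IH.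
have -> : 'C(m.+1, 2) = ('C(m, 2) + m)%N by rewrite binS bin1.
rewrite (_ : (m.+1 * m.+1 = m * m + (m + m.+1))%N); last by lia.
rewrite !expnD !natrM natrB ?expn_gt0 ?prime_gt0// (natrX _ _ m.+1).
have b0 : (p ^ m)%:R != 0 :> R by rewrite natrX expf_neq0.
have t0 : p%:R ^+ m.+1 != 0 :> R by rewrite expf_neq0.
move: b0 t0; set a := (p ^ 'C(m, 2))%:R; set b := (p ^ m)%:R; set t := p%:R ^+ m.+1.
set P := (\prod_(_ <= i < _) _)%:R; set s := (p ^ (m * m))%:R => b0 t0.
have -> : 1 - t^-1 = (t - 1) / t by rewrite mulrBl mulfV// mul1r.
rewrite mulf_div (_ : a * b * _ = b * (a * P * (t - 1))); last first.
  by rewrite [a * b]mulrC -!mulrA.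
rewrite [s * (b * t)]mulrCA -[LHS]mulf_div.
by rewrite mulfV// mul1r.
Qed.

End GeneralLinearRatio.

Section Limits.
Variable R : realType.
Local Open Scope ring_scope.

Lemma C_infty_cvg p : prime p ->
  (fun n => \prod_(1 <= i < n.+1) (1 - (p%:R ^+ i)^-1) : R) @ \oo --> C_infty p R.
Proof.
move=> p_pr; have f0 i : 0 <= 1 - ((p%:R : R) ^+ i)^-1 <= 1.
  have pi1 : 1 <= (p%:R : R) ^+ i by rewrite exprn_ege1// ler1n prime_gt0.
  rewrite subr_ge0 invf_le1 ?(lt_le_trans ltr01)// pi1/=.
  by rewrite lerBlDr lerDl invr_ge0 (le_trans ler01).
have P0 n : 0 <= \prod_(1 <= i < n.+1) (1 - ((p%:R : R) ^+ i)^-1).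
  by apply: prodr_ge0 => i _; have /andP[] := f0 i.
apply: nonincreasing_is_cvgn; last by exists 0 => _ [n _ <-].
apply/nonincreasing_seqP => n; rewrite [leLHS]big_nat_recr//= ler_piMr//.
Qed.

Lemma covering_ratio_cvg (q : nat) (E : nat -> nat) : (0 < q)%N ->
  (forall m, q ^ m <= E m + q * (q - 1) ^ m)%N -> (forall m, E m <= q ^ m)%N ->
  (fun m => (E m)%:R / (q ^ m)%:R : R) @ \oo --> (1 : R).
Proof.
move=> q0 El Eu.
have qm m : 0 < (q ^ m)%:R :> R by rewrite ltr0n expn_gt0 q0.
pose x : R := (q - 1)%:R / q%:R.
apply: (@squeeze_cvgr _ _ _ _ (fun m => 1 - q%:R * x ^+ m) (cst 1)).
- apply: nearW => m; apply/andP; split; last by rewrite ler_pdivrMr// mul1r ler_nat.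
  rewrite ler_pdivlMr// mulrBl mul1r lerBlDr /x expr_div_n -natrX -mulrA -natrX divfK ?gt_eqF//.
  by rewrite -natrM -natrD ler_nat.
- rewrite -[X in _ --> X]subr0; apply: cvgB; first exact: cvg_cst.
  rewrite -[X in _ --> X](mulr0 q%:R); apply: cvgMr; apply: cvg_expr.
  rewrite ger0_norm ?divr_ge0// ltr_pdivrMr ?ltr0n// mul1r ltr_nat.
  by rewrite subn1 prednK.
- exact: cvg_cst.
Qed.

End Limits.

(** Union bound over the value that a non-surjective function misses. *)
Lemma ffun_surjective_bound m q :
  (q ^ m <= #|[pred c : {ffun 'I_m -> 'I_q} | [forall i, i \in codom c]]| +
    q * (q - 1) ^ m)%N.
Proof.
have -> : (q ^ m = #|{ffun 'I_m -> 'I_q}|)%N by rewrite card_ffun !card_ord.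
rewrite -(cardC [pred c : {ffun 'I_m -> 'I_q} | [forall i, i \in codom c]]) leq_add2l.
pose B i := [set c : {ffun 'I_m -> 'I_q} | c \in ffun_on (predC1 i)]%SET.
apply: leq_trans (_ : #|(\bigcup_i B i)%SET| <= _)%N.
  apply/subset_leq_card/fintype.subsetP => c; rewrite !inE => /forallPn[i ic].
  apply/finset.bigcupP; exists i => //; rewrite finset.inE; apply/ffun_onP => j.
  by rewrite inE; apply: contraNneq ic => <-; exact: codom_f.
apply: leq_trans (_ : \sum_i #|B i| <= _)%N; last first.
  rewrite (eq_bigr (fun=> (q - 1) ^ m)%N) => [|i _].
    by rewrite sum_nat_const card_ord.
  by rewrite cardsE card_ffun_on card_ord cardC1 card_ord subn1.
elim/big_rec2: _ => [|i k A _ Ak]; first by rewrite cards0.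
by apply: leq_trans (leq_card_setU _ _) _; rewrite leq_add2l.
Qed.

(** * The Zassenhaus filtration *)

Section Zassenhaus.
Variables (p : nat) (p_pr : prime p).
Let p1 : (1 < p)%N := prime_gt1 p_pr.

Lemma gen_hom (G H : topGroupType) (f : G -> H) (S : set G) (T : set H) :
  hom f -> (forall x, S x -> gen T (f x)) -> forall x, gen S x -> gen T (f x).
Proof.
move=> [fM fC] fS; apply: (@smallest_sub _ _ S (f @^-1` gen T)) => //.
have [[T1 TM TV] cT] := gen_closed_subgroup T.
split; last exact: preimage_closed.
split=> [|x y Tx Ty|x Tx] /=; first by rewrite (gmorph1 fM).
  by rewrite fM; exact: TM.
by rewrite (gmorphV fM); exact: TV.
Qed.

Lemma zassenhaus_hom (G H : topGroupType) (f : G -> H) i x : hom f ->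
  zassenhaus p G i x -> zassenhaus p H i (f x).
Proof.
move=> fh; have fM := fh.1; rewrite /zassenhaus.
suff H' k l y : zassenhaus_rec p k l y -> zassenhaus_rec p k l (f y) by exact: H'.
elim: k l y => {i x} [//|k IH] i x /=; case: ifP => // _; move: x; apply: gen_hom => // x.
case=> [[y Dy <-]|[jk ijk Cx]]; apply: sub_gen.
  by left; exists (f y); [exact: IH|rewrite (gmorphX fM)].
right; exists jk => //; move: x Cx; apply: gen_hom => // _ [a Da [b Db <-]].
apply: sub_gen; exists (f a); first exact: IH.
by exists (f b); [exact: IH|rewrite (gmorphR fM)].
Qed.

Lemma zassenhaus_closed (G : topGroupType) i : closed (zassenhaus p G i).
Proof.
case: i => [|i]; first exact: closedT.
rewrite /zassenhaus /=; case: ifP => _; first exact: closedT.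
exact: (gen_closed_subgroup _).2.
Qed.

Lemma zassenhaus_closed_normal (G : topGroupType) i :
  closed_normal_subgroup (zassenhaus p G i).
Proof.
split; first by split; [exact: zassenhaus_subgroup|exact: zassenhaus_closed].
move=> x g; apply: (@zassenhaus_endo p G (fun y => y ^ g)); first exact: conjg_continuous.
by move=> a b; rewrite conjMg.
Qed.

Lemma H1_zassenhaus (G : topGroupType) (f : G -> 'F_p) i x : H1 f -> (1 < i)%N ->
  zassenhaus p G i x -> f x = 0%R.
Proof.
move=> /H1_lc_hom fl i1; rewrite zassenhausE//.
have [cK _] := lc_hom_eq_closed_normal fl (lc_hom0 _ _).
move: x; apply: smallest_sub => // x [[y Dy <-]|[[a b] /= _ Cx]] /=.
  by rewrite lc_homX// -mulr_natr pchar_Fp_0// mulr0.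
move: x Cx; apply: smallest_sub => // _ [u _ [v _ <-]].
apply: (lc_hom_comm fl); apply: sub_gen; exists u => //.
by exists v.
Qed.

Lemma divup_lt i : (1 < i)%N -> (divup p i < i)%N.
Proof.
move=> i1; rewrite /divup ltn_divLR ?(ltnW p1)//.
by case: p p1 => [//|[//|k]] _ /=; rewrite mulnC; nia.
Qed.

Lemma zassenhaus_decr (G : topGroupType) i j : (i <= j)%N ->
  zassenhaus p G j `<=` zassenhaus p G i.
Proof.
have step k : forall l, (l <= k)%N -> zassenhaus p G l.+1 `<=` zassenhaus p G l.
  elim: k => [|k IH] l; first by rewrite leqn0 => /eqP ->.
  have mono a b : (a <= b)%N -> (b <= k.+1)%N -> zassenhaus p G b `<=` zassenhaus p G a.
    elim: b => [|b IHb]; first by rewrite leqn0 => /eqP ->.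
    rewrite leq_eqVlt => /orP[/eqP ->|ab] bk; first by [].
    by apply: (subset_trans (IH b bk)); apply: IHb => //; exact: ltnW.
  rewrite leq_eqVlt => /orP[/eqP ->|/IH//].
  have [->|k0] := posnP k; first by rewrite zassenhaus1.
  rewrite (@zassenhausE p G k.+2)// (@zassenhausE p G k.+1)//.
  apply: smallest_sub; first exact: gen_closed_subgroup.
  move=> x [[y Dy <-]|[[a b] /= [a0 b0 ab] Cx]].
    apply: sub_gen; left; exists y => //; apply: mono Dy.
      by rewrite /divup leq_div2r// leq_add2r.
    have := @divup_lt k.+2 isT; lia.
  move: x Cx; apply: smallest_sub; first exact: gen_closed_subgroup.
  move=> _ [u Du [v Dv <-]]; apply: sub_gen; right.
  (* The weight drops by one: lower [b] if [a] is 1, and [a] otherwise, so that both indices stay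
     positive. *)
  have [a1|a1] := leqP a 1.
    exists (a, b.-1) => /=; first by split=> //; lia.
    apply: sub_gen; exists u => //; exists v => //.
    by apply: mono Dv; lia.
  exists (a.-1, b) => /=; first by split=> //; lia.
  apply: sub_gen; exists u; last by exists v.
  by apply: mono Du; lia.
elim: j => [|j IH]; first by rewrite leqn0 => /eqP ->.
rewrite leq_eqVlt => /orP[/eqP -> //|ij].
by apply: subset_trans (step j j _) (IH _).
Qed.

(** If D_j were nontrivial, a nonzero invariant functional on D_j would kill D_{pj}, hence D_j. It
    kills p-th powers of D_j, and in a commutator of D_a with D_b, a + b = pj, one index is at least
    j, so that conjugation invariance applies. *)
Lemma zassenhaus_stable (G : topGroupType) j : pro_p p G -> (0 < j)%N ->
  zassenhaus p G j `<=` zassenhaus p G (p * j) -> zassenhaus p G j `<=` [set 1].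
Proof.
move=> G_pro j0 jpj; set K := zassenhaus p G j.
have cK : closed_normal_subgroup K by exact: zassenhaus_closed_normal.
have c1 : closed_normal_subgroup [set 1 : G].
  split; last by move=> x g ->; rewrite /= conj1g.
  split; last exact: pro_p_closed1 G_pro.
  by split=> [|x y -> ->|x ->] //=; rewrite ?mulg1 ?invg1.
have [[[K1 KM KV] _] nK] := cK.
apply: contrapT => nK1; have [||f [fM fJ fO _ [x Kx]]] := pro_p_chief_hom p_pr G_pro c1 cK.
- by move=> x ->.
- by move=> e; apply: nK1; rewrite e.
apply.
have f1 : f 1 = 0%R by apply: (addrI (f 1)); rewrite -fM// mulg1 addr0.
have fV z : K z -> f z^-1 = (- f z)%R.
  by move=> Kz; apply: (addrI (f z)); rewrite -fM ?mulgV ?f1 ?subrr//; exact: KV.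
pose A := [set x | K x /\ f x = 0%R].
have cA : closed_subgroup A.
  split; first split=> [|y z [Ky fy] [Kz fz]|y [Ky fy]]; first by split.
  - by split; [exact: KM|rewrite fM// fy fz addr0].
  - by split; [exact: KV|rewrite fV// fy oppr0].
  apply: closedI; first exact: cK.1.2.
  by rewrite -openC; exact: (fO (fun a => a <> 0%R)).
suff /(_ x (jpj x Kx))[] : zassenhaus p G (p * j) `<=` A by [].
have pj1 : (1 < p * j)%N by rewrite (leq_trans p1)// leq_pmulr.
rewrite zassenhausE//; apply: smallest_sub => // z [[y Dy <-]|[[a b] /= [a0 b0 ab] Cz]].
  have Ky : K y.
    move: Dy; rewrite (_ : divup p (p * j) = j)//.
    by rewrite /divup mulnC divnMDl ?(ltnW p1)// divn_small ?addn0// prednK ?(ltnW p1).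
  have pX k : K (y ^+ k) /\ f (y ^+ k) = (f y *+ k)%R.
    elim: k => [|k [Kk fk]]; first by rewrite expg0.
    by rewrite expgS mulrS -fk -fM//; split=> //; exact: KM.
  split; first exact: (pX p).1.
  by rewrite (pX p).2 -mulr_natr pchar_Fp_0// mulr0.
move: z Cz; apply: smallest_sub => // _ [u Du [v Dv <-]].
have [ja|aj] := leqP j a.
  have Ku : K u by apply: zassenhaus_decr Du.
  have -> : [~ u, v] = u^-1 * u ^ v by [].
  have KuV := KV u Ku; have Kuv := nK u v Ku.
  by split; [exact: KM|rewrite fM// fV// fJ// addNr].
have Kv : K v by apply: zassenhaus_decr Dv; nia.
have -> : [~ u, v] = (v^-1) ^ u * v by rewrite /commg /conjg !mulgA.
have KvV := KV v Kv; have Kuv := nK _ u KvV.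
by split; [exact: KM|rewrite fM// fJ// fV// addNr].
Qed.

(** The orders of the D_{p^t} cannot decrease forever, and [zassenhaus_stable] applies where they
    stall. *)
Lemma zassenhaus_trivial (G : topGroupType) : pro_p p G -> finite_set [set: G] ->
  exists2 j, (0 < j)%N & zassenhaus p G j `<=` [set 1].
Proof.
move=> G_pro fG.
have fD i : finite_set (zassenhaus p G i) by exact: sub_finite_set fG.
have [[t Dt]|nD] := pselect (exists t, zassenhaus p G (p ^ t) `<=` zassenhaus p G (p ^ t.+1)).
  exists (p ^ t)%N; first by rewrite expn_gt0 ltnW.
  by apply: zassenhaus_stable => //; [rewrite expn_gt0 ltnW|rewrite -expnS].
pose c t := #|` fset_set (zassenhaus p G (p ^ t))|.
have cS t : (c t.+1 < c t)%N.
  apply: fproper_ltn_card; rewrite fproperE; apply/andP; split.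
    by rewrite -fset_set_sub//; apply: zassenhaus_decr; rewrite leq_exp2l.
  by apply/negP; rewrite -fset_set_sub// => Dt; apply: nD; exists t.
have ct t : (c t + t <= c 0)%N.
  elim: t => [|t IH]; first by rewrite addn0.
  by apply: leq_trans IH; rewrite addnS -addSn leq_add2r.
by have := ct (c 0).+1; lia.
Qed.

End Zassenhaus.

Lemma qpi_sigma_epi (G : sigmaGroupType) (N : sigmaNormal G) : sigma_epi (qpi N).
Proof.
split; last by move=> b; exists (repr b); rewrite qreprK.
by split; [split; [exact: qpiM|exact: qpi_continuous]|exact: qpi_sigma].
Qed.

Lemma quot_factor (G H : sigmaGroupType) (N : sigmaNormal G) (f : G -> H) :
  sigma_hom f -> (forall x, ns_set N x -> f x = 1) ->
  exists2 g : quot N -> H, sigma_hom g & forall x, g (qpi N x) = f x.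
Proof.
move=> [[fM fC] fs] fN; pose g (a : quot N) := f (repr a).
have gE x : g (qpi N x) = f x.
  by have [z Nz e] := repr_qpi N x; rewrite /g e fM (fN z Nz) mulg1.
exists g => //; split; first split.
- move=> a b; move: a b; apply: quotP => x; apply: quotP => y.
  by rewrite -qpiM !gE fM.
- apply/quotient_continuous => x.
  by rewrite (_ : _ \o _ = f); [exact: fC|apply/funext => z; exact: gE].
- by move=> a; move: a; apply: quotP => x; rewrite -qpi_sigma !gE fs.
Qed.

Lemma sigma_epi_surj (G H : sigmaGroupType) (f : G -> H) :
  sigma_epi f -> set_surj setT setT f.
Proof. by move=> [_ fS] b _; have [a <-] := fS b; exists a. Qed.

Definition epi_of (G H : sigmaGroupType) (f : G -> H) (fE : sigma_epi f) : sigmaEpi G H :=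
  SigmaEpi fE.1 (sigma_epi_surj fE).

Lemma sigmaEpi_epi (G H : sigmaGroupType) (f : sigmaEpi G H) : sigma_epi f.
Proof.
split; first exact: epi_hom.
by move=> b; have [a _ <-] := epi_surj f (I : setT b); exists a.
Qed.

Lemma image_closed (G H : sigmaGroupType) (f : G -> H) (A : set G) :
  compact [set: G] -> hausdorff_space H -> hom f -> closed A -> closed (f @` A).
Proof.
move=> cG hH [_ fC] cA; apply: compact_closed => //; apply: continuous_compact.
  exact: continuous_subspaceT.
exact: subclosed_compact cA cG _.
Qed.

Lemma preimage_closed_normal (G H : topGroupType) (f : G -> H) (A : set H) :
  hom f -> closed_normal_subgroup A -> closed_normal_subgroup (f @^-1` A).
Proof.
move=> [fM fC] [[[A1 AM AV] cA] nA]; split; first split.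
- split=> [|x y Ax Ay|x Ax] /=.
  + by rewrite (gmorph1 fM).
  + by rewrite fM; exact: AM.
  + by rewrite (gmorphV fM); exact: AV.
- exact: preimage_closed.
- by move=> x g Ax /=; rewrite (gmorphJ fM); exact: nA.
Qed.

Section Relators.
Variables (G : sigmaGroupType) (m : nat) (r : m.-tuple (minusT G)).

Lemma relator_mem i : ns_set (relatorN r) (val (tnth r i)).
Proof. by apply: sub_gen_smallest; exists i. Qed.

Lemma relator_sub (A : set G) : closed_normal_subgroup A ->
  (forall i, A (val (tnth r i))) -> ns_set (relatorN r) `<=` A.
Proof. by move=> cA rA; apply: smallest_sub => // _ [i _ <-]; exact: rA. Qed.

Lemma relator_closed : closed (relatorN r : set G).
Proof. by have [[]] := normal_gen_closed_normal [set val (tnth r i) | i in [set: 'I_m]]. Qed.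

End Relators.

(** * Presentations with a given quotient *)

Section FixedQuotient.
Variables (p : nat) (p_pr : prime p) (p_gt2 : (2 < p)%N).
Variables (F : forall m : nat, freeSigma p m) (n : nat) (D : sigmaNormal (F n)).
Hypothesis D_closed : closed (D : set (F n)).
Hypothesis D_Aut : forall f, Aut_sigma (F n) f -> f @` D = D.
Hypothesis D_comm : D `<=` comm_subgroup [set: F n] [set: F n].
Variables (Q : sigmaGroupType) (kappa : F n -> Q) (e : 'I_n -> Q -> 'F_p).
Hypothesis Q_discrete : forall A : set Q, open A.
Hypothesis Q_pro : pro_p p Q.
Hypothesis kappa_epi : sigma_epi kappa.
Hypothesis kappaD : forall d, ns_set D d -> kappa d = 1.
Hypothesis eH1 : forall i, H1 (e i).
Hypothesis e_indep : H1_independent e.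

Let F_pro m : pro_p p (F m) := (free_gen_free (F m)).1.

Lemma H1_descend (H : sigmaGroupType) (rho : F n -> H) (phi : H -> Q) :
  sigma_epi rho -> sigma_epi phi -> forall f : H -> 'F_p, H1 f ->
  exists c : 'I_n -> 'F_p, f = fun a => (\sum_i c i * e i (phi a))%R.
Proof.
move=> rhoE phiE f f1.
have [[[rhoh _] rhoS] [[prh _] prS]] := (rhoE, sigma_epi_comp rhoE phiE).
have [c cE] := H1_pullback p_pr eH1 e_indep prh prS (H1_comp f1 rhoh).
by exists c; apply/funext => h; have [a <-] := rhoS h; rewrite -[LHS]/((f \o rho) a) cE.
Qed.

Lemma lift_epi (H : sigmaGroupType) (rho s : F n -> H) (phi : H -> Q) :
  pro_p p H -> sigma_epi rho -> sigma_epi phi -> sigma_hom s ->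
  (forall b, exists a, phi (s a) = b) -> sigma_epi s.
Proof.
move=> H_pro rhoE phiE sh sS; split=> //.
apply: (free_epi_criterion p_pr H_pro sh.1 _ sS e_indep).
exact: (H1_descend rhoE phiE).
Qed.

(** The functionals on F_n all come from Q, so [alpha] is onto once it is onto modulo ker psi. A
    section of [alpha] is onto for the same reason, hence inverse to it. *)
Lemma endo_Aut (psi : F n -> Q) (alpha : F n -> F n) :
  sigma_epi psi -> sigma_hom alpha -> (forall b, exists a, psi (alpha a) = b) ->
  Aut_sigma (F n) alpha.
Proof.
have idE : sigma_epi (@id (F n)) by split; [exact: sigma_hom_id|move=> b; exists b].
move=> psiE ah aS; have aE := lift_epi (F_pro n) idE psiE ah aS.
have [b bh ab] := free_sigma_lift p_pr p_gt2 (F_pro n) (F_pro n) ah aE.2 idE.1.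
have [|_ bS] := lift_epi (F_pro n) idE (sigma_epi_comp aE psiE) bh.
  by move=> q; have [a <-] := psiE.2 q; exists a; rewrite /= ab.
split=> //; exists b; last exact: bh.1.2.
by split=> x; [have [y <-] := bS x; rewrite ab|exact: ab].
Qed.

(** By projectivity rho' = rho a with a : F_n -> F_n; [endo_Aut] makes a an automorphism, which
    preserves D. *)
Lemma image_D_unique (H : sigmaGroupType) (rho rho' : F n -> H) (phi : H -> Q) :
  pro_p p H -> sigma_epi phi -> sigma_epi rho -> sigma_epi rho' ->
  rho @` D = rho' @` D.
Proof.
move=> H_pro phiE rhoE rho'E.
have [a ah ra] := free_sigma_lift p_pr p_gt2 (F_pro n) H_pro rhoE.1 rhoE.2 rho'E.1.
have aut : Aut_sigma (F n) a.
  apply: (endo_Aut (sigma_epi_comp rhoE phiE)) => // q.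
  have [h <-] := phiE.2 q; have [x <-] := rho'E.2 h.
  by exists x; rewrite /= ra.
rewrite -{1}(D_Aut aut); apply/seteqP; split=> [_ [_ [d Dd <-] <-]|_ [d Dd <-]].
  by exists d.
by exists (a d) => //; exists d.
Qed.

(** * Presentations over Q and the dual of the relation module *)

Definition lifts_kappa m (phi : F m -> Q) (s : F n -> F m) :=
  sigma_hom s /\ forall a, phi (s a) = kappa a.

Lemma lifts_kappa_ex m (phi : F m -> Q) : sigma_epi phi -> exists s, lifts_kappa phi s.
Proof.
move=> phiE.
have [s sh se] := free_sigma_lift p_pr p_gt2 (F_pro m) Q_pro phiE.1 phiE.2 kappa_epi.1.
by exists s.
Qed.

(** That [phi] induces an isomorphism of (G_r)_D with Q, expressed through its kernel in F_m. *)
Definition presents m (r : m.-tuple (minusT (F m))) (phi : F m -> Q) :=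
  exists rho : F n -> quot (relatorN r), sigma_epi rho /\
    forall x, phi x = 1 <-> (rho @` D) (qpi _ x).

(* The F_p-dual of K / K^p [K, F_m] s(D), where K is the kernel of phi; its   *)
(* elements are extended by zero outside K.                                   *)
Definition kernel_dual m (phi : F m -> Q) (s : F n -> F m) : set (F m -> 'F_p) :=
  [set f | [/\ forall x, phi x <> 1 -> f x = 0%R,
    forall x y, phi x = 1 -> phi y = 1 -> f (x * y) = (f x + f y)%R,
    forall x g, f (x ^ g) = f x,
    forall A, open (f @^-1` A) & forall d, ns_set D d -> f (s d) = 0%R]].

Lemma kernel_dual_subspace m (phi : F m -> Q) s : is_subspace (kernel_dual phi s).
Proof.
split; first by split=> // [x y _ _|A]; [rewrite addr0|exact: cst_open_preimage].
move=> a f g [f0 fM fJ fO fD] [g0 gM gJ gO gD]; split.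
- by move=> x px; rewrite f0// g0// mulr0 addr0.
- by move=> x y px py; rewrite fM// gM// mulrDr addrACA.
- by move=> x h; rewrite fJ gJ.
- exact: (@open_preimage2 _ _ _ _ f g (fun u v => a * u + v)%R).
- by move=> d Dd; rewrite fD// gD// mulr0 addr0.
Qed.

Lemma kernel_closed_normal (G : sigmaGroupType) (phi : G -> Q) : sigma_hom phi ->
  closed_normal_subgroup [set x | phi x = 1].
Proof.
move=> [[pM pC] ps]; split; first split.
- split=> [|x y /= px py|x /= px]; first by rewrite /= (gmorph1 pM).
  + by rewrite pM px py mulg1.
  + by rewrite (gmorphV pM) px invg1.
- rewrite -openC.
  exact: (continuous_open_preimage pC (Q_discrete (~` [set 1]))).
- by move=> x g /= px; rewrite (gmorphJ pM) px conj1g.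
Qed.

Lemma kernel_dual_closed_normal m (phi : F m -> Q) s f : sigma_hom phi ->
  kernel_dual phi s f -> closed_normal_subgroup [set x | phi x = 1 /\ f x = 0%R].
Proof.
move=> ph; have [[[K1 KM KV] cK] nK] := kernel_closed_normal ph.
move=> [f0 fM fJ fO fD].
have f1 : f 1 = 0%R by apply: (addrI (f 1)); rewrite -fM// mulg1 addr0.
split; first split.
- split=> [|x y [px fx] [py fy]|x [px fx]]; first by split.
  + by split; [exact: KM|rewrite fM// fx fy addr0].
  + split; first exact: KV.
    by have := fM x x^-1 px (KV x px); rewrite mulgV f1 fx add0r.
- apply: closedI => //; rewrite -openC; exact: (fO (fun a => a <> 0%R)).
- by move=> x g [px fx]; split; [exact: nK|rewrite fJ].
Qed.

Lemma presents_epi m (r : m.-tuple (minusT (F m))) (phi : F m -> Q) s :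
  sigma_epi phi -> lifts_kappa phi s -> presents r phi ->
  exists phiH : quot (relatorN r) -> Q,
    [/\ sigma_epi phiH, forall x, phiH (qpi _ x) = phi x & sigma_epi (qpi (relatorN r) \o s)].
Proof.
move=> phiE [sh ps] [rho [rhoE rhoK]]; have [N1 _ _] := ns_subgroup (relatorN r).
have [|phiH phiHh phiHE] := @quot_factor _ _ (relatorN r) phi phiE.1.
  move=> x Nx; apply/rhoK; exists 1; first by have [] := ns_subgroup D.
  rewrite (gmorph1 rhoE.1.1.1) -(gmorph1 (@qpiM _ (relatorN r))).
  by apply/qpiP; rewrite invg1 mul1g.
have phiHepi : sigma_epi phiH.
  by split=> // b; have [a <-] := phiE.2 b; exists (qpi _ a).
exists phiH; split=> //.
apply: (lift_epi _ rhoE phiHepi).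
- by apply: quot_pro_p => //; exact: relator_closed.
- by apply: sigma_hom_comp => //; exact: (qpi_sigma_epi _).1.
- by move=> b; have [a <-] := kappa_epi.2 b; exists a; rewrite /= phiHE ps.
Qed.

(** If the normal closure M of the y_i and s(D) were smaller than K, [pro_p_chief_hom] would give a
    nonzero functional on K killing M; extended by zero it lies in [kernel_dual], which the y_i
    separate. *)
Lemma kernel_generated m (phi : F m -> Q) s k (y : 'I_k -> F m) :
  sigma_epi phi -> lifts_kappa phi s -> (forall i, phi (y i) = 1) ->
  (forall f, kernel_dual phi s f -> (forall i, f (y i) = 0%R) -> f = fun=> 0%R) ->
  forall A : set (F m), closed_normal_subgroup A -> (forall i, A (y i)) ->
    (forall d, ns_set D d -> A (s d)) -> [set x | phi x = 1] `<=` A.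
Proof.
move=> phiE [sh ps] y1 yS A cA yA dA.
pose M : set (F m) := normal_gen (range y `|` s @` D).
suff <- : M = [set x | phi x = 1].
  by apply: smallest_sub => // x [[i _ <-]|[d Dd <-]]; [exact: yA|exact: dA].
have cM : closed_normal_subgroup M by exact: normal_gen_closed_normal.
have MD d : ns_set D d -> M (s d) by move=> Dd; apply: sub_gen_smallest; right; exists d.
have cK := kernel_closed_normal phiE.1.
have MK : M `<=` [set x | phi x = 1].
  apply: smallest_sub => // x [[i _ <-]|[d Dd <-]]; first exact: y1.
  by rewrite /= ps kappaD.
apply: contrapT => neMK.
have [f [fM fJ fO fm [x px fx]]] := pro_p_chief_hom p_pr (F_pro m) cM cK MK neMK.
pose f' y := if `[< phi y = 1 >] then f y else 0%R.
have f'E z : phi z = 1 -> f' z = f z by rewrite /f' => /asboolP ->.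
apply: fx; rewrite -f'E//; have -> // : f' = fun=> 0%R.
apply: yS; last by move=> i; rewrite f'E// fm//; apply: sub_gen_smallest; left; exists i.
split.
- by move=> z pz; rewrite /f'; case: asboolP.
- by move=> z t pz pt; rewrite !f'E ?fM ?phiE.1.1.1 ?pz ?pt ?mulg1.
- move=> z g; have [pz|npz] := pselect (phi z = 1).
    by rewrite !f'E// ?fJ//; exact: cK.2.
  have npg : phi (z ^ g) <> 1.
    by move=> /(cK.2 _ g^-1); rewrite /= -conjgM mulgV conjg1.
  by rewrite /f'; do 2 case: asboolP.
- apply: (@open_preimage2 _ _ _ _ phi f (fun q u => if `[< q = 1 >] then u else 0%R)) => // S.
  exact: (continuous_open_preimage phiE.1.1.2).
- by move=> d Dd; rewrite f'E ?fm// ?ps ?kappaD//; exact: MD.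
Qed.

(** Forward, rho(D) is also the image of s(D), so K = N_r s(D) and a functional killing r is zero.
    Backward, s followed by the projection to G_r serves as rho: functionals killing its image also
    kill the image of K, by [kernel_generated], and F_m = s(F_n) K. *)
Lemma presentsP m (r : m.-tuple (minusT (F m))) (phi : F m -> Q) s :
  sigma_epi phi -> lifts_kappa phi s ->
  presents r phi <->
  (forall i, phi (val (tnth r i)) = 1) /\
  (forall f, kernel_dual phi s f -> (forall i, f (val (tnth r i)) = 0%R) -> f = fun=> 0%R).
Proof.
move=> phiE sL; have [sh ps] := sL; have sM := sh.1.1.
have [[N1 NM NV] [D1 DM DV]] := (ns_subgroup (relatorN r), ns_subgroup D).
have cNr : pro_p p (quot (relatorN r)).
  by apply: quot_pro_p => //; exact: relator_closed.
split=> [pr|[r1 rS]].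
  have [phiH [phiHE phiHq qsE]] := presents_epi phiE sL pr.
  have [rho [rhoE rhoK]] := pr.
  have KE x : phi x = 1 -> exists2 d, ns_set D d & ns_set (relatorN r) ((s d)^-1 * x).
    move=> /rhoK; rewrite (image_D_unique cNr phiHE rhoE qsE).
    by move=> [d Dd /= /qpiP]; exists d.
  have rK i : phi (val (tnth r i)) = 1.
    rewrite -phiHq (_ : qpi _ _ = 1) ?(gmorph1 phiHE.1.1.1)//.
    rewrite -(gmorph1 (@qpiM _ (relatorN r))); apply/esym/qpiP.
    by rewrite invg1 mul1g; exact: relator_mem.
  split=> // f fK fr; have [f0 fM fJ fO fD] := fK.
  have cn := kernel_dual_closed_normal phiE.1 fK.
  apply/funext => x; have [px|/f0//] := pselect (phi x = 1).
  have [d Dd Nx] := KE x px.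
  have [pn fn] := relator_sub cn (fun i => conj (rK i) (fr i)) Nx.
  rewrite -[x](mulVKg (s d)) fM ?fD ?fn ?addr0//.
  by rewrite ps kappaD.
have cK := kernel_closed_normal phiE.1.
have KA := kernel_generated phiE sL r1 rS.
have rhoh : sigma_hom (qpi (relatorN r) \o s).
  by apply: sigma_hom_comp => //; exact: (qpi_sigma_epi _).1.
have [|phiH phiHh phiHq] := @quot_factor _ _ (relatorN r) phi phiE.1.
  by move=> x Nx; exact: (relator_sub cK r1 Nx).
have rhoE : sigma_epi (qpi (relatorN r) \o s).
  split=> //; apply: (pro_p_surj_criterion p_pr cNr rhoh.1) => f f1 fs.
  have fl : lc_hom (f \o qpi (relatorN r)).
    by apply/H1_lc_hom/H1_comp => //; exact: (qpi_sigma_epi _).1.1.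
  have fM0 x : phi x = 1 -> f (qpi (relatorN r) x) = 0%R.
    apply: (KA _ (lc_hom_eq_closed_normal fl (lc_hom0 _ _))) => [i|d Dd] /=; last exact: fs.
    rewrite -[qpi _ _](_ : qpi (relatorN r) 1 = _).
      by rewrite -[LHS]/((f \o qpi _) 1) lc_hom1.
    by apply/qpiP; rewrite invg1 mul1g; exact: relator_mem.
  apply/funext; apply: quotP => x; have [a ax] := kappa_epi.2 (phi x).
  rewrite -[x](mulVKg (s a)) qpiM f1.1 fs add0r fM0//.
  by rewrite phiE.1.1.1 (gmorphV phiE.1.1.1) ps ax mulVg.
exists (qpi (relatorN r) \o s); split=> // x; split=> [px|[d Dd /= /qpiP Nx]]; last first.
  rewrite -[x](mulVKg (s d)) phiE.1.1.1 ps kappaD// mul1g.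
  exact: (relator_sub cK r1 Nx).
move: x px; apply: KA => [|i|d Dd] /=; last by exists d.
  apply: (@preimage_closed_normal _ _ (qpi (relatorN r)) ((qpi (relatorN r) \o s) @` D)).
    exact: (qpi_sigma_epi _).1.1.
  split; first split.
  - exact: (image_subgroup (epi_of rhoE) D).
  - by apply: image_closed D_closed; [case: (F_pro n)|case: cNr|case: rhoE => -[]].
  - exact: (@image_normal _ _ (epi_of rhoE) D).
exists 1 => //; rewrite (gmorph1 sM); apply/qpiP; rewrite invg1 mul1g.
exact: relator_mem.
Qed.

(** * Comparison of the functionals for phi and for kappa *)

Lemma lifts_kappa_id : lifts_kappa kappa id.
Proof. by split=> //; exact: sigma_hom_id. Qed.

Lemma kernel_dual_section m (phi : F m -> Q) s f : lifts_kappa phi s ->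
  kernel_dual phi s f -> kernel_dual kappa id (f \o s).
Proof.
move=> [[[sM sC] _] ps] [f0 fM fJ fO fD]; split=> //.
- by move=> x kx /=; rewrite f0// ps.
- by move=> x y kx ky /=; rewrite sM fM// ps.
- by move=> x g /=; rewrite (gmorphJ sM) fJ.
- by move=> A; rewrite comp_preimage; apply: continuous_open_preimage.
Qed.

Lemma kernel_dual_sigma m (phi : F m -> Q) s f : sigma_hom phi -> lifts_kappa phi s ->
  kernel_dual phi s f -> kernel_dual phi s (f \o sigma).
Proof.
move=> [[pM pC] psi] [[_ ss] ps] [f0 fM fJ fO fD].
have s1 (H : sigmaGroupType) : sigma (1 : H) = 1 by exact: gmorph1 (@sigmaM H).
split.
- move=> x px /=; rewrite f0// psi => e1.
  by apply: px; rewrite -[phi x]sigmaK e1 s1.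
- by move=> x y px py /=; rewrite sigmaM fM// psi ?px ?py s1.
- by move=> x g /=; rewrite (gmorphJ (@sigmaM (F m))) fJ.
- move=> A; rewrite comp_preimage; apply: continuous_open_preimage => //.
  exact: sigma_continuous.
- by move=> d Dd /=; rewrite -ss fD//; exact: ns_sigma.
Qed.

(** Since F_m = s(F_n) K, put g(s(a) k) = f(k). Vanishing of f on s(F_n) makes this well defined,
    and conjugation invariance makes it additive. *)
Lemma kernel_dual_extension m (phi : F m -> Q) s f : sigma_epi phi -> lifts_kappa phi s ->
  kernel_dual phi s f -> (forall a, f (s a) = 0%R) ->
  exists g : F m -> 'F_p,
    [/\ H1 g, forall a, g (s a) = 0%R & forall x, phi x = 1 -> g x = f x].
Proof.
move=> phiE [[[sM sC] ss] ps] [f0 fM fJ fO fD] fs; have pM := phiE.1.1.1.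
have /choice[t tP] : forall x, exists a, kappa a = phi x.
  by move=> x; exact: kappa_epi.2.
have sV a x : kappa a = phi x -> phi ((s a)^-1 * x) = 1.
  by move=> ax; rewrite pM (gmorphV pM) ps ax mulVg.
pose g x := f ((s (t x))^-1 * x).
have gE a x : kappa a = phi x -> g x = f ((s a)^-1 * x).
  move=> ax; have -> : (s a)^-1 * x = s (a^-1 * t x) * ((s (t x))^-1 * x).
    by rewrite sM (gmorphV sM) mulgA mulgK.
  rewrite fM ?fs ?add0r// ?sV//.
  by rewrite ps kappa_epi.1.1.1 (gmorphV kappa_epi.1.1.1) tP ax mulVg.
exists g; split.
- split=> [x y|b].
    have xy : kappa (t x * t y) = phi (x * y) by rewrite kappa_epi.1.1.1 !tP pM.
    rewrite (gE _ _ xy) (_ : _ * _ = ((s (t x))^-1 * x) ^ s (t y) * ((s (t y))^-1 * y)).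
      have px : phi (((s (t x))^-1 * x) ^ s (t y)) = 1.
        by rewrite (gmorphJ pM) (sV (t x))// conj1g.
      by rewrite (fM _ _ px) ?fJ// (sV (t y)).
    by rewrite sM invgM /conjg !mulgA mulgK.
  apply: (@locally_constant_open _ _ g [set z | phi z = 1 /\ f z = 0%R]).
    apply: open_nbhs_nbhs; split.
      apply: openI; first exact: (continuous_open_preimage phiE.1.1.2 (Q_discrete [set 1])).
      exact: (fO [set 0%R]).
    by split; [exact: gmorph1 pM|rewrite -(gmorph1 sM) fs].
  move=> x z [pz fz]; rewrite (gE (t x)) ?tP ?pM ?pz ?mulg1//.
  by rewrite mulgA fM ?fz ?addr0// sV.
- by move=> a; rewrite (gE a) ?ps// mulVg -(gmorph1 sM) fs.
- move=> x px; rewrite (gE 1) ?(gmorph1 kappa_epi.1.1.1)//.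
  by rewrite (gmorph1 sM) invg1 mul1g.
Qed.

Definition H1_section_ker m (s : F n -> F m) : set (F m -> 'F_p) :=
  [set g | H1 g /\ forall a, g (s a) = 0%R].

Lemma H1_section_ker_subspace m (s : F n -> F m) : is_subspace (H1_section_ker s).
Proof.
split; first by split=> //; exact: H1_0.
move=> a f g [f1 fs] [g1 gs]; split; first exact: (H1_subspace p (F m)).2.
by move=> b; rewrite fs gs mulr0 addr0.
Qed.

Definition restrict_kernel m (phi : F m -> Q) (g : F m -> 'F_p) x :=
  if `[< phi x = 1 >] then g x else 0%R.

Lemma restrict_kernelE m (phi : F m -> Q) g x : phi x = 1 -> restrict_kernel phi g x = g x.
Proof. by rewrite /restrict_kernel => /asboolP ->. Qed.

Lemma restrict_kernel_dual m (phi : F m -> Q) s g : sigma_epi phi -> lifts_kappa phi s ->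
  H1 g -> (forall d, ns_set D d -> g (s d) = 0%R) ->
  kernel_dual phi s (restrict_kernel phi g).
Proof.
move=> phiE [_ ps] g1 gs; have pM := phiE.1.1.1.
have gl : lc_hom g by exact/H1_lc_hom.
split.
- by move=> x px; rewrite /restrict_kernel; case: asboolP.
- by move=> x y px py; rewrite !restrict_kernelE ?g1.1// pM px py mulg1.
- move=> x h; have gx : g (x ^ h) = g x.
    by rewrite /conjg !g1.1 lc_homV// addrC addrK.
  have [px|npx] := pselect (phi x = 1).
    by rewrite !restrict_kernelE// (gmorphJ pM) px conj1g.
  have npg : phi (x ^ h) <> 1.
    by rewrite (gmorphJ pM) => /(congr1 (conjg^~ (phi h)^-1)); rewrite conjgK conj1g.
  by rewrite /restrict_kernel; do 2 case: asboolP.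
- apply: (@open_preimage2 _ _ _ _ phi g (fun q u => if `[< q = 1 >] then u else 0%R)).
    by move=> S; exact: (continuous_open_preimage phiE.1.1.2).
  exact: gl.2.
- by move=> d Dd; rewrite restrict_kernelE ?gs// ps kappaD.
Qed.

Lemma H1_section_ker_eq0 m (phi : F m -> Q) s g : sigma_epi phi -> lifts_kappa phi s ->
  H1_section_ker s g -> (forall x, phi x = 1 -> g x = 0%R) -> g = fun=> 0%R.
Proof.
move=> phiE [_ ps] [g1 gs] gK; have pM := phiE.1.1.1.
apply/funext => x; have [a ax] := kappa_epi.2 (phi x).
by rewrite -[x](mulVKg (s a)) g1.1 gs gK ?addr0// pM (gmorphV pM) ps ax mulVg.
Qed.

(** H^1(F_m) has dimension m and is the direct sum of this space and the span of the n pullbacks of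
    [e] along phi. The two halves prove independence of the joint family and separation by the [y]
    together with the s(x_j). *)
Lemma H1_section_ker_dim m (phi : F m -> Q) s : sigma_epi phi -> lifts_kappa phi s ->
  exists w (g : 'I_w -> F m -> 'F_p) y,
    dual_system (H1_section_ker s) g y /\ (w + n = m)%N.
Proof.
move=> phiE [[[sM sC] ss] ps].
have WS := H1_section_ker_subspace s.
have [|w [g [y ds]]] := dual_system_ex (x := @free_gen _ _ (F m)) WS.
  move=> f [f1 _] fx; apply: (H1_free_eq p_pr) => //; exact: H1_0.
exists w, g, y; split=> //; apply/eqP; rewrite eqn_leq; apply/andP; split.
  apply: (@separated_independent_leq_addl _ _ _ _ _ g (fun j a => e j (phi a))
    (@free_gen _ _ (F m))) => a b ab.
  have [gW gy gS] := ds.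
  have h1 : H1 (fun x => \sum_i a i * g i x + \sum_i b i * e i (phi x))%R.
    have := (H1_subspace p (F m)).2 1%R _ _
      (subspace_sum a (H1_subspace p (F m)) (fun i => (gW i).1))
      (subspace_sum b (H1_subspace p (F m)) (fun i => H1_comp (eH1 i) phiE.1.1)).
    by under eq_fun do rewrite mul1r.
  have h0 : (fun x => \sum_i a i * g i x + \sum_i b i * e i (phi x))%R = fun=> 0%R.
    by apply: (H1_free_eq p_pr) => //; exact: H1_0.
  have b0 : forall i, b i = 0%R.
    apply: e_indep => q; have [c <-] := kappa_epi.2 q.
    have := congr1 (@^~ (s c)) h0 => /=.
    rewrite big1 ?add0r => [|i _]; last by rewrite (gW i).2 mulr0.
    by under eq_bigr do rewrite ps.
  split=> // i; have := congr1 (@^~ (y i)) h0 => /=.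
  under eq_bigr do rewrite gy; rewrite sum_delta big1 ?addr0// => j _.
  by rewrite b0 mul0r.
have /choice[d dP] : forall i : 'I_m, exists f : F m -> 'F_p,
    H1 f /\ forall j, f (free_gen (F m) j) = (i == j)%:R%R.
  move=> i; have [f [fM fO fx]] := @free_hom_ex p p_pr m (F m) 'F_p 1
    (fun j => (i == j)%:R%R) (card_Fp_pfactor p_pr).
  by exists f; split=> //; split.
apply: (@dual_system_leq _ _ _ _ _ d (@free_gen _ _ (F m))
  (join_points y (fun j => s (free_gen (F n) j))) (H1_subspace p (F m))).
  split=> [i|i j|f f1 fx]; [exact: (dP i).1|exact: (dP i).2|].
  by apply: (H1_free_eq p_pr) => //; exact: H1_0.
move=> f f1 /join_points_vanish[fy fsx]; have [_ _ gS] := ds; apply: gS => //; split=> // a.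
have : f \o s = fun=> 0%R.
  by apply: (H1_free_eq p_pr) => //; [exact: H1_comp|exact: H1_0].
by move=> /(congr1 (@^~ a)).
Qed.

(** * Sign and dimension, from one presentation *)

Section Witness.
Variables (N : nat) (rN : N.-tuple (minusT (F N))) (phiN : F N -> Q).
Hypothesis phiN_epi : sigma_epi phiN.
Hypothesis rN_presents : presents rN phiN.

(** Since q sN is an automorphism, q(sN(D)) = D; this is what lets functionals for kappa be pulled
    back to functionals for phiN. *)
Lemma witness_lift : exists (sN : F n -> F N) (q : F N -> F n),
  [/\ lifts_kappa phiN sN, sigma_hom q, forall x, kappa (q x) = phiN x &
      Aut_sigma (F n) (q \o sN)].
Proof.
have [sN sL] := lifts_kappa_ex phiN_epi.
have [q qh qk] := free_sigma_lift p_pr p_gt2 (F_pro n) Q_pro kappa_epi.1 kappa_epi.2 phiN_epi.1.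
exists sN, q; split=> //; apply: (endo_Aut kappa_epi).
  exact: sigma_hom_comp sL.1 qh.
by move=> b; have [a <-] := kappa_epi.2 b; exists a; rewrite /= qk sL.2.
Qed.

Lemma kernel_dual_pullback sN q f : lifts_kappa phiN sN -> sigma_hom q ->
  (forall x, kappa (q x) = phiN x) -> Aut_sigma (F n) (q \o sN) ->
  kernel_dual kappa id f -> kernel_dual phiN sN (f \o q).
Proof.
move=> sL [[qM qC] qs] qk qA [f0 fM fJ fO fD]; split.
- by move=> x px /=; rewrite f0// qk.
- by move=> x y px py /=; rewrite qM fM// qk.
- by move=> x g /=; rewrite (gmorphJ qM) fJ.
- by move=> A; rewrite comp_preimage; apply: continuous_open_preimage.
- move=> d Dd; apply: (fD (q (sN d))); rewrite -(D_Aut qA); by exists d.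
Qed.

Lemma kernel_dual_witness f q sN : lifts_kappa phiN sN -> sigma_hom q ->
  (forall x, kappa (q x) = phiN x) -> Aut_sigma (F n) (q \o sN) ->
  kernel_dual kappa id f -> (forall i, f (q (val (tnth rN i))) = 0%R) -> f = fun=> 0%R.
Proof.
move=> sL qh qk qA fK fr; have [_ [b [_ abK] _]] := qA.
have [_ rS] := (presentsP rN phiN_epi sL).1 rN_presents.
have /= := rS _ (kernel_dual_pullback sL qh qk qA fK) fr.
by move=> fq; apply/funext => x; rewrite -(abK x) -[LHS]/((f \o q) (sN (b x))) fq.
Qed.

(** The functional f sigma + f vanishes on the q(r_i), which sigma inverts, and these detect every
    functional for kappa. *)
Lemma kernel_dual_kappa_sigma f x : kernel_dual kappa id f -> f (sigma x) = (- f x)%R.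
Proof.
move=> fK; have [sN [q [sL qh qk qA]]] := witness_lift.
have [r1 _] := (presentsP rN phiN_epi sL).1 rN_presents.
have fsK := kernel_dual_sigma kappa_epi.1 lifts_kappa_id fK.
have := kernel_dual_subspace kappa id => -[_ /(_ 1%R _ _ fsK fK) fsfK].
have := kernel_dual_witness sL qh qk qA fsfK; rewrite /= => h.
have fE : (fun x => 1 * f (sigma x) + f x)%R = fun=> 0%R.
  apply: h => i; have /set_mem sr := valP (tnth rN i).
  have kr : kappa (q (val (tnth rN i))) = 1 by rewrite qk.
  have [_ fM _ _ fD] := fK.
  have f1 : f 1 = 0%R by apply: (fD 1); have [] := ns_subgroup D.
  rewrite mul1r -qh.2 sr (gmorphV qh.1.1) -fM// ?mulVg//.
  by rewrite (gmorphV kappa_epi.1.1.1) kr invg1.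
apply/eqP; rewrite -addr_eq0 -[f (sigma x)]mul1r.
by have /= := congr1 (@^~ x) fE => ->.
Qed.

(** The v pullbacks f q and the restrictions of the N - n homomorphisms killing sN(F_n) are
    independent functionals for phiN, which the N relators separate. Hence v + (N - n) <= N. *)
Lemma kernel_dual_kappa_dim : exists v (f : 'I_v -> F n -> 'F_p) y,
  dual_system (kernel_dual kappa id) f y /\ (v <= n)%N.
Proof.
have [sN [q [sL qh qk qA]]] := witness_lift.
have [r1 rS] := (presentsP rN phiN_epi sL).1 rN_presents.
have [v [f [y ds]]] := dual_system_ex (kernel_dual_subspace kappa id)
  (fun g gK => kernel_dual_witness sL qh qk qA gK).
exists v, f, y; split=> //.
have [w [g [z [[gW gz _] wnN]]]] := H1_section_ker_dim phiN_epi sL.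
rewrite -(leq_add2l w) wnN addnC; have [fK fy _] := ds.
apply: (@separated_independent_leq_addl _ _ _ _ _ (fun i => f i \o q)
  (fun i => restrict_kernel phiN (g i)) (fun i => val (tnth rN i))) => a b ab.
have gK i : kernel_dual phiN sN (restrict_kernel phiN (g i)).
  by apply: restrict_kernel_dual => //; [exact: (gW i).1|move=> d _; exact: (gW i).2].
have KS := kernel_dual_subspace phiN sN.
pose h x := (\sum_i a i * f i (q x) + \sum_i b i * restrict_kernel phiN (g i) x)%R.
have hK : kernel_dual phiN sN h.
  have := KS.2 1%R _ _ (subspace_sum a KS (fun i => kernel_dual_pullback sL qh qk qA (fK i)))
    (subspace_sum b KS gK).
  by under eq_fun do rewrite mul1r.
have h0 := rS h hK ab.
have a0 : forall i, a i = 0%R.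
  have [_ [c [_ cK] _]] := qA.
  move=> i; have := congr1 (@^~ (sN (c (y i)))) h0; rewrite /h /= [X in (_ + X)%R]big1 ?addr0.
    rewrite -[q (sN _)]/((q \o sN) _) cK.
    by under eq_bigr do rewrite fy; rewrite sum_delta.
  by move=> j _; rewrite /restrict_kernel (gW j).2 if_same mulr0.
have W0 : (fun x => \sum_i b i * g i x)%R = fun=> 0%R.
  apply: (H1_section_ker_eq0 phiN_epi sL).
    by apply: subspace_sum => //; exact: H1_section_ker_subspace.
  move=> x px; have := congr1 (@^~ x) h0; rewrite /h /= big1 ?add0r => [hx|i _].
    by rewrite -[RHS]hx; apply: eq_bigr => i _; rewrite restrict_kernelE.
  by rewrite a0 mul0r.
split=> // i; have := congr1 (@^~ (z i)) W0 => /=.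
by under eq_bigr do rewrite gz; rewrite sum_delta.
Qed.

(** The sum h = f sigma + f vanishes on s(F_n) by the case of kappa, so on K it is the restriction
    of a homomorphism on F_m, where sigma is -1. But h is also sigma-invariant, so 2h = 0, and p is
    odd. *)
Lemma kernel_dual_sigmaE m (phi : F m -> Q) s f x : sigma_epi phi -> lifts_kappa phi s ->
  kernel_dual phi s f -> f (sigma x) = (- f x)%R.
Proof.
move=> phiE sL fK; have fsK := kernel_dual_sigma phiE.1 sL fK.
have := (kernel_dual_subspace phi s).2 1%R _ _ fsK fK.
set h := (fun _ => _)%R => hK.
have hs a : h (s a) = 0%R.
  rewrite /h /= -sL.1.2 mul1r -[f (s (sigma a))]/((f \o s) _).
  by rewrite (kernel_dual_kappa_sigma _ (kernel_dual_section sL fK)) /= addNr.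
have [g [g1 gs gh]] := kernel_dual_extension phiE sL hK hs.
have s1 : sigma (1 : Q) = 1 by exact: gmorph1 (@sigmaM Q).
suff : h x = 0%R by rewrite /h /= mul1r => /eqP; rewrite addr_eq0 => /eqP.
have [px|] := pselect (phi x = 1); last by case: hK => h0 _ _ _ _ /h0.
have hsx : h (sigma x) = h x by rewrite /h /= sigmaK !mul1r addrC.
have : h (sigma x) = (- h x)%R.
  by rewrite -!gh ?(H1_sigma p_pr g1)// phiE.1.2 px s1.
rewrite hsx => /eqP; rewrite -addr_eq0 -mulr2n -mulr_natr mulf_eq0 => /orP[/eqP//|].
rewrite -(dvdn_pcharf (pchar_Fp p_pr)) => /dvdn_leq-/(_ isT).
by rewrite leqNgt p_gt2.
Qed.

(** Separating points: at most n of the form s(y_i) for the restriction to kappa, and m - n more,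
    the points z_j moved into K, for the functionals that vanish on s(F_n). *)
Lemma kernel_dual_dim_leq m (phi : F m -> Q) s : sigma_epi phi -> lifts_kappa phi s ->
  exists v (f : 'I_v -> F m -> 'F_p) y,
    dual_system (kernel_dual phi s) f y /\ (v <= m)%N.
Proof.
move=> phiE sL; have pM := phiE.1.1.1.
have [v [f [y [[fK fy fS] vn]]]] := kernel_dual_kappa_dim.
have [w [g [z [[gW gz gS] wnm]]]] := H1_section_ker_dim phiE sL.
have /choice[t tP] : forall x, exists a, kappa a = phi x by move=> x; exact: kappa_epi.2.
pose pts := join_points (fun i => s (y i)) (fun j => (s (t (z j)))^-1 * z j).
have ptsS h : kernel_dual phi s h -> (forall i, h (pts i) = 0%R) -> h = fun=> 0%R.
  move=> hK /join_points_vanish[hy hz].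
  have hs a : h (s a) = 0%R.
    rewrite -[LHS]/((h \o s) a) (fS (h \o s))//; exact: kernel_dual_section hK.
  have [k [k1 ks kh]] := kernel_dual_extension phiE sL hK hs.
  have k0 : k = fun=> 0%R.
    apply: gS => // j; rewrite -[z j](mulVKg (s (t (z j)))) k1.1 ks add0r kh//.
    by rewrite pM (gmorphV pM) sL.2 tP mulVg.
  apply/funext => x; have [px|npx] := pselect (phi x = 1); last by case: hK => -> .
  by rewrite -kh// k0.
have [u [h [x ds]]] := dual_system_ex (kernel_dual_subspace phi s) ptsS.
exists u, h, x; split=> //; rewrite -wnm addnC.
apply: leq_trans (_ : v + w <= _)%N; last by rewrite leq_add2r.
exact: dual_system_leq (kernel_dual_subspace phi s) ds ptsS.
Qed.

Lemma exponent_ex : exists E, forall q : Q, q ^+ (p ^ E) = 1.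
Proof.
have [|gT [u [uM uS pT u1 _]]] := pro_p_finite_quotient p_pr Q_pro (U := [set 1 : Q]).
  by apply: open_nbhs_nbhs; split=> //; exact: Q_discrete.
have [E cE] := p_natP pT; exists E => q; apply: u1.
by rewrite (gmorphX uM) -cE expg_cardG ?finset.inE.
Qed.

(* A homomorphism F_m -> Z/p^k kills s(D), so its restriction to the kernel of *)
(* phi, which contains the p^E-th powers of the free generators, is determined *)
(* by its values at the v points y: hence p^((k - E) m) <= p^(k v) for all k.  *)
Lemma kernel_dual_dim_geq m (phi : F m -> Q) s v (f : 'I_v -> F m -> 'F_p) y :
  sigma_epi phi -> lifts_kappa phi s -> dual_system (kernel_dual phi s) f y ->
  (m <= v)%N.
Proof.
move=> phiE sL [fK fy fS]; rewrite leqNgt; apply/negP => vm.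
(* If v <= m - 1, then (k - E) m <= k v forces k <= E m, which this k violates. *)
have [E EQ] := exponent_ex; pose k := (E * m).+1.
have Ek : (E <= k)%N by rewrite /k; nia.
have p1 := prime_gt1 p_pr.
have pk1 : (1 < p ^ k)%N by rewrite -(expn0 p) ltn_exp2l.
pose A := 'Z_(p ^ k).
have cA : #|A| = (p ^ k)%N by rewrite card_ord Zp_cast.
pose B := {ffun 'I_m -> 'I_(p ^ (k - E))}.
have /choice[h hP] : forall c : B, exists h : F m -> A,
    lc_hom h /\ forall i, h (free_gen (F m) i) = (c i)%:R%R.
  move=> c; have [h [hM hO hx]] := free_hom_ex p_pr (F m) (fun i => (c i)%:R%R : A) cA.
  by exists h; split.
pose ev (c : B) : {ffun 'I_v -> A} := [ffun j => h c (y j)].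
have ev_inj : injective ev.
  move=> c c' ecc'; apply/ffunP => i; apply: val_inj.
  have hc : [set x | phi x = 1] `<=` [set x | h c x = h c' x].
    apply: (kernel_generated phiE sL (y := y) _ fS).
    - move=> j; apply: contrapT => py; have [f0 _ _ _ _] := fK j.
      by have /eqP := fy j j; rewrite eqxx f0// eq_sym oner_eq0.
    - by apply: lc_hom_eq_closed_normal; [exact: (hP c).1|exact: (hP c').1].
    - by move=> j /=; have /ffunP/(_ j) := ecc'; rewrite !ffunE.
    - move=> d /D_comm dC /=.
      have hs c0 : h c0 (s d) = 0%R.
        apply: (lc_hom_comm (f := h c0 \o s)) dC; split=> [a b|S] /=.
          by rewrite sL.1.1.1 (hP c0).1.1.
        rewrite comp_preimage; apply: continuous_open_preimage; first exact: sL.1.1.2.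
        exact: (hP c0).1.2.
      by rewrite !hs.
  have : h c (free_gen (F m) i ^+ (p ^ E)) = h c' (free_gen (F m) i ^+ (p ^ E)).
    by apply: hc => /=; rewrite (gmorphX phiE.1.1.1) EQ.
  rewrite (lc_homX _ _ (hP c).1) (lc_homX _ _ (hP c').1) (hP c).2 (hP c').2.
  rewrite -!mulrnA => /(congr1 val); rewrite /= !val_Zp_nat//.
  have lt (b : 'I_(p ^ (k - E))) : (b * p ^ E < p ^ k)%N.
    have -> : (p ^ k = p ^ (k - E) * p ^ E)%N by rewrite -expnD subnK.
    by rewrite ltn_pmul2r// expn_gt0 (ltnW p1).
  rewrite !modn_small// => /eqP; rewrite eqn_pmul2r ?expn_gt0 ?(ltnW p1)// => /eqP//.
have := leq_card _ ev_inj; rewrite !card_ffun !card_ord Zp_cast// -!expnM leq_exp2l//.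
by rewrite /k; nia.
Qed.

Lemma kernel_dual_basis m (phi : F m -> Q) s : sigma_epi phi -> lifts_kappa phi s ->
  exists (f : 'I_m -> F m -> 'F_p) y, dual_system (kernel_dual phi s) f y.
Proof.
move=> phiE sL; have [v [f [y [ds vm]]]] := kernel_dual_dim_leq phiE sL.
have /eqP e0 : v == m by rewrite eqn_leq vm (kernel_dual_dim_geq phiE sL ds).
by subst v; exists f, y.
Qed.

(** * Haar measure and the count of pairs (r, phi) *)

Section Measure.
Variables (R : realType) (haar : forall m, probability (borel_minus (F m)) R).
Hypothesis haarP : forall m, is_haar (haar m).
Variables (q : nat) (tq : 'I_q -> Q).
Hypothesis tq_inj : injective tq.
Hypothesis tqP : forall x, minus Q x <-> exists i, tq i = x.

Lemma fibre_measurable m (T : Type) (g : F m -> T) (S : set T) :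
  (forall S, open (g @^-1` S)) ->
  measurable [set a : borel_minus (F m) | S (g (val a))].
Proof.
move=> gO; apply: sub_sigma_algebra.
have vC : continuous (val : minusT (F m) -> F m) by exact: initial_continuous.
exact: (continuous_open_preimage vC (gO S)).
Qed.

(** The second hypothesis says that the coset of [k] is inverted by sigma. *)
Lemma haar_fibre m (N' : sigmaNormal (F m)) (k : F m) : open (N' : set (F m)) ->
  ns_set N' ((sigma k)^-1 * k^-1) ->
  haar m [set a | ns_set N' (k^-1 * val a)] =
  ((#|` fset_set (minus (quot N'))|)%:R^-1)%:E.
Proof.
move=> oN Nk; rewrite -(haarP oN (b := qpi N' k)).
  by congr (haar m _); apply/seteqP; split=> a /= => [/qpiP/esym|/esym/qpiP].
rewrite /minus /= -qpi_sigma -(gmorphV (@qpiM _ N')).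
by apply/qpiP.
Qed.

(** The q fibres over Q^- cover F_m^- and have equal measure. *)
Lemma haar_kernel m (phi : F m -> Q) : sigma_epi phi ->
  haar m [set a | phi (val a) = 1] = (q%:R^-1)%:E.
Proof.
move=> phiE; have [[pM pC] psi] := phiE.1.
have [[sK _] nK] := kernel_closed_normal phiE.1.
have s1 : sigma (1 : Q) = 1 by exact: gmorph1 (@sigmaM Q).
have sigK x : phi x = 1 -> phi (sigma x) = 1 by move=> px; rewrite psi px s1.
pose K : sigmaNormal (F m) := SigmaNormal sK nK sigK.
have pO S : open (phi @^-1` S) by exact: continuous_open_preimage.
have oK : open (K : set (F m)) by exact: (pO [set 1]).
pose B i := [set a : borel_minus (F m) | phi (val a) = tq i].
have BE i : haar m (B i) = ((#|` fset_set (minus (quot K))|)%:R^-1)%:E.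
  have [k ki] := phiE.2 (tq i).
  have mi : minus Q (tq i) by apply/tqP; exists i.
  rewrite -(haar_fibre (k := k) oK); last first.
    rewrite /= pM !(gmorphV pM) psi ki.
    by move: mi; rewrite /minus /= => ->; rewrite invgK mulgV.
  congr (haar m _); apply/seteqP; split=> a; rewrite /B /= pM (gmorphV pM) ki.
    by move=> ->; rewrite mulVg.
  by move=> /(congr1 (mulg (tq i))); rewrite mulVKg mulg1.
have [i0 i01] : exists i, tq i = 1 by apply/tqP; rewrite /minus /= s1 invg1.
have -> : [set a : borel_minus (F m) | phi (val a) = 1] = B i0.
by apply/seteqP; split=> a; rewrite /B /= i01.
have B_part : trivIset setT B.
  by move=> i j _ _ [a [/= ai aj]]; apply: tq_inj; rewrite -ai -aj.
have : haar m (\bigcup_i B i) = 1%E.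
  rewrite -(probability_setT (haar m)); congr (haar m _).
  apply/seteqP; split=> // a _; have /set_mem sa := valP a.
  have /tqP[i ti] : minus Q (phi (val a)).
    by rewrite /minus /= -psi sa (gmorphV pM).
  by exists i.
rewrite probability_finite_bigcup//; last first.
  by move=> i; apply: (fibre_measurable (g := phi) [set tq i] pO).
rewrite (eq_bigr _ (fun i _ => BE i)) sumEFin sumr_const card_ord BE => -[].
set c := (_^-1)%R => qc; congr EFin.
have q0 : (q%:R != 0 :> R)%R.
  by apply: contra_eq_neq qc => q0; rewrite -mulr_natr q0 mulr0 eq_sym oner_eq0.
by apply: (mulIf q0); rewrite mulVf// mulr_natr.
Qed.

Section KernelBasis.
Variables (m : nat) (phi : F m -> Q) (s : F n -> F m).
Variables (f : 'I_m -> F m -> 'F_p) (y : 'I_m -> F m).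
Hypothesis phiE : sigma_epi phi.
Hypothesis sL : lifts_kappa phi s.
Hypothesis ds : dual_system (kernel_dual phi s) f y.

Let fK : forall i, kernel_dual phi s (f i). Proof. by have [] := ds. Qed.

Lemma kernel_dual_y i : phi (y i) = 1.
Proof.
apply: contrapT => py; have [_ fy _] := ds; have [f0 _ _ _ _] := fK i.
by have /eqP := fy i i; rewrite eqxx f0// eq_sym oner_eq0.
Qed.

Lemma kernel_dual_f1 i : f i 1 = 0%R.
Proof.
have [_ _ _ _ fD] := fK i; rewrite -(fD 1) ?(gmorph1 sL.1.1.1)//.
by have [] := ns_subgroup D.
Qed.

Lemma kernel_dual_fV i x : phi x = 1 -> f i x^-1 = (- f i x)%R.
Proof.
move=> px; have [_ fM _ _ _] := fK i; apply: (addrI (f i x)).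
by rewrite -fM ?mulgV ?kernel_dual_f1 ?subrr// (gmorphV phiE.1.1.1) px invg1.
Qed.

Lemma kernel_dual_fX i x k : phi x = 1 -> f i (x ^+ k) = (f i x *+ k)%R.
Proof.
move=> px; have [_ fM _ _ _] := fK i; elim: k => [|k IH].
  by rewrite expg0 kernel_dual_f1.
by rewrite expgS fM ?IH ?mulrS// (gmorphX phiE.1.1.1) px expg1n.
Qed.

Lemma kernel_dual_values (w : 'rV['F_p]_m) :
  exists2 k, phi k = 1 & forall i, f i k = w 0%R i.
Proof.
have [_ fy _] := ds; have pM := phiE.1.1.1.
suff H l : exists2 k, phi k = 1 & forall i, f i k = (\sum_(j <- l) w 0 j * (i == j)%:R)%R.
  have [k pk fk] := H (index_enum 'I_m); exists k => // i; rewrite fk.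
  by under eq_bigr do rewrite eq_sym; exact: sum_delta.
elim: l => [|j l [k pk fk]].
  exists 1; first exact: gmorph1 pM.
  by move=> i; rewrite big_nil kernel_dual_f1.
have py : phi (y j ^+ val (w 0%R j)) = 1 by rewrite (gmorphX pM) kernel_dual_y expg1n.
exists (y j ^+ val (w 0%R j) * k); first by rewrite pM py pk mulg1.
move=> i; have [_ fM _ _ _] := fK i.
rewrite fM// kernel_dual_fX ?kernel_dual_y// fy fk big_cons; congr (_ + _)%R.
by rewrite -[X in (X * _)%R](natr_Zp (w 0%R j)) mulr_natl.
Qed.

Definition value_fibre (w : 'rV['F_p]_m) : set (borel_minus (F m)) :=
  [set a | phi (val a) = 1 /\ forall j, f j (val a) = w 0%R j].

Lemma value_fibre_measurable w : measurable (value_fibre w).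
Proof.
rewrite (_ : value_fibre w = [set a | phi (val a) = 1] `&`
  \bigcap_(j in setT) [set a | f j (val a) = w 0%R j]).
  apply: measurableI.
    apply: (fibre_measurable (g := phi) [set 1]) => S.
    exact: (continuous_open_preimage phiE.1.1.2).
  apply: fin_bigcap_measurable => [|j _]; first exact: finite_finset.
  by apply: (fibre_measurable (g := f j) [set w 0%R j]); have [] := fK j.
by apply/seteqP; split=> a /= [pa fa]; split=> // j *; apply: fa.
Qed.

Lemma value_fibre_disjoint : trivIset setT value_fibre.
Proof.
move=> w w' _ _ [a [[_ aw] [_ aw']]]; apply/rowP => j.
by rewrite -aw -aw'.
Qed.

(** The common kernel [N0] of phi and the f_j is open and sigma-stable. As sigma is -1 on the f_j,
    every value vector w belongs to a coset in (F_m/N0)^-, so the p^m value fibres have equal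
    measure, with sum 1/q by [haar_kernel]. *)
Lemma haar_value_fibre w : haar m (value_fibre w) = ((q * p ^ m)%:R^-1)%:E.
Proof.
have [[pM pC] psi] := phiE.1; have s1 : sigma (1 : Q) = 1 by exact: gmorph1 (@sigmaM Q).
pose N0 := [set x | phi x = 1 /\ forall j, f j x = 0%R].
have fM i x z : phi x = 1 -> phi z = 1 -> f i (x * z) = (f i x + f i z)%R.
  by have [_ fM _ _ _] := fK i; exact: fM.
have sN0 : is_subgroup N0.
  split; first by split; [exact: gmorph1 pM|exact: kernel_dual_f1].
    move=> x z [px fx] [pz fz]; split; first by rewrite pM px pz mulg1.
    by move=> j; rewrite fM// fx fz addr0.
  move=> x [px fx]; split; first by rewrite (gmorphV pM) px invg1.
  by move=> j; rewrite kernel_dual_fV// fx oppr0.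
have nN0 : is_normal N0.
  move=> x g [px fx]; split; first by rewrite (gmorphJ pM) px conj1g.
  by move=> j; have [_ _ fJ _ _] := fK j; rewrite fJ.
have sigN0 x : N0 x -> N0 (sigma x).
  move=> [px fx]; split; first by rewrite psi px s1.
  by move=> j; rewrite (kernel_dual_sigmaE _ phiE sL (fK j)) fx oppr0.
pose K : sigmaNormal (F m) := SigmaNormal sN0 nN0 sigN0.
have oK : open (K : set (F m)).
  apply: (@openI _ (phi @^-1` [set 1]) [set x | forall j, f j x = 0%R]).
    exact: continuous_open_preimage.
  rewrite openE => x /= fx; apply: filter_forall => j.
  apply: (open_nbhs_nbhs (A := f j @^-1` [set 0%R])); split=> //.
  by have [_ _ _ fO _] := fK j; exact: fO.
have vE w' : haar m (value_fibre w') = ((#|` fset_set (minus (quot K))|)%:R^-1)%:E.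
  have [k pk fk] := kernel_dual_values w'.
  have pV x : phi x = 1 -> phi x^-1 = 1 by move=> px; rewrite (gmorphV pM) px invg1.
  have psk : phi (sigma k) = 1 by rewrite psi pk s1.
  rewrite -(haar_fibre (k := k) oK); last first.
    split; first by rewrite pM !pV// mulg1.
    move=> j; rewrite fM ?pV// !kernel_dual_fV// (kernel_dual_sigmaE _ phiE sL (fK j)).
    by rewrite opprK subrr.
  congr (haar m _); apply/seteqP; split=> a /= [pa fa].
    split; first by rewrite pM pV// pa mulg1.
    by move=> j; rewrite fM ?pV// kernel_dual_fV// fk fa addNr.
  have {}pa : phi (val a) = 1 by move: pa; rewrite pM pV// mul1g.
  split=> // j; have /eqP := fa j; rewrite fM ?pV// kernel_dual_fV//.
  by rewrite addrC subr_eq0 -fk => /eqP.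
have : haar m (\bigcup_w value_fibre w) = (q%:R^-1)%:E.
  rewrite -(haar_kernel phiE); congr (haar m _).
  apply/seteqP; split=> [a [w' _ []]//|a pa].
  by exists (\row_j f j (val a))%R => //; split=> // j; rewrite mxE.
rewrite probability_finite_bigcup; [|exact: value_fibre_measurable|exact: value_fibre_disjoint].
rewrite (eq_bigr _ (fun w _ => vE w)) sumEFin sumr_const card_mx card_Fp// mul1n vE => -[].
set c := (_^-1)%R => qc; congr EFin.
have pm0 : ((p ^ m)%:R != 0 :> R)%R by rewrite pnatr_eq0 -lt0n expn_gt0 prime_gt0.
by apply: (mulIf pm0); rewrite mulr_natr qc natrM invfM -mulrA mulVf// mulr1.
Qed.

Lemma presents_unitmx (r : m.-tuple (minusT (F m))) : presents r phi <->
  (forall i, phi (val (tnth r i)) = 1) /\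
  (\matrix_(i, j) f j (val (tnth r i)))%R \in unitmx.
Proof.
have [_ fy fS] := ds; have KS := kernel_dual_subspace phi s.
set M := (\matrix_(i, j) _)%R.
have ME (c : 'rV_m) i : ((c *m M^T) 0 i = \sum_j c 0 j * f j (val (tnth r i)))%R.
  by rewrite mxE; apply: eq_bigr => j _; rewrite !mxE.
rewrite (presentsP r phiE sL); split=> -[r1 rS]; split=> //.
  rewrite -unitmx_tr -row_free_unit; apply: inj_row_free => c cM.
  have cK := subspace_sum (c 0%R) KS fK.
  have c0 := rS _ cK; apply/rowP => j; rewrite mxE.
  have cr i : (\sum_j c 0 j * f j (val (tnth r i)) = 0)%R by rewrite -ME cM mxE.
  have /(congr1 (@^~ (y j))) /= := c0 cr.
  by under eq_bigr do rewrite fy; rewrite sum_delta.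
move=> g gK gr; have gE := dual_system_expand KS ds gK.
pose c : 'rV['F_p]_m := (\row_j g (y j))%R.
have cM : (c *m M^T)%R = 0%R.
  apply/rowP => i; rewrite ME [RHS]mxE.
  transitivity (g (val (tnth r i))); last exact: gr.
  have /= gi := congr1 (@^~ (val (tnth r i))) gE; rewrite [RHS]gi.
  by apply: eq_bigr => j _; rewrite mxE.
have uM : M^T%R \in unitmx by rewrite unitmx_tr.
have c0 : c = 0%R by rewrite -(mulmxK uM c) cM mul0mx.
rewrite gE; apply/funext => x; rewrite big1// => j _.
by have /rowP/(_ j) := c0; rewrite !mxE => ->; rewrite mul0r.
Qed.

End KernelBasis.

Definition unit_matrices m := #|[pred M : 'M['F_p]_m | M \in unitmx]|.

Lemma presents_prob m (phi : F m -> Q) : sigma_epi phi ->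
  measurable [set r : m.-tuple (borel_minus (F m)) | presents r phi] /\
  power_prob (haar m) m [set r : m.-tuple (borel_minus (F m)) | presents r phi] =
    ((unit_matrices m)%:R / (q ^ m * p ^ (m * m))%:R)%R%:E.
Proof.
move=> phiE; have [s sL] := lifts_kappa_ex phiE.
have [f [y ds]] := kernel_dual_basis phiE sL.
pose box (M : {M : 'M['F_p]_m | M \in unitmx}) :=
  [set t : m.-tuple (borel_minus (F m)) | forall i, value_fibre phi f (row i (val M)) (tnth t i)].
have vM w := value_fibre_measurable phiE ds w.
have mbox M : measurable (box M) by exact: (measurable_box (fun i => vM (row i (val M)))).
have -> : [set r : m.-tuple (borel_minus (F m)) | presents r phi] = \bigcup_M box M.
  apply/seteqP; split=> [r /(presents_unitmx phiE sL ds)[r1 rU]|r [M _ rM]].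
    exists (exist (fun M => M \in unitmx) _ rU) => // i; split; first exact: r1.
    by move=> j; rewrite /= !mxE.
  apply/(presents_unitmx phiE sL ds); split=> [i|]; first exact: (rM i).1.
  rewrite (_ : (\matrix_(i, j) _)%R = val M); first exact: valP.
  by apply/matrixP => i j; rewrite mxE (rM i).2 mxE.
split; first by apply: fin_bigcup_measurable => [|M _]; [exact: finite_finset|exact: mbox].
rewrite probability_finite_bigcup//; last first.
  move=> M M' _ _ [r [rM rM']]; apply/val_inj/row_matrixP => i.
  by apply: (value_fibre_disjoint (phi := phi) (f := f)) => //; exists (tnth r i).
rewrite (eq_bigr (fun=> (((q * p ^ m)%:R^-1 ^+ m)%R)%:E)) => [|M _]; last first.
  rewrite (power_prob_box (haar m) (fun i => vM (row i (val M)))).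
  rewrite (eq_bigr _ (fun i _ => haar_value_fibre phiE sL ds _)).
  by rewrite prodEFin prodr_const card_ord.
rewrite sumEFin sumr_const card_sig; congr EFin.
by rewrite -[LHS]mulr_natl exprVn -natrX expnMn -expnM.
Qed.

Definition gen_tuple m (phi : F m -> Q) (c : {ffun 'I_m -> 'I_q}) :=
  sigma_hom phi /\ forall i, phi (free_gen (F m) i) = tq (c i).

Lemma gen_tuple_ex m : exists phi : {ffun 'I_m -> 'I_q} -> F m -> Q,
  forall c, gen_tuple (phi c) c.
Proof.
have /choice[phi phiP] : forall c : {ffun 'I_m -> 'I_q}, exists phi : F m -> Q, gen_tuple phi c.
  move=> c; apply: (@free_sigma_hom_ex p m (F m) Q (fun i => tq (c i)) Q_pro) => i.
  by apply/tqP; exists (c i).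
by exists phi.
Qed.

Lemma gen_tuple_hom m (phi : F m -> Q) : sigma_hom phi -> exists c, gen_tuple phi c.
Proof.
move=> ph; have /choice[c cP] : forall i, exists j, tq j = phi (free_gen (F m) i).
  by move=> i; apply/tqP; rewrite /minus /= -ph.2 free_gen_sigma (gmorphV ph.1.1).
by exists [ffun i => c i]; split=> // i; rewrite ffunE cP.
Qed.

Lemma gen_tuple_unique m (phi phi' : F m -> Q) c :
  gen_tuple phi c -> gen_tuple phi' c -> phi = phi'.
Proof.
move=> [ph pc] [ph' pc']; apply: (free_hom_unique Q_pro ph.1 ph'.1) => i.
by rewrite pc pc'.
Qed.

Lemma gen_tuple_inj m (phi : F m -> Q) c c' :
  gen_tuple phi c -> gen_tuple phi c' -> c = c'.
Proof.
by move=> [_ pc] [_ pc']; apply/ffunP => i; apply: tq_inj; rewrite -pc -pc'.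
Qed.

(** Q is generated by Q^-, which contains the images under kappa of the generators of F_n. *)
Lemma gen_tuple_surj m (phi : F m -> Q) (c : {ffun 'I_m -> 'I_q}) : gen_tuple phi c ->
  [forall i, i \in codom c] -> sigma_epi phi.
Proof.
move=> [ph pc] /forallP cS; split=> //.
have [[pM _] _] := ph; have [kM kC] := kappa_epi.1.1.
suff kT : [set a | exists b, phi b = kappa a] = setT.
  move=> b; have [a <-] := kappa_epi.2 b.
  by have : [set a | exists b, phi b = kappa a] a by rewrite kT.
apply: (free_gen_dense p_pr).
  split; first split=> [|a b [x xa] [z zb]|a [x xa]].
  - by exists 1; rewrite (gmorph1 pM) (gmorph1 kM).
  - by exists (x * z); rewrite pM kM xa zb.
  - by exists x^-1; rewrite (gmorphV pM) (gmorphV kM) xa.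
  rewrite -openC.
  exact: (continuous_open_preimage kC (Q_discrete (~` [set b | exists x, phi x = b]))).
move=> i /=; have /tqP[j ji] : minus Q (kappa (free_gen (F n) i)).
  by rewrite /minus /= -kappa_epi.1.2 free_gen_sigma (gmorphV kM).
by have /codomP[l jl] := cS j; exists (free_gen (F m) l); rewrite pc -jl ji.
Qed.

Lemma presents_kernel m (r : m.-tuple (minusT (F m))) (phi phi' : F m -> Q) :
  sigma_epi phi -> sigma_epi phi' -> presents r phi -> presents r phi' ->
  forall x, phi x = 1 <-> phi' x = 1.
Proof.
move=> phiE phiE' pr [rho' [rhoE' rhoK']] x.
have [s sL] := lifts_kappa_ex phiE.
have [phiH [phiHE _ _]] := presents_epi phiE sL pr; have [rho [rhoE rhoK]] := pr.
rewrite rhoK rhoK' (image_D_unique _ phiHE rhoE rhoE')//.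
by apply: quot_pro_p => //; exact: relator_closed.
Qed.

Lemma sigma_iso_of_kernel (G : sigmaGroupType) (phi phi' : G -> Q) :
  sigma_epi phi -> sigma_epi phi' -> (forall x, phi x = 1 <-> phi' x = 1) ->
  exists2 alpha, Aut_sigma Q alpha & forall x, alpha (phi x) = phi' x.
Proof.
have key (psi psi' : G -> Q) : sigma_epi psi -> sigma_epi psi' ->
    (forall x, psi x = 1 <-> psi' x = 1) ->
    exists2 beta : Q -> Q, sigma_hom beta & forall x, beta (psi x) = psi' x.
  move=> [[[pM _] ps] pS] [[[pM' _] ps'] _] pE.
  have /choice[t tP] := pS.
  have bE x : psi' (t (psi x)) = psi' x.
    apply: (mulgI (psi' x)^-1); rewrite mulVg -(gmorphV pM') -pM'.
    by apply/pE; rewrite pM (gmorphV pM) tP mulVg.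
  exists (psi' \o t) => //; split; last by move=> b; have [x <-] := pS b; rewrite -ps /= !bE ps'.
  split=> [a b|]; last first.
    by move=> b U /nbhs_singleton Ub; apply: open_nbhs_nbhs; split=> //; exact: Q_discrete.
  have [[x <-] [z <-]] := (pS a, pS b).
  by rewrite -pM /= !bE pM'.
move=> phiE phiE' pE.
have [a ah aE] := key _ _ phiE phiE' pE.
have [b bh bE] := key _ _ phiE' phiE (fun x => iff_sym (pE x)).
exists a => //; split=> //; exists b; last exact: bh.1.2.
split=> u; first by have [x <-] := phiE.2 u; rewrite aE bE.
by have [x <-] := phiE'.2 u; rewrite bE aE.
Qed.

Lemma presents_Aut m (r : m.-tuple (minusT (F m))) (phi : F m -> Q) alpha :
  presents r phi -> Aut_sigma Q alpha -> presents r (alpha \o phi).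
Proof.
move=> [rho [rhoE rhoK]] [ah [b [aK bK] _]]; exists rho; split=> // x.
rewrite -rhoK /= -[1 in X in X <-> _](gmorph1 ah.1.1).
by split=> [/(can_inj aK)|->].
Qed.

(** All phi presenting r have the same kernel, the preimage of rho(D), so they differ from [phi0] by
    a unique automorphism of Q, here [h c]; conversely each automorphism yields one. *)
Lemma card_presentations m (r : m.-tuple (minusT (F m))) (phi0 : F m -> Q)
    (phi : {ffun 'I_m -> 'I_q} -> F m -> Q) :
  (forall c, gen_tuple (phi c) c) -> sigma_epi phi0 -> presents r phi0 ->
  #|[pred c | `[< sigma_epi (phi c) /\ presents r (phi c) >]]| =
  #|` fset_set (Aut_sigma Q)|.
Proof.
move=> phiP phiE0 pr0; set P := [pred c | _].
have [t tP] := choice phiE0.2.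
pose h c : Q -> Q := phi c \o t.
have hE c : c \in P -> Aut_sigma Q (h c) /\ forall x, h c (phi0 x) = phi c x.
  move=> /asboolP[pE pr].
  have [a aA aE] := sigma_iso_of_kernel phiE0 pE (presents_kernel phiE0 pE pr0 pr).
  suff -> : h c = a by [].
  by apply/funext => b; rewrite /h /= -aE tP.
have hA : Aut_sigma Q = [set` (h @` [fset c | c in P])%fset].
  apply/seteqP; split=> [a aA|_ /= /imfsetP[c /imfsetP[c' c'P ->] ->]]; last first.
    exact: (hE c' c'P).1.
  have aE : sigma_epi (a \o phi0).
    apply: sigma_epi_comp => //; split; first exact: aA.1.
    by move=> b; have [_ [a' [_ a'K] _]] := aA; exists (a' b); rewrite a'K.
  have [c cP] := gen_tuple_hom aE.1.
  have cE : phi c = a \o phi0 by exact: gen_tuple_unique (phiP c) cP.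
  apply/imfsetP; exists c.
    apply/imfsetP; exists c => //; apply/asboolP.
    by rewrite cE; split=> //; exact: presents_Aut.
  by apply/funext => b; rewrite /h /= cE /= tP.
rewrite hA set_fsetK card_in_imfset; last first.
  move=> c c' /imfsetP[c1 c1P ->] /imfsetP[c2 c2P ->] hc.
  apply: (gen_tuple_inj (phiP c1)); suff -> : phi c1 = phi c2 by exact: phiP.
  by apply/funext => x; rewrite -(hE c1 c1P).2 -(hE c2 c2P).2 hc.
by rewrite card_imfset//= cardE.
Qed.

Lemma card_Aut_gt0 : (0 < #|` fset_set (Aut_sigma Q)|)%N.
Proof.
have [phi phiP] := gen_tuple_ex N.
rewrite -(card_presentations phiP phiN_epi rN_presents).
have [c cP] := gen_tuple_hom phiN_epi.1.
apply/card_gt0P; exists c; apply/asboolP.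
by rewrite (gen_tuple_unique (phiP c) cP).
Qed.

Definition presented m : set (m.-tuple (borel_minus (F m))) :=
  [set r | exists phi : F m -> Q, sigma_epi phi /\ presents r phi].

Lemma presented_prob m : (0 < m)%N -> exists E : nat,
  [/\ (q ^ m <= E + q * (q - 1) ^ m)%N, (E <= q ^ m)%N &
    power_prob (haar m) m (@presented m) =
    (E%:R / (q ^ m)%:R * \prod_(1 <= i < m.+1) (1 - (p%:R ^+ i)^-1) /
      (#|` fset_set (Aut_sigma Q)|)%:R)%R%:E].
Proof.
move=> m0; have [phi phiP] := gen_tuple_ex m.
pose epi c := `[< sigma_epi (phi c) >]; pose E := #|[pred c | epi c]|.
exists E; split.
- apply: leq_trans (ffun_surjective_bound m q) _; rewrite leq_add2r.
  apply/subset_leq_card/fintype.subsetP => c cS; apply/asboolP.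
  exact: gen_tuple_surj (phiP c) cS.
- by apply: leq_trans (max_card _) _; rewrite card_ffun !card_ord.
pose x : R := ((unit_matrices m)%:R / (q ^ m * p ^ (m * m))%:R)%R.
pose S c := [set r : m.-tuple (borel_minus (F m)) |
  sigma_epi (phi c) /\ presents r (phi c)].
have SE c : measurable (S c) /\ power_prob (haar m) m (S c) = (if epi c then x else 0)%R%:E.
  rewrite /epi; case: asboolP => [ce|ne].
    have -> : S c = [set r : m.-tuple (borel_minus (F m)) | presents r (phi c)].
      by apply/seteqP; split=> r // [].
    exact: presents_prob.
  have -> : S c = set0 by apply/seteqP; split=> r // [].
  by split; [exact: measurable0|rewrite measure0].
have PE : @presented m = \bigcup_c S c.
  apply/seteqP; split=> [r [psi [psiE pr]]|r [c _ [ce pr]]]; last by exists (phi c).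
  have [c cP] := gen_tuple_hom psiE.1; exists c => //.
  by rewrite /S /= (gen_tuple_unique (phiP c) cP).
have mP : measurable (@presented m).
  rewrite PE; apply: fin_bigcup_measurable => [|c _]; first exact: finite_finset.
  exact: (SE c).1.
have cA r : presented r -> #|[pred c | `[< S c r >]]| = #|` fset_set (Aut_sigma Q)|.
  by move=> [psi [psiE pr]]; exact: card_presentations psiE pr.
have SA r c : S c r -> presented r by move=> [ce pr]; exists (phi c).
have := probability_count (power_prob (haar m) m) (fun c => (SE c).1) mP cA SA.
rewrite (eq_bigr _ (fun c _ => (SE c).2)) sumEFin -big_mkcond /= sumr_const.
have Pf : power_prob (haar m) m (@presented m) \is a fin_num by exact: fin_num_measure.
rewrite -(fineK Pf) -EFinM => -[] ex; congr EFin.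
have A0 : ((#|` fset_set (Aut_sigma Q)|)%:R != 0 :> R)%R.
  by rewrite pnatr_eq0 -lt0n card_Aut_gt0.
apply: (mulfI A0); rewrite -ex mulrC divfK// -unitmx_ratio// -/(unit_matrices m).
by rewrite -[LHS]mulr_natl /x natrM mulf_div mulrA.
Qed.

Lemma presented_prob_cvg :
  (fun m => power_prob (haar m) m (@presented m)) @ \oo -->
  (C_infty p R / (#|` fset_set (Aut_sigma Q)|)%:R)%R%:E.
Proof.
have /choice[E EP] : forall m : nat, exists E : nat,
    [/\ (q ^ m <= E + q * (q - 1) ^ m)%N, (E <= q ^ m)%N &
    (0 < m)%N -> power_prob (haar m) m (@presented m) =
    (E%:R / (q ^ m)%:R * \prod_(1 <= i < m.+1) (1 - (p%:R ^+ i)^-1) /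
      (#|` fset_set (Aut_sigma Q)|)%:R)%R%:E].
  (* The value at m = 0 is arbitrary within the bounds; the formula is only required for positive
     m. *)
  case=> [|m]; first by exists 1%N; split.
  by have [//|E [E1 E2 E3]] := @presented_prob m.+1; exists E.
have q0 : (0 < q)%N.
  have [i _] : exists i, tq i = 1.
    by apply/tqP; rewrite /minus /= (gmorph1 (@sigmaM Q)) invg1.
  exact: leq_ltn_trans (ltn_ord i).
pose g m : R := ((E m)%:R / (q ^ m)%:R * \prod_(1 <= i < m.+1) (1 - (p%:R ^+ i)^-1) /
  (#|` fset_set (Aut_sigma Q)|)%:R)%R.
have gC : g @ \oo --> (C_infty p R / (#|` fset_set (Aut_sigma Q)|)%:R)%R.
  apply: cvgM; last exact: cvg_cst.
  rewrite -[X in _ --> X]mul1r; apply: cvgM; last exact: C_infty_cvg.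
  by apply: covering_ratio_cvg => // m; have [] := EP m.
apply/fine_cvgP; split.
  near=> m; have [_ _ ->//] := EP m.
  by near: m; exact: nbhs_infty_gt.
apply: cvg_trans gC; apply: near_eq_cvg; near=> m.
have [_ _ /= ->//] := EP m.
by near: m; exact: nbhs_infty_gt.
Unshelve. all: by end_near.
Qed.

End Measure.

End Witness.

(** * Membership in U_D and its dependence on a finite level *)

Definition has_quotient (H : sigmaGroupType) :=
  exists (rho : F n -> H) (phi : H -> Q),
    [/\ sigma_epi rho, sigma_epi phi & forall h, phi h = 1 <-> (rho @` D) h].

Lemma has_quotient_iso (H H' : sigmaGroupType) :
  sigma_isomorphic H H' -> has_quotient H -> has_quotient H'.
Proof.
move=> [u [uh [v [uK vK] vC]]] [rho [phi [rhoE phiE rhoK]]].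
have uE : sigma_epi u by split=> // b; exists (v b).
have vh : sigma_hom v.
  split; [split=> // x y|] => [|x]; apply: (can_inj uK).
    by rewrite uh.1.1 !vK.
  by rewrite uh.2 !vK.
have vE : sigma_epi v by split=> // b; exists (u b).
exists (u \o rho), (phi \o v); split; [exact: sigma_epi_comp|exact: sigma_epi_comp|].
move=> h; rewrite /= rhoK; split=> [[d Dd dh]|[d Dd /= <-]]; exists d => //.
by rewrite /= dh vK.
Qed.

Lemma has_quotient_presents m (r : m.-tuple (minusT (F m))) :
  has_quotient (quot (relatorN r)) <-> exists phi : F m -> Q, sigma_epi phi /\ presents r phi.
Proof.
split=> [[rho [phi [rhoE phiE rhoK]]]|[phi [phiE pr]]].
  exists (phi \o qpi _); split; first exact: sigma_epi_comp (qpi_sigma_epi _) phiE.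
  by exists rho; split=> // x; exact: rhoK.
have [s sL] := lifts_kappa_ex phiE.
have [phiH [phiHE phiHq _]] := presents_epi phiE sL pr; have [rho [rhoE rhoK]] := pr.
by exists rho, phiH; split=> //; apply: quotP => x; rewrite phiHq.
Qed.

(** The dimension condition follows from [has_quotient]: the pullbacks of the e_i along phi form a
    basis of H^1(H). *)
Lemma has_quotientP (H : sigmaGroupType) : pro_p p H ->
  (dim_H1 p H n /\
    exists rho : sigmaEpi (F n) H, sigma_isomorphic (quot (imageN rho D)) Q) <->
  has_quotient H.
Proof.
move=> H_pro; split=> [[_ [rho [f [fh [g [fK gK] gC]]]]]|[rho [phi [rhoE phiE rhoK]]]].
  have fE : sigma_epi f by split=> // b; exists (g b).
  exists rho, (f \o qpi _); split; first exact: sigmaEpi_epi.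
    exact: sigma_epi_comp (qpi_sigma_epi _) fE.
  move=> h /=; rewrite -(gmorph1 fh.1.1); split=> [/(can_inj fK)|Dh].
    rewrite -(gmorph1 (@qpiM _ (imageN rho D))) => /esym/qpiP.
    by rewrite invg1 mul1g.
  congr f; rewrite -(gmorph1 (@qpiM _ (imageN rho D))); apply/esym/qpiP.
  by rewrite invg1 mul1g.
split.
  exists (fun i => e i \o phi) => [i|f f1]; first exact: H1_comp (eH1 i) phiE.1.1.
  have [c cE] := H1_descend rhoE phiE f1; exists [ffun i => c i]; split.
    by rewrite cE; apply/funext => x; apply: eq_bigr => i _; rewrite ffunE.
  move=> c' c'E; apply/ffunP => i; rewrite ffunE; apply/eqP; rewrite -subr_eq0; apply/eqP.
  apply: (e_indep (c := fun i => c i - c' i)%R) => b; have [x <-] := phiE.2 b.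
  under eq_bigr do rewrite mulrBl.
  rewrite sumrB; have := congr1 (@^~ x) cE; rewrite c'E /= => ->.
  by rewrite subrr.
exists (epi_of rhoE).
have [|g gh gE] := @quot_factor _ _ (imageN (epi_of rhoE) D) phi phiE.1.
  by move=> x /rhoK.
have [t tP] := choice phiE.2.
exists g; split=> //; exists (qpi _ \o t).
  split; last by move=> b; rewrite /= gE.
  apply: quotP => x; rewrite /= gE; apply/qpiP; apply/rhoK.
  by rewrite phiE.1.1.1 (gmorphV phiE.1.1.1) tP mulVg.
by move=> b U /nbhs_singleton Ub; apply: open_nbhs_nbhs; split=> //; exact: Q_discrete.
Qed.

(* For a large index i, a quotient X of H' with X/D_i(X) = Q equals Q: then   *)
(* D_j(X) lies in D_{pj}(X) for some j, so D_j(X) is trivial by the Nakayama  *)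
(* argument of zassenhaus_stable.                                             *)
Lemma has_quotient_local : finite_set [set: Q] -> exists2 i, (2 <= i)%N &
  forall H H' : sigmaGroupType, pro_p p H -> pro_p p H' ->
    sigma_isomorphic (quot (zassenhausN p H i)) (quot (zassenhausN p H' i)) ->
    has_quotient H -> has_quotient H'.
Proof.
move=> Qfin; have [j j0 Dj] := zassenhaus_trivial p_pr Q_pro Qfin.
have p1 := prime_gt1 p_pr.
pose i := (p * j)%N; have i2 : (2 <= i)%N by rewrite (leq_trans p1)// leq_pmulr.
have ji : (j <= i)%N by rewrite leq_pmull// ltnW.
exists i => // H H' H_pro H'_pro [u [uh [v [uK vK] vC]]] [rho [phi [rhoE phiE rhoK]]].
have vh : sigma_hom v.
  split; [split=> // x y|] => [|x]; apply: (can_inj uK).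
    by rewrite uh.1.1 !vK.
  by rewrite uh.2 !vK.
have vE : sigma_epi v by split=> // b; exists (u b).
set Z := zassenhausN p H i in u uh v uK vK vC vh vE.
set Z' := zassenhausN p H' i in u uh v uK vK vC vh vE.
have Z_pro : pro_p p (quot Z) by apply: quot_pro_p => //; exact: zassenhaus_closed.
have phiZ x : ns_set Z x -> phi x = 1.
  move=> Zx; apply: Dj; apply: (zassenhaus_hom phiE.1.1).
  exact: (zassenhaus_decr p_pr ji).
have [phib phibh phibE] := quot_factor phiE.1 phiZ.
have phibEpi : sigma_epi phib.
  by split=> // b; have [x <-] := phiE.2 b; exists (qpi _ x).
pose w : H' -> quot Z := v \o qpi Z'.
have wE : sigma_epi w by exact: sigma_epi_comp (qpi_sigma_epi _) vE.
pose phi' := phib \o w; have phi'E : sigma_epi phi' by exact: sigma_epi_comp wE phibEpi.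
have [rho' rho'h rho'k] :=
  free_sigma_lift p_pr p_gt2 H'_pro Q_pro phi'E.1 phi'E.2 kappa_epi.1.
have rho'E : sigma_epi rho'.
  split=> //; apply: (free_epi_criterion (phi := phi') p_pr H'_pro rho'h.1 _ _ e_indep).
    move=> f f1; pose fb (a : quot Z') := f (repr a).
    have fbE x : fb (qpi Z' x) = f x.
      have [z Zz zE] := repr_qpi Z' x.
      by rewrite /fb zE f1.1 (H1_zassenhaus p_pr f1 i2 Zz) addr0.
    have fb1 : H1 fb.
      split=> [|b]; first by apply: quotP => x; apply: quotP => y; rewrite -qpiM !fbE f1.1.
      rewrite quot_openE (_ : _ @^-1` _ = f @^-1` [set b]); first exact: f1.2.
      by apply/seteqP; split=> x /=; rewrite fbE.
    have uqh : hom (u \o qpi Z) by exact: (sigma_hom_comp (qpi_sigma_epi Z).1 uh).1.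
    have [c cE] := H1_descend rhoE phiE (H1_comp fb1 uqh).
    exists c; apply/funext => x; rewrite -fbE -(vK (qpi Z' x)) -[v _](qreprK (N := Z)).
    rewrite -[LHS]/((fb \o (u \o qpi Z)) (repr (v (qpi Z' x)))) cE.
    by apply: eq_bigr => l _; rewrite /phi' /= /w /= -phibE qreprK.
  by move=> b; have [a <-] := kappa_epi.2 b; exists a; rewrite rho'k.
exists rho', phi'; split=> // x; split=> [px|[d Dd <-]]; last by rewrite rho'k kappaD.
(* Both maps are surjections of F_n onto H / D_i(H), so they send D to the same subgroup. Hence ker
   phi' is rho'(D) up to D_i(H'). *)
have wD : (qpi Z \o rho) @` D = (w \o rho') @` D.
  apply: (image_D_unique Z_pro phibEpi).
    exact: sigma_epi_comp rhoE (qpi_sigma_epi _).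
  exact: sigma_epi_comp rho'E wE.
have dec y : phi' y = 1 -> exists2 d, ns_set D d & ns_set Z' ((rho' d)^-1 * y).
  move=> py; have /rhoK[d0 Dd0 hd0] : phi (repr (w y)) = 1 by rewrite -phibE qreprK.
  have : ((w \o rho') @` D) (w y).
    by rewrite -wD; exists d0 => //=; rewrite hd0 qreprK.
  case=> d Dd /= /(congr1 u); rewrite /w /= !vK => /qpiP Zd.
  by exists d.
pose I := imageN (epi_of rho'E) D.
have X_pro : pro_p p (quot I).
  apply: quot_pro_p => //; apply: image_closed D_closed; last exact: rho'h.1.
    by case: (F_pro n).
  by case: H'_pro.
have [|phiX phiXh phiXE] := @quot_factor _ _ I phi' phi'E.1.
  by move=> _ [d Dd <-]; rewrite /= rho'k kappaD.
have qD d y : ns_set D d -> qpi I y = qpi I ((rho' d)^-1 * y).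
  move=> Dd; rewrite qpiM (_ : qpi I (rho' d)^-1 = 1) ?mul1g//.
  rewrite -(gmorph1 (@qpiM _ I)); apply/esym/qpiP; rewrite invg1 mul1g.
  by exists d^-1; [have [_ _ DV] := ns_subgroup D; exact: DV|exact: gmorphV rho'h.1.1 d].
have qZ y : ns_set Z' y -> zassenhaus p (quot I) i (qpi I y).
  by move=> Zy; apply: (zassenhaus_hom (qpi_sigma_epi I).1.1).
have Xj : zassenhaus p (quot I) j `<=` [set 1].
  apply: zassenhaus_stable => //; apply: quotP => y Dy.
  have [d Dd Zd] : exists2 d, ns_set D d & ns_set Z' ((rho' d)^-1 * y).
    by apply: dec; rewrite -phiXE; apply: Dj; exact: (zassenhaus_hom phiXh.1).
  by rewrite (qD d)//; exact: qZ.
have [d Dd Zd] := dec x px.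
have : qpi I x = 1 by rewrite (qD d)//; apply: Xj; apply: (zassenhaus_decr p_pr ji); exact: qZ.
by rewrite -(gmorph1 (@qpiM _ I)) => /esym/qpiP; rewrite invg1 mul1g.
Qed.

End FixedQuotient.

(** * Classes in Sch and the conclusion *)

Lemma finite_discrete (X : topologicalType) : hausdorff_space X -> finite_set [set: X] ->
  forall A : set X, open A.
Proof.
move=> hX fX A; rewrite -[A]setCK openC; apply: compact_closed => //.
by apply: finite_compact; exact: sub_finite_set fX.
Qed.

Lemma finite_set_enum (T : Type) (A : set T) : finite_set A ->
  exists (q : nat) (t : 'I_q -> T), injective t /\ forall x, A x <-> exists i, t i = x.
Proof.
move=> /finite_setP[q /card_set_bijP[f [fS fI fJ]]].
have /choice[t tP] : forall i : 'I_q, exists x, A x /\ f x = i.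
  by move=> i; have [x Ax fx] := fJ i (ltn_ord i); exists x.
exists q, t; split=> [i j e|x].
  by apply: val_inj; rewrite /= -(tP i).2 -(tP j).2 e.
split=> [Ax|[i <-]]; last exact: (tP i).1.
exists (Ordinal (fS x Ax)); apply: fI; rewrite ?inE//; first exact: (tP _).1.
by rewrite (tP _).2.
Qed.

Section Classes.
Variables (p : nat) (F : forall n : nat, freeSigma p n).

Lemma group_of_class (u : presentation F) : sigma_isomorphic (Gr u) (group_of (class_of u)).
Proof.
have /(@eqmodP _ (pres_equiv F))/asboolP : class_of u = class_of (repr (class_of u)).
  by rewrite /class_of reprK.
exact.
Qed.

Lemma group_of_pro_p (c : Sch F) : prime p -> pro_p p (group_of c).
Proof.
move=> p_pr; apply: quot_pro_p => //; last exact: relator_closed.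
exact: (free_gen_free _).1.
Qed.

Lemma group_of_weak_Schur (c : Sch F) : prime p -> weak_Schur F (group_of c).
Proof.
move=> p_pr; split; first exact: group_of_pro_p.
by exists (repr c); exact: sigma_isomorphic_refl.
Qed.

Lemma U_basic_open i (G : sigmaGroupType) : (2 <= i)%N -> weak_Schur F G ->
  open (U_basic (F := F) i G).
Proof.
move=> i2 GS; exists [set U_basic (F := F) i G]; last by rewrite bigcup_set1.
move=> _ ->; apply: (@finI_from1 _ _ _ id); by exists i, G.
Qed.

End Classes.

Theorem proposition10p14
  (R : realType) (p : nat) (p_prime : prime p) (p_gt2 : (2 < p)%N)
  (F : forall n : nat, freeSigma p n)
  (haar : forall n : nat, probability (borel_minus (F n)) R)
  (haarP : forall n : nat, is_haar (haar n))
  (n : nat) (D : sigmaNormal (F n))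
  (D_closed : closed (D : set (F n)))
  (D_frattini : D `<=` frattini (F n))
  (D_Aut : forall f, Aut_sigma (F n) f -> f @` D = D)
  (G : sigmaGroupType) (G_Schur : weak_Schur F G) (d_G : dim_H1 p G n)
  (pi : sigmaEpi (F n) G)
  (GD_finite : finite_set [set: quot (imageN pi D)])
  (D_comm : D `<=` comm_subgroup [set: F n] [set: F n]) :
  open (U_D D pi) /\ closed (U_D D pi) /\
  mu_infty haar (U_D D pi) =
    ((C_infty p R / (#|` fset_set (Aut_sigma (quot (imageN pi D)))|)%:R)%R)%:E.
Proof.
have [G_pro [[N rN] Giso]] := G_Schur.
pose Q : sigmaGroupType := quot (imageN pi D).
have piE := sigmaEpi_epi pi.
have Q_pro : pro_p p Q.
  apply: quot_pro_p => //; apply: image_closed D_closed; last exact: piE.1.1.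
    by case: (free_gen_free (F n)) => -[].
  by case: G_pro.
have Q_discrete : forall A : set Q, open A.
  by apply: finite_discrete => //; case: Q_pro.
pose kappa : F n -> Q := qpi (imageN pi D) \o pi.
have kappaE : sigma_epi kappa by exact: sigma_epi_comp piE (qpi_sigma_epi _).
have kappaD d : ns_set D d -> kappa d = 1.
  move=> Dd; rewrite -(gmorph1 (@qpiM _ (imageN pi D))); apply/esym/qpiP.
  by rewrite invg1 mul1g; exists d.
have [e0 e01 e0b] := d_G.
(* A basis of H^1(G) descends to Q because D consists of products of commutators up to closure,
   which homomorphisms to F_p kill. *)
pose e i (a : Q) := e0 i (repr a).
have eE i x : e i (qpi (imageN pi D) x) = e0 i x.
  have [z [d Dd <-] zE] := repr_qpi (imageN pi D) x.
  rewrite /e zE (e01 i).1; have /H1_lc_hom fl := H1_comp (e01 i) piE.1.1.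
  by have /= -> := lc_hom_comm fl (D_comm d Dd); rewrite addr0.
have e1 i : H1 (e i).
  split=> [|b].
    by apply: quotP => x; apply: quotP => y; rewrite -qpiM !eE (e01 i).1.
  rewrite quot_openE (_ : _ @^-1` _ = e0 i @^-1` [set b]); first exact: (e01 i).2.
  by apply/seteqP; split=> x /=; rewrite eE.
have e_indep : H1_independent e.
  move=> c c0; have [c' [_ cU]] := e0b _ (H1_0 p G).
  suff ec : finfun c = 0%R by move=> i; have /ffunP/(_ i) := ec; rewrite !ffunE.
  rewrite -(cU (finfun c)); last first.
    apply/funext => x; rewrite -[LHS](c0 (qpi _ x)).
    by apply: eq_bigr => i _; rewrite ffunE eE.
  apply: cU; apply/funext => x; rewrite big1// => i _.
  by rewrite ffunE mul0r.
have [q [tq [tq_inj tqP]]] := finite_set_enum (sub_finite_set (@subsetT _ (minus Q)) GD_finite).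
have UE c : U_D D pi c <-> has_quotient D Q (group_of c).
  rewrite -(has_quotientP p_prime D Q_discrete e1 e_indep); last exact: group_of_pro_p.
  by [].
have GQ : has_quotient D Q G.
  exists pi, (qpi (imageN pi D)); split=> [//||h]; first exact: qpi_sigma_epi.
  rewrite -(gmorph1 (@qpiM _ (imageN pi D))).
  split=> [/esym/qpiP|Dh]; first by rewrite invg1 mul1g.
  by apply/esym/qpiP; rewrite invg1 mul1g.
have QP m (r : m.-tuple (minusT (F m))) :=
  has_quotient_presents p_prime p_gt2 D Q_pro kappaE e1 e_indep r.
(* The presentation of G as a weak Schur group is the witness that fixes the sign and the dimension
   bound. *)
have [phiN [phiNE rNp]] := (QP N rN).1 (has_quotient_iso Giso GQ).
have [i i2 iP] := has_quotient_local p_prime p_gt2 D_closed D_Aut Q_pro kappaE kappaD e1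
  e_indep GD_finite.
(* A set that depends only on the level-i quotient is a union of basic open sets; this is applied to
   U_D and to its complement. *)
have nbU (A : set (Sch F)) :
    (forall c d, sigma_isomorphic (quot (zassenhausN p (group_of c) i))
       (quot (zassenhausN p (group_of d) i)) -> A c -> A d) -> open A.
  move=> AP; rewrite (_ : A = \bigcup_(c in A) U_basic (F := F) i (group_of c)).
    by apply: bigcup_open => c _; apply: U_basic_open => //; exact: group_of_weak_Schur.
  apply/seteqP; split=> [c Ac|d [c Ac dc]].
    by exists c => //; exact: sigma_isomorphic_refl.
  exact: AP (sigma_isomorphic_sym dc) Ac.
have UP c d : sigma_isomorphic (quot (zassenhausN p (group_of c) i))
    (quot (zassenhausN p (group_of d) i)) -> U_D D pi c -> U_D D pi d.
  by move=> cd /UE Uc; apply/UE; apply: iP cd Uc; exact: group_of_pro_p.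
split; first exact: nbU.
split.
  rewrite -[U_D D pi]setCK closedC; apply: nbU => c d cd nUc Ud.
  exact/nUc/(UP _ _ (sigma_isomorphic_sym cd)).
rewrite /mu_infty (_ : mu haar ^~ _ = fun m => power_prob (haar m) m (@presented p F n D Q m)).
  apply: cvg_lim => //.
  exact: (presented_prob_cvg p_prime p_gt2 D_closed D_Aut D_comm Q_discrete Q_pro kappaE kappaD
    e1 e_indep phiNE rNp haarP tq_inj tqP).
apply/funext => m; congr (power_prob _ _ _); apply/seteqP.
have isoP (r : m.-tuple (minusT (F m))) :=
  group_of_class (F := F) (existT (fun n => n.-tuple (minusT (F n))) m r).
split=> r; first by move=> /UE /(has_quotient_iso (sigma_isomorphic_sym (isoP r))) /QP.
by move=> /QP /(has_quotient_iso (isoP r)) /UE.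
Qed.
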